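(* There exist a (large enough) absolute constant $C>0$ and absolute constants $K,c_0,c_1>0$ such that the following holds for all integers $1\le d\le n$, all $\delta\in(0,1/2)$ and all $\theta\in\mathbf{R}^d$ with $\|\theta\|^2\le 1$. Let $M$ be the greatest integer with $2^Md\le n$, let $g_i=2^i d$ for $i=0,1,\dots,M$, and define $$\tilde{m}= \min\Big\{m\in \{0,1,\ldots,M\}:\; L^2(\tilde{\theta}(g_j),\tilde{\theta}(g_{j-1}))\leq 4 C^2 \Big(\frac{\sqrt{d g_j}}{n}\wedge\frac{d g_j}{n^2\|\tilde\theta(g_j) \|^2 }\Big)\ \text{for all } m+1\le j\le M\Big\},$$ and $\tilde\ell=g_{\tilde m}=2^{\tilde m}d$. Then, with probability at least $1-c_1\log(en/d)\,e^{-c_0 d}$, the estimator $\tilde\theta(\tilde\ell)$ satisfies $$ L^2(\tilde{\theta}(\tilde{\ell}),\theta) \le K\left(\sqrt{\frac{\delta d }{n}} + \frac{d}{n}\right). $$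
   Context: Model. For $i=1,\dots,n$ one observes $Y_i=\eta_i\theta+\xi_i\in\mathbf{R}^d$, where $\theta\in\mathbf{R}^d$ is unknown, $\eta_1$ is a Rademacher variable, $(\eta_i)$ is a homogeneous Markov chain on $\{-1,1\}$ with $\eta_{i+1}=\eta_i$ with probability $1-\delta$ and $\eta_{i+1}=-\eta_i$ with probability $\delta$, $\delta\in(0,1/2)$ (unknown), and $\xi_1,\dots,\xi_n$ are i.i.d. isotropic ($\mathbf{E}\,\xi_i\xi_i^\top=\mathbf{I}_d$) $1$-sub-Gaussian vectors, independent of $\eta$. A random vector $\omega\in\mathbf{R}^d$ is $1$-sub-Gaussian if $\mathbf{E}\exp(\langle v,\omega\rangle)\le\exp(\|v\|^2/2)$ for all $v\in\mathbf{R}^d$. Absolute constants do not depend on $n,d,\delta,\theta$ or the noise distribution. Notation. $a\wedge b=\min(a,b)$, $\|\cdot\|$ is the Euclidean norm, $x_+=\max(x,0)$; a ratio with zero denominator and positive numerator is read as $+\infty$. The loss is $L(u,v)=\min\{\|u-v\|,\|u+v\|\}$ for $u,v\in\mathbf{R}^d$. Estimator. For a number of buckets $\ell\in\{1,\dots,n\}$ let $k=\lfloor n/\ell\rfloor$ and divide the indices $1,\dots,k\ell$ into $\ell$ consecutive blocks $I_1,\dots,I_\ell$ of length $k$ (so all observations are used when $n=k\ell$). Set $\tilde Y_i=\frac1k\sum_{j\in I_i}Y_j$, let $\tilde Y\in\mathbf{R}^{d\times\ell}$ be the matrix with columns $\tilde Y_i$, and $\hat\Sigma=\frac1\ell\tilde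 Y\tilde Y^\top$. Let $\lambda_{max}(\hat\Sigma)$ and $v_{max}(\hat\Sigma)$ be its top eigenvalue and a corresponding unit eigenvector. The estimator is $$\tilde{\theta}(\ell) = \sqrt{\Big(\lambda_{max}(\hat{\Sigma})-\frac{1}{k}\Big)_+}\; v_{max}(\hat{\Sigma}),$$ and $\tilde\theta(\tilde\ell)$ denotes this family evaluated at the data-dependent value $\tilde\ell$. *)

(* Defs.v *)
From HB Require Import structures.
From mathcomp Require Import all_boot all_order all_algebra.
From mathcomp Require Import all_classical all_reals all_analysis.

Set Implicit Arguments.
Unset Strict Implicit.
Unset Printing Implicit Defensive.
Import Order.TTheory GRing.Theory Num.Theory.
Import numFieldNormedType.Exports.

Local Open Scope classical_set_scope.
Local Open Scope ring_scope.

(* The library norm on matrices is the max-norm, hence these. *)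
Definition dotp (R : realType) (d : nat) (u v : 'cV[R]_d) : R :=
  \sum_(a < d) u a 0 * v a 0.

Definition enorm (R : realType) (d : nat) (u : 'cV[R]_d) : R :=
  Num.sqrt (dotp u u).

Definition loss (R : realType) (d : nat) (u v : 'cV[R]_d) : R :=
  Num.min (enorm (u - v)) (enorm (u + v)).

Definition mutually_independent (R : realType) (disp : measure_display)
    (T : measurableType disp) (P : probability T R) (n : nat)
    (F : 'I_n -> set (set T)) : Prop :=
  forall (J : {set 'I_n}) (A : 'I_n -> set T),
    (forall i, i \in J -> F i (A i)) ->
    P (\bigcap_(i in [set` J]) A i) = (\prod_(i in J) P (A i))%E.

Definition independent2 (R : realType) (disp : measure_display)
    (T : measurableType disp) (P : probability T R) (F G : set (set T)) : Prop :=
  forall A B, F A -> G B -> P (A `&` B) = (P A * P B)%E.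

(* Indices start at 0.  The Markov property is the product form of
   P(eta_{i+1} = s_{i+1} | eta_j = s_j, j <= i) = p(s_i, s_{i+1}), which is
   void when the conditioning event is null. *)
Definition sign_chain (R : realType) (disp : measure_display)
    (T : measurableType disp) (P : probability T R) (n : nat) (delta : R)
    (eta : 'I_n -> {RV P >-> R}) : Prop :=
  let path_event (s : 'I_n -> R) (i : 'I_n) : set T :=
    [set w | forall j : 'I_n, (j <= i)%N -> eta j w = s j] in
  [/\ forall i w, eta i w = 1 \/ eta i w = -1,
      forall i : 'I_n, i = 0%N :> nat ->
        P [set w | eta i w = 1] = (2^-1)%:E /\
        P [set w | eta i w = -1] = (2^-1)%:E
    & forall s : 'I_n -> R, (forall i, s i = 1 \/ s i = -1) ->
        forall i j : 'I_n, j = i.+1 :> nat ->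
        P (path_event s j) =
          (P (path_event s i) *
           (if s j == s i then 1 - delta else delta)%:E)%E].

Definition col_of_tuple (R : realType) (d : nat) (t : d.-tuple R) : 'cV[R]_d :=
  \col_a tnth t a.

Definition isotropic (R : realType) (disp : measure_display)
    (T : measurableType disp) (P : probability T R) (d : nat)
    (xi : T -> 'cV[R]_d) : Prop :=
  forall a b : 'I_d,
    ('E_P[fun w => (xi w a 0 * xi w b 0)%R] = ((1%:M : 'M[R]_d) a b)%:E)%E.

Definition subgaussian1 (R : realType) (disp : measure_display)
    (T : measurableType disp) (P : probability T R) (d : nat)
    (xi : T -> 'cV[R]_d) : Prop :=
  forall v : 'cV[R]_d,
    ('E_P[fun w => expR (dotp v (xi w))] <= (expR (enorm v ^+ 2 / 2))%:E)%E.

(* Random vectors are random variables with values in d.-tuple R, which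
   carries the product (Borel) sigma-algebra. *)
Definition noise_model (R : realType) (disp : measure_display)
    (T : measurableType disp) (P : probability T R) (n d : nat)
    (xi : 'I_n -> {RV P >-> d.-tuple R}) : Prop :=
  [/\ mutually_independent P (fun i => g_sigma_algebra_preimage (xi i)),
      forall (i j : 'I_n) (B : set (d.-tuple R)), measurable B ->
        distribution P (xi i) B = distribution P (xi j) B,
      forall i, isotropic P (fun w => col_of_tuple (xi i w))
    & forall i, subgaussian1 P (fun w => col_of_tuple (xi i w))].

Definition observation (R : realType) (disp : measure_display)
    (T : measurableType disp) (P : probability T R) (n d : nat)
    (eta : 'I_n -> {RV P >-> R}) (xi : 'I_n -> {RV P >-> d.-tuple R})
    (theta : 'cV[R]_d) (w : T) (i : 'I_n) : 'cV[R]_d :=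
  eta i w *: theta + col_of_tuple (xi i w).

(* With 0-based indices the i-th block is {i * k, ..., (i + 1) * k - 1}. *)
Definition block_means (R : realType) (n d : nat) (Y : 'I_n -> 'cV[R]_d)
    (l : nat) : 'M[R]_(d, l) :=
  let k := (n %/ l)%N in
  \matrix_(a < d, i < l)
    (k%:R^-1 * \sum_(j < n | (i * k <= j < i.+1 * k)%N) Y j a 0).

Definition sigma_hat (R : realType) (n d : nat) (Y : 'I_n -> 'cV[R]_d)
    (l : nat) : 'M[R]_d :=
  l%:R^-1 *: (block_means Y l *m (block_means Y l)^T).

(* eigenvalue is about left eigenvectors and sup is that of R; for symmetric S
   and 0 < d this is the maximum of the (nonempty, finite) set of eigenvalues. *)
Definition lambda_max (R : realType) (d : nat) (S : 'M[R]_d) : R :=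
  sup [set a | eigenvalue S a].

(* vmax is any selection of unit top eigenvectors: the eigenvector is never
   unique (sign) and no measurability is required. *)
Definition top_eigenvector (R : realType) (d : nat)
    (vmax : 'M[R]_d -> 'cV[R]_d) : Prop :=
  forall S : 'M[R]_d, S^T = S ->
    S *m vmax S = lambda_max S *: vmax S /\ enorm (vmax S) = 1.

Definition theta_tilde (R : realType) (n d : nat)
    (vmax : 'M[R]_d -> 'cV[R]_d) (Y : 'I_n -> 'cV[R]_d) (l : nat) : 'cV[R]_d :=
  let S := sigma_hat Y l in
  let k := (n %/ l)%N in
  Num.sqrt (Num.max (lambda_max S - k%:R^-1) 0) *: vmax S.

Definition grid (d i : nat) : nat := (2 ^ i * d)%N.

(* Division in \bar R: x / 0 = +oo for x > 0. *)
Definition threshold (R : realType) (n d : nat)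
    (vmax : 'M[R]_d -> 'cV[R]_d) (Y : 'I_n -> 'cV[R]_d) (l : nat) : \bar R :=
  Order.min
    (Num.sqrt (d * l)%N%:R / n%:R)%:E
    ((d * l)%N%:R%:E / (n%:R ^+ 2 * enorm (theta_tilde vmax Y l) ^+ 2)%:E)%E.

Definition admissible (R : realType) (n d : nat) (C : R)
    (vmax : 'M[R]_d -> 'cV[R]_d) (Y : 'I_n -> 'cV[R]_d) (M m : nat) : bool :=
  [forall j : 'I_M.+1, (m < j)%N ==>
    (((loss (theta_tilde vmax Y (grid d j))
            (theta_tilde vmax Y (grid d j.-1))) ^+ 2)%:E
       <= (4 * C ^+ 2)%:E * threshold vmax Y (grid d j))%E].

(* m = M is always admissible, so the minimum is over a nonempty set. *)
Definition m_tilde (R : realType) (n d : nat) (C : R)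
    (vmax : 'M[R]_d -> 'cV[R]_d) (Y : 'I_n -> 'cV[R]_d) (M : nat) : nat :=
  [arg min_(m < (ord_max : 'I_M.+1) | admissible C vmax Y M m) (m : nat)]%N.

Definition l_tilde (R : realType) (n d : nat) (C : R)
    (vmax : 'M[R]_d -> 'cV[R]_d) (Y : 'I_n -> 'cV[R]_d) (M : nat) : nat :=
  grid d (m_tilde C vmax Y M).

(* Main.v *)
Require Import Defs.
From HB Require Import structures.
From mathcomp Require Import all_boot all_order all_algebra.
From mathcomp Require Import all_classical all_reals all_analysis.
From mathcomp Require Import measurable_realfun.
From mathcomp Require Import ring lra zify.

(** The estimators are compared with [theta_star = theta + Ws], where
    [Ws = (1/n) sum_j eta_j xi_j]: this is the mean of the observations after
    correction by the unknown signs, and its distance to [theta] is of order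
    [sqrt (d/n)], which the rate allows.

    For [l] buckets of length [k], let [a] be the average of the squared block means
    of the signs. The matrix [sigma_hat - I/k] is [theta_star theta_star^T] up to an
    error of operator norm [(1-a) |theta|^2 + |theta| |W - Ws| + s], up to constants,
    where [s = sqrt (d l) / n] is the deviation of the noise covariance and [W] is the
    noise term of the block estimator ([theta_tilde_error]). The squared norm of
    [W - Ws] is of order [(1-a) d/n + s^2], because the squares of the weights of
    [W - Ws] sum to at most [(1-a)/n + 2 l/n^2] ([sum_sqr_block_coef]); thus it does
    not spoil the balance between bias and noise. The perturbation bound
    [spectral_perturbation] yields that the squared loss between the estimator and
    [theta_star] is at most a constant times the bias [(1-a)^2 |theta|^2] plus the
    noise [s^2 / (s + |theta_star|^2)].

    A block without flip has mean sign 1 or -1, so [1 - a] is at most the number of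
    flips divided by [l]. The number of flips is at most [q = 2 delta n + 2 d] outside
    an event of probability [e^-d] ([flips_tail]). On the finest grid point the blocks
    are singletons and there is no bias. The deviation bounds for the noise
    ([linear_tail], [quadratic_tail]) are Chernoff bounds in the directions of a finite
    net of the unit ball ([ball_net]); those whose weights depend on the signs are
    applied conditionally on the sign pattern ([conditional_union_bound]). A union
    bound over the at most [1 + log2 (n/d)] grid points gives the stated probability
    ([favourable_event]).

    On this event the rest is deterministic. The selection rule is at least as good as
    the smallest number of buckets from which on the noise dominates the bias
    ([lepski_oracle]), and at the grid point before it the bias is at most
    [(q/l)^2 |theta|^2] and exceeds the noise [N]. Since [N^2] is then of order
    [q d / n^2], the noise is of order [sqrt (delta d / n) + d / n]
    ([oracle_rate_algebra]). *)

Import Order.TTheory GRing.Theory Num.Theory.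
Import numFieldNormedType.Exports.
Local Open Scope classical_set_scope.
Local Open Scope ring_scope.

Set Implicit Arguments.
Unset Strict Implicit.
Unset Printing Implicit Defensive.

(** * Euclidean geometry *)

Lemma dotpC (R : realType) d (u v : 'cV[R]_d) : dotp u v = dotp v u.
Proof. by apply: eq_bigr => a _; rewrite mulrC. Qed.

Lemma dotpDl (R : realType) d (u v w : 'cV[R]_d) :
  dotp (u + v) w = dotp u w + dotp v w.
Proof. by rewrite -big_split; apply: eq_bigr => a _; rewrite mxE mulrDl. Qed.

Lemma dotpZl (R : realType) d c (u v : 'cV[R]_d) :
  dotp (c *: u) v = c * dotp u v.
Proof. by rewrite mulr_sumr; apply: eq_bigr => a _; rewrite mxE mulrA. Qed.

Lemma dotpDr (R : realType) d (u v w : 'cV[R]_d) :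
  dotp w (u + v) = dotp w u + dotp w v.
Proof. by rewrite dotpC dotpDl !(dotpC w). Qed.

Lemma dotpZr (R : realType) d c (u v : 'cV[R]_d) :
  dotp u (c *: v) = c * dotp u v.
Proof. by rewrite dotpC dotpZl dotpC. Qed.

Lemma dotpNl (R : realType) d (u v : 'cV[R]_d) : dotp (- u) v = - dotp u v.
Proof. by rewrite -scaleN1r dotpZl mulN1r. Qed.

Lemma dotpNr (R : realType) d (u v : 'cV[R]_d) : dotp u (- v) = - dotp u v.
Proof. by rewrite -scaleN1r dotpZr mulN1r. Qed.

Lemma dotp0l (R : realType) d (u : 'cV[R]_d) : dotp 0 u = 0.
Proof. by rewrite -(scale0r 0) dotpZl mul0r. Qed.

Definition dotpE := (dotpDl, dotpDr, dotpNl, dotpNr, dotpZl, dotpZr).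

Lemma dotp_suml (R : realType) d (I : Type) (r : seq I) (P : pred I)
    (F : I -> 'cV[R]_d) (v : 'cV[R]_d) :
  dotp (\sum_(i <- r | P i) F i) v = \sum_(i <- r | P i) dotp (F i) v.
Proof.
by apply: (big_morph (fun u => dotp u v) (fun x y => dotpDl x y v) (dotp0l v)).
Qed.

Lemma dotp_sumr (R : realType) d (I : Type) (r : seq I) (P : pred I)
    (F : I -> 'cV[R]_d) (v : 'cV[R]_d) :
  dotp v (\sum_(i <- r | P i) F i) = \sum_(i <- r | P i) dotp v (F i).
Proof. by rewrite dotpC dotp_suml; apply: eq_bigr => i _; exact: dotpC. Qed.

Lemma dotp_ge0 (R : realType) d (u : 'cV[R]_d) : 0 <= dotp u u.
Proof. by apply: sumr_ge0 => a _; rewrite -expr2 sqr_ge0. Qed.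

Lemma dotp_eq0 (R : realType) d (u : 'cV[R]_d) : (dotp u u == 0) = (u == 0).
Proof.
apply/idP/eqP => [|->]; last by rewrite dotp0l.
rewrite psumr_eq0 => [/allP u0|a _]; last by rewrite -expr2 sqr_ge0.
apply/colP => a; have /implyP/(_ isT) := u0 a (mem_index_enum _).
by rewrite mulf_eq0 orbb mxE => /eqP.
Qed.

Lemma dotp_mulmx (R : realType) d (A : 'M[R]_d) (u v : 'cV[R]_d) :
  dotp u (A *m v) = dotp (A^T *m u) v.
Proof.
rewrite /dotp; under eq_bigr do rewrite mxE mulr_sumr.
rewrite exchange_big; apply: eq_bigr => b _ /=.
rewrite mxE mulr_suml; apply: eq_bigr => a _; rewrite mxE; ring.
Qed.

Lemma enorm_ge0 (R : realType) d (u : 'cV[R]_d) : 0 <= enorm u.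
Proof. exact: sqrtr_ge0. Qed.

Lemma sqr_enorm (R : realType) d (u : 'cV[R]_d) : enorm u ^+ 2 = dotp u u.
Proof. by rewrite sqr_sqrtr ?dotp_ge0. Qed.

Lemma enorm0 (R : realType) d : enorm (0 : 'cV[R]_d) = 0.
Proof. by rewrite /enorm dotp0l sqrtr0. Qed.

Lemma enorm_eq0 (R : realType) d (u : 'cV[R]_d) : (enorm u == 0) = (u == 0).
Proof. by rewrite -dotp_eq0 -sqr_enorm sqrf_eq0. Qed.

Lemma enormN (R : realType) d (u : 'cV[R]_d) : enorm (- u) = enorm u.
Proof. by rewrite /enorm !dotpE opprK. Qed.

Lemma enormBC (R : realType) d (u v : 'cV[R]_d) : enorm (u - v) = enorm (v - u).
Proof. by rewrite -enormN opprB. Qed.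

Lemma enormZ (R : realType) d c (u : 'cV[R]_d) :
  enorm (c *: u) = `|c| * enorm u.
Proof. by rewrite /enorm !dotpE mulrA -expr2 sqrtrM ?sqr_ge0 // sqrtr_sqr. Qed.

(** The form [B] may be degenerate: for a null direction [y] the quadratic in the
    coefficient of [y] is affine, and nonnegativity makes its slope vanish. *)
Lemma psd_cauchy_schwarz (R : realType) d (B : 'M[R]_d) (x y : 'cV[R]_d) :
  B^T = B -> (forall z, 0 <= dotp z (B *m z)) ->
  dotp x (B *m y) ^+ 2 <= dotp x (B *m x) * dotp y (B *m y).
Proof.
move=> symB psdB.
have symE : dotp y (B *m x) = dotp x (B *m y) by rewrite dotp_mulmx symB dotpC.
set p := dotp x (B *m x); set q := dotp y (B *m y); set m := dotp x _.
have q0 : 0 <= q by exact: psdB.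
have quad s t : 0 <= s ^+ 2 * p + 2 * s * t * m + t ^+ 2 * q.
  have := psdB (s *: x + t *: y).
  rewrite mulmxDr -!scalemxAr !dotpE symE -/p -/q -/m.
  by congr (_ <= _); ring.
have [q_eq0|q_neq0] := eqVneq q 0.
  have [->|m0] := eqVneq m 0; first by rewrite expr0n q_eq0 mulr0.
  have := quad 1 (- (p + 1) / (2 * m)).
  have -> : 1 ^+ 2 * p + 2 * 1 * (- (p + 1) / (2 * m)) * m
      + (- (p + 1) / (2 * m)) ^+ 2 * q = -1 by rewrite q_eq0; field.
  by rewrite ler0N1.
have := quad q (- m).
have -> : q ^+ 2 * p + 2 * q * - m * m + (- m) ^+ 2 * q = q * (p * q - m ^+ 2).
  by ring.
by rewrite pmulr_rge0 ?subr_ge0 // lt_def q0 andbT.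
Qed.

Lemma cauchy_schwarz (R : realType) d (x y : 'cV[R]_d) :
  `|dotp x y| <= enorm x * enorm y.
Proof.
rewrite -ler_sqr ?nnegrE ?mulr_ge0 ?enorm_ge0 ?normr_ge0 // real_normK ?num_real //.
rewrite exprMn !sqr_enorm.
have := @psd_cauchy_schwarz R d 1%:M x y; rewrite !mul1mx; apply.
  by rewrite trmx1.
by move=> z; rewrite mul1mx dotp_ge0.
Qed.

Lemma enormD (R : realType) d (x y : 'cV[R]_d) : enorm (x + y) <= enorm x + enorm y.
Proof.
rewrite -ler_sqr ?nnegrE ?addr_ge0 ?enorm_ge0 // sqrrD !sqr_enorm !dotpE.
have := cauchy_schwarz x y; rewrite ler_norml (dotpC y) => /andP[_].
by nra.
Qed.

Lemma sqr_enormD_le (R : realType) d (x y : 'cV[R]_d) :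
  enorm (x + y) ^+ 2 <= 2 * enorm x ^+ 2 + 2 * enorm y ^+ 2.
Proof.
have h : enorm (x + y) ^+ 2 <= (enorm x + enorm y) ^+ 2.
  by rewrite ler_sqr ?nnegrE ?addr_ge0 ?enorm_ge0 ?enormD.
by apply: le_trans h _; have := sqr_ge0 (enorm x - enorm y); rewrite !expr2; lra.
Qed.

Lemma loss_ge0 (R : realType) d (u v : 'cV[R]_d) : 0 <= loss u v.
Proof. by rewrite le_min !enorm_ge0. Qed.

Lemma loss_sym (R : realType) d (u v : 'cV[R]_d) : loss u v = loss v u.
Proof. by rewrite /loss enormBC [u + v]addrC. Qed.

(** The loss is the distance on the quotient by the sign change; exhibiting the
    sign that achieves it reduces its properties to those of the norm. *)
Lemma lossE (R : realType) d (u v : 'cV[R]_d) :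
  exists2 e : R, e = 1 \/ e = -1 & loss u v = enorm (u - e *: v).
Proof.
rewrite /loss; case: leP => _; [exists 1|exists (-1)]; rewrite ?scale1r //.
- by left.
- by right.
- by rewrite scaleN1r opprK.
Qed.

Lemma loss_le (R : realType) d (u v : 'cV[R]_d) (e : R) :
  e = 1 \/ e = -1 -> loss u v <= enorm (u - e *: v).
Proof.
by rewrite /loss => -[] ->; rewrite ?scale1r ?scaleN1r ?opprK ge_min lexx ?orbT.
Qed.

Lemma loss_triangle (R : realType) d (u v w : 'cV[R]_d) :
  loss u w <= loss u v + loss v w.
Proof.
have [e he ->] := lossE u v; have [f hf ->] := lossE v w.
have hef : e * f = 1 \/ e * f = -1.
  by case: he hf => -> [] ->; rewrite ?mul1r ?mulN1r ?opprK; [left|right|right|left].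
apply: (le_trans (loss_le u w hef)).
have -> : u - (e * f) *: w = (u - e *: v) + e *: (v - f *: w).
  by rewrite scalerBr scalerA addrA subrK.
apply: (le_trans (enormD _ _)); rewrite enormZ.
by case: he => ->; rewrite ?normrN normr1 mul1r.
Qed.

Lemma loss_enorm (R : realType) d (u v : 'cV[R]_d) : enorm u <= enorm v + loss u v.
Proof.
have [e he ->] := lossE u v.
have -> : enorm v = enorm (e *: v).
  by rewrite enormZ; case: he => ->; rewrite ?normrN normr1 mul1r.
by rewrite -{1}(subrK (e *: v) u) addrC; exact: enormD.
Qed.

(** * Top eigenpairs of symmetric matrices *)

(** A crude bound, used only to know that suprema of quadratic forms over the
    unit ball are finite. *)
Lemma bilin_bound (R : realType) d (A : 'M[R]_d) :
  exists2 K, 0 <= K &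
    forall x y : 'cV[R]_d, `|dotp x (A *m y)| <= K * (enorm x * enorm y).
Proof.
have entry (x : 'cV[R]_d) a : `|x a 0| <= enorm x.
  rewrite -ler_sqr ?nnegrE ?normr_ge0 ?enorm_ge0 // real_normK ?num_real //.
  rewrite sqr_enorm /dotp (bigD1 a) //= -expr2 lerDl.
  by apply: sumr_ge0 => b _; rewrite -expr2 sqr_ge0.
exists (\sum_a \sum_b `|A a b|).
  by apply: sumr_ge0 => a _; apply: sumr_ge0 => b _.
move=> x y; rewrite /dotp mulr_suml.
apply: (le_trans (ler_norm_sum _ _ _)); apply: ler_sum => a _.
rewrite normrM mxE mulr_suml.
apply: (@le_trans _ _ (enorm x * \sum_b `|A a b| * enorm y)).
  apply: ler_pM => //.
  apply: (le_trans (ler_norm_sum _ _ _)); apply: ler_sum => b _.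
  by rewrite normrM ler_wpM2l.
rewrite mulr_sumr le_eqVlt; apply/orP; left; apply/eqP.
by apply: eq_bigr => b _; ring.
Qed.

(** The supremum [m] of the Rayleigh quotient is an eigenvalue: [m - S] is
    positive semidefinite, and an invertible positive semidefinite matrix is
    bounded below on the sphere by Cauchy-Schwarz, which contradicts the choice
    of [m]. Every eigenvalue is a Rayleigh quotient, so [m] is the largest one. *)
Lemma rayleigh_le_lambda_max (R : realType) d (S : 'M[R]_d) (x : 'cV[R]_d) :
  S^T = S -> dotp x (S *m x) <= lambda_max S * dotp x x.
Proof.
move=> symS.
have [->|x0] := eqVneq x 0; first by rewrite !dotp0l mulr0.
pose rq := [set dotp z (S *m z) | z in [set z : 'cV[R]_d | dotp z z = 1]].
have normalize (z : 'cV[R]_d) : z != 0 ->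
    exists2 q, rq q & dotp z (S *m z) = q * dotp z z.
  move=> z0; have ez : enorm z != 0 by rewrite enorm_eq0.
  exists (dotp ((enorm z)^-1 *: z) (S *m ((enorm z)^-1 *: z))).
    exists ((enorm z)^-1 *: z) => //=.
    by rewrite !dotpE -sqr_enorm; field.
  by rewrite -scalemxAr !dotpE -sqr_enorm; field.
have [K K0 hK] := bilin_bound S.
have ubK : ubound rq K.
  move=> _ [z z1 <-]; apply: le_trans (ler_norm _) _; apply: le_trans (hK _ _) _.
  by rewrite -expr2 sqr_enorm z1 mulr1.
have [q0 rq0 xq0] := normalize x x0.
have supq : has_sup rq by split; [exists q0|exists K].
set m := sup rq.
have le_m (z : 'cV[R]_d) : dotp z (S *m z) <= m * dotp z z.
  have [->|z0] := eqVneq z 0; first by rewrite !dotp0l mulr0.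
  have [q rqq ->] := normalize z z0.
  by rewrite ler_wpM2r ?dotp_ge0 //; apply: ub_le_sup => //; exists K.
suff eigm : eigenvalue S m.
  apply: le_trans (le_m x) _; rewrite ler_wpM2r ?dotp_ge0 //.
  apply: ub_le_sup => //; exists K => a /eigenvalueP[v vS v0].
  have hv : S *m v^T = a *: v^T.
    by rewrite -[in LHS]symS -trmx_mul vS linearZ.
  have v0' : v^T != 0 by rewrite -trmx0 (inj_eq trmx_inj).
  have [q rqq] := normalize _ v0'; rewrite hv dotpZr.
  move/(mulIf _) => -> //; last by rewrite dotp_eq0.
  exact: ubK.
pose B := m%:M - S.
have symB : B^T = B by rewrite /B linearB /= symS tr_scalar_mx.
have BE (y z : 'cV[R]_d) : dotp y (B *m z) = m * dotp y z - dotp y (S *m z).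
  by rewrite /B mulmxBl mul_scalar_mx !dotpE.
have psdB (z : 'cV[R]_d) : 0 <= dotp z (B *m z) by rewrite BE subr_ge0.
apply: contrapT => /negP; rewrite /eigenvalue /eigenspace => noneig.
have unitB : B \in unitmx.
  have : S - m%:M \in unitmx.
    by rewrite -row_free_unit -kermx_eq0; move: noneig; rewrite negbK.
  have -> : B = (-1) *: (S - m%:M) by rewrite scaleN1r opprB.
  by rewrite unitmxZ ?unitrN ?unitr1.
have [K1 K10 hK1] := bilin_bound (invmx B); have [K2 K20 hK2] := bilin_bound B.
(* dotp z (B z) >= |B z|^2 / K2 and |B z| >= |z| / K1 *)
have lower (z : 'cV[R]_d) : dotp z z = 1 -> 1 <= K1 ^+ 2 * K2 * dotp z (B *m z).
  move=> z1; set y := B *m z; have zE : z = invmx B *m y by rewrite mulKmx.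
  have ez : enorm z = 1 by rewrite /enorm z1 sqrtr1.
  have h1 : 1 <= K1 * enorm y.
    have := hK1 z y; rewrite -zE z1 normr1 ez mul1r; done.
  have h2 : enorm y ^+ 2 <= K2 * dotp z (B *m z).
    have := psd_cauchy_schwarz y z symB psdB; rewrite -/y -sqr_enorm => h.
    have h3 := hK2 y y; have {h3} h3 := le_trans (ler_norm _) h3.
    have y0 : 0 < enorm y.
      rewrite lt_def enorm_ge0 andbT; apply/eqP => y0; move: h1.
      by rewrite y0 mulr0 ler10.
    rewrite -(ler_pM2r (exprn_gt0 2 y0)).
    have := le_trans h (ler_wpM2r (psdB z) h3); rewrite -/y.
    by congr (_ <= _); ring.
  have h1' : 1 <= K1 ^+ 2 * enorm y ^+ 2.
    by rewrite -exprMn expr_ge1 // (le_trans ler01 h1).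
  by apply: le_trans h1' _; rewrite -mulrA ler_wpM2l ?sqr_ge0.
pose K3 := K1 ^+ 2 * K2 + 1.
have K30 : 0 < K3 by rewrite /K3 ltr_wpDl // mulr_ge0 // sqr_ge0.
have [q [y y1 qE] hz] := sup_adherent (divr_gt0 ltr01 K30) supq.
have := lower y y1; have := psdB y; rewrite BE y1 mulr1 => h0 h.
have : 1 <= K3 * (m - q).
  by rewrite -qE; apply: (le_trans h); rewrite ler_wpM2r // lerDl.
rewrite mulrC -ler_pdivrMr // lerBrDl => h1; move: hz.
by rewrite -/m ltrBlDr ltNge h1.
Qed.

(** Let [L] be the top eigenvalue minus [kappa], [c] the inner product of [u] with
    the eigenvector and [r] the length of [t]. The squared loss is
    [(r - c)^2 + (|u|^2 - c^2)]. Testing the error bound on [v] and the Rayleigh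
    inequality on [u] puts [L] and [c^2] within [D] of one another and [L] above
    [|u|^2 - D], which bounds both terms by multiples of [D]. When [D] is small
    compared with [|u|^2], testing on [v] and its component [p] orthogonal to [u]
    bounds the sine of the angle by [2 D / |u|^2], and each term gains a factor
    [D / |u|^2]. *)
Lemma spectral_perturbation (R : realType) d (S : 'M[R]_d) (kappa D : R)
    (u v : 'cV[R]_d) :
  S^T = S -> S *m v = lambda_max S *: v -> enorm v = 1 ->
  (forall x y, `|dotp x (S *m y) - kappa * dotp x y - dotp x u * dotp u y|
     <= D * (enorm x * enorm y)) ->
  let t := Num.sqrt (Num.max (lambda_max S - kappa) 0) *: v in
  loss t u ^+ 2 <= 3 * D /\ loss t u ^+ 2 * dotp u u <= 6 * D ^+ 2.
Proof.
move=> symS eigv nv hD; set L := lambda_max S - kappa; set r := Num.sqrt _ => t.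
pose X := dotp u u; have X0 : 0 <= X by exact: dotp_ge0.
have vv : dotp v v = 1 by rewrite -sqr_enorm nv expr1n.
pose e : R := if 0 <= dotp v u then 1 else -1.
have he : e = 1 \/ e = -1 by rewrite /e; case: ifP => _; [left|right].
pose c := e * dotp v u.
have e2 : e ^+ 2 = 1 by case: he => ->; rewrite ?sqrrN expr1n.
have c0 : 0 <= c.
  by rewrite /c /e; case: ifPn; rewrite ?mul1r // mulN1r -ltNge oppr_ge0 => /ltW.
have c2 : c ^+ 2 = dotp v u ^+ 2 by rewrite exprMn e2 mul1r.
have r0 : 0 <= r by exact: sqrtr_ge0.
have r2 : r ^+ 2 = Num.max L 0 by rewrite sqr_sqrtr // le_max lexx orbT.
have lossle : loss t u ^+ 2 <= (r - c) ^+ 2 + (X - c ^+ 2).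
  have : loss t u ^+ 2 <= enorm (t - e *: u) ^+ 2.
    by rewrite ler_sqr ?nnegrE ?enorm_ge0 ?loss_ge0 // loss_le.
  move/le_trans; apply; rewrite sqr_enorm /t !dotpE vv (dotpC u v) -/X.
  rewrite le_eqVlt; apply/orP; left; apply/eqP.
  transitivity (r ^+ 2 - 2 * r * c + e ^+ 2 * X); first by rewrite /c; ring.
  by rewrite e2; ring.
have Lc : `|L - c ^+ 2| <= D.
  have := hD v v; rewrite eigv dotpZr vv nv !mulr1 (dotpC u v) -expr2 -c2.
  by congr (`|_| <= _); rewrite /L; ring.
have D0 : 0 <= D by exact: le_trans (normr_ge0 _) Lc.
move: Lc; rewrite ler_norml => /andP[Lc1 Lc2].
have LX : X - D <= L.
  have [X_eq0|X_neq0] := eqVneq X 0; first by have := sqr_ge0 c; lra.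
  have Xp : 0 < X by rewrite lt_def X_neq0.
  have := hD u u; rewrite -[enorm u * _]expr2 sqr_enorm -/X ler_norml => /andP[h _].
  have := rayleigh_le_lambda_max u symS; rewrite -/X => h'.
  by rewrite -(ler_pM2r Xp) /L; lra.
have Xc : X - c ^+ 2 <= 2 * D by lra.
have rc1 : r ^+ 2 - c ^+ 2 <= D.
  by rewrite r2; case: (leP L 0) => hL; have := sqr_ge0 c; lra.
have rc2 : - D <= r ^+ 2 - c ^+ 2.
  by rewrite r2; case: (leP L 0) => hL; have := sqr_ge0 c; lra.
have first : loss t u ^+ 2 <= 3 * D.
  apply: (le_trans lossle).
  suff : (r - c) ^+ 2 <= D by lra.
  case: (leP r c) => h.
    have : 0 <= r * (c - r) by rewrite mulr_ge0 ?subr_ge0.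
    by move: rc2; rewrite !expr2; lra.
  have : 0 <= c * (r - c) by rewrite mulr_ge0 ?subr_ge0 // ltW.
  by move: rc1; rewrite !expr2; lra.
split=> //; rewrite -/X.
have [XD|XD] := leP X (2 * D).
  by have := ler_wpM2r X0 first; have := ler_wpM2l D0 XD; rewrite expr2; lra.
have Xp : 0 < X by lra.
have Lp : X / 2 <= L by lra.
have rL : r ^+ 2 = L by rewrite r2 max_l //; lra.
pose p := v - (dotp v u / X) *: u.
have pu : dotp p u = 0 by rewrite /p !dotpE -/X mulfVK ?subrr // gt_eqF.
have pv : dotp p v = 1 - c ^+ 2 / X.
  by rewrite c2 /p !dotpE vv (dotpC u v); field; rewrite gt_eqF.
have pp : dotp p p = 1 - c ^+ 2 / X.
  by rewrite -pv {2}/p dotpDr dotpNr dotpZr pu mulr0 subr0.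
have XP : X * dotp p p = X - c ^+ 2 by rewrite pp; field; rewrite gt_eqF.
have sinus : X * (X - c ^+ 2) <= 4 * D ^+ 2.
  have [p0|p0] := eqVneq (dotp p p) 0.
    by rewrite -XP p0 !mulr0 mulr_ge0 // sqr_ge0.
  have P0 : 0 < dotp p p by rewrite lt_def p0 dotp_ge0.
  have := hD p v; rewrite eigv dotpZr pu mul0r subr0 nv mulr1 -mulrBl -/L pv -pp.
  rewrite ger0_norm ?mulr_ge0 ?dotp_ge0 //; last by lra.
  rewrite -sqr_enorm expr2 mulrA ler_pM2r; last first.
    by rewrite lt_def enorm_ge0 andbT enorm_eq0 -dotp_eq0.
  move=> h; rewrite -XP -sqr_enorm.
  have h2 : X / 2 * enorm p <= D by apply: le_trans h; rewrite ler_wpM2r ?enorm_ge0.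
  have : (X / 2 * enorm p) ^+ 2 <= D ^+ 2.
    by rewrite ler_sqr ?nnegrE // mulr_ge0 ?enorm_ge0 // divr_ge0.
  by rewrite !exprMn !expr2; lra.
have cosinus : X * (r - c) ^+ 2 <= 2 * D ^+ 2.
  have h1 : (r - c) ^+ 2 * (r + c) ^+ 2 <= D ^+ 2.
    rewrite -exprMn -subr_sqr -[X in X <= _]real_normK ?num_real //.
    by rewrite ler_sqr ?nnegrE // ler_norml rc1 andbT lerNl; lra.
  have h2 : X / 2 <= (r + c) ^+ 2.
    by have := mulr_ge0 r0 c0; have := sqr_ge0 c; move: Lp; rewrite -rL !expr2; lra.
  by have := ler_wpM2l (sqr_ge0 (r - c)) h2; lra.
by have := ler_wpM2l X0 lossle; lra.
Qed.

(** Rescaling makes the two vectors equally long, so that the parallelogram law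
    loses no constant. *)
Lemma polarization (R : realType) d (Z : 'M[R]_d) (q : R) :
  Z^T = Z -> (forall x, `|dotp x (Z *m x)| <= q * dotp x x) ->
  forall x y, `|dotp x (Z *m y)| <= q * (enorm x * enorm y).
Proof.
move=> symZ hq x y.
have [->|x0] := eqVneq x 0; first by rewrite dotp0l normr0 enorm0 mul0r mulr0.
have [->|y0] := eqVneq y 0.
  by rewrite mulmx0 dotpC dotp0l normr0 enorm0 !mulr0.
have hx : 0 < enorm x by rewrite lt_def enorm_ge0 andbT enorm_eq0.
have hy : 0 < enorm y by rewrite lt_def enorm_ge0 andbT enorm_eq0.
set a := enorm x in hx *; set b := enorm y in hy *.
have symE : dotp y (Z *m x) = dotp x (Z *m y) by rewrite dotp_mulmx symZ dotpC.
have xx : dotp x x = a ^+ 2 by rewrite sqr_enorm.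
have yy : dotp y y = b ^+ 2 by rewrite sqr_enorm.
(* both sides of the parallelogram have length a * b *)
have := hq (b *: x + a *: y); have := hq (b *: x - a *: y).
rewrite !mulmxDr !mulmxN -!scalemxAr !dotpE symE (dotpC y x) xx yy !ler_norml.
move=> /andP[h1 h2] /andP[h3 h4].
have ab : 0 < a * b by rewrite mulr_gt0.
apply/andP; split; rewrite -(ler_pM2l ab); move: h1 h2 h3 h4;
rewrite !expr2; lra.
Qed.

(** * A net of the unit ball *)

Lemma sum_halves_le (R : realFieldType) B : \sum_(i < B) (2^-1 : R) ^+ i <= 2.
Proof.
suff -> : \sum_(i < B) (2^-1 : R) ^+ i = 2 - 2 * 2^-1 ^+ B.
  by rewrite lerBlDr lerDl mulr_ge0 // exprn_ge0.
elim: B => [|B IH]; first by rewrite big_ord0 expr0 mulr1 subrr.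
by rewrite big_ord_recr /= IH exprS; field.
Qed.

(** Weighting [z] by [prod_a 16 * 2^-(z a)] gives weight at least 1 to each
    counted [z], and the total weight factors over the coordinates into
    [(16 * 2 * 2) ^ d] at most. *)
Lemma card_small_l1 (B d : nat) :
  (#|[pred z : {ffun 'I_d -> bool * 'I_B} | \sum_a (z a).2 <= 4 * d]| <= 64 ^ d)%N.
Proof.
pose w (p : bool * 'I_B) : rat := 16 * 2^-1 ^+ p.2.
have w0 p : 0 <= w p by rewrite mulr_ge0 // exprn_ge0.
rewrite -(ler_nat rat) natrX -sum1_card natr_sum.
apply: (@le_trans _ _ (\sum_(z : {ffun 'I_d -> bool * 'I_B}) \prod_a w (z a))).
  rewrite [leRHS](bigID (mem [pred z : {ffun 'I_d -> bool * 'I_B} | (\sum_a (z a).2 <= 4 * d)%N])) /=.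
  rewrite -[leLHS]addr0; apply: lerD; last first.
    by apply: sumr_ge0 => z _; apply: prodr_ge0.
  apply: ler_sum => z; rewrite inE => hz.
  rewrite big_split /= prodr_const card_ord prodrXr.
  have -> : (1%N%:R : rat) = 16 ^+ d * 2^-1 ^+ (4 * d).
    by rewrite exprM -exprMn expr1n.
  by rewrite ler_pM2l ?exprn_gt0 // ler_wiXn2l.
rewrite -(bigA_distr_bigA (fun _ => w)) /= prodr_const card_ord.
have sum_ge0 : 0 <= \sum_p w p by apply: sumr_ge0.
have sum_le : \sum_p w p <= 64.
  rewrite -(pair_bigA _ (fun b i => w (b, i))) /= big_bool /= /w /= -mulr_sumr.
  have := @sum_halves_le rat B; lra.
apply: (lerXn2r d) sum_le; first by rewrite nnegrE.
by rewrite nnegrE ler0n.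
Qed.

(** The points are [z / (4 sqrt d)] with [z] integral. Rounding the coordinates of
    a point of the ball towards 0 keeps it in the ball, moves it by at most 1/4,
    and the l1 norm of the resulting [z] is at most [4 d], so that few [z] occur. *)
Lemma ball_net (R : realType) d : (0 < d)%N ->
  exists s : seq 'cV[R]_d, [/\ (size s <= 64 ^ d)%N,
    forall x, x \in s -> dotp x x <= 1 &
    forall u, dotp u u <= 1 -> exists2 x, x \in s & dotp (u - x) (u - x) <= 16^-1].
Proof.
move=> d0; have dR : 0 < d%:R :> R by rewrite ltr0n.
pose N : R := 4 * Num.sqrt d%:R.
have N0 : 0 < N by rewrite mulr_gt0 // sqrtr_gt0.
have N2 : N ^+ 2 = 16 * d%:R by rewrite exprMn sqr_sqrtr ?ler0n //; ring.
pose B := (4 * d).+1.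
pose Z := {ffun 'I_d -> bool * 'I_B}.
pose vec (z : Z) : 'cV[R]_d := \col_a ((-1) ^+ (z a).1 * (z a).2%:R / N).
pose A := [pred z : Z | (\sum_a (z a).2 <= 4 * d)%N].
exists [seq vec z | z <- enum A & dotp (vec z) (vec z) <= 1]; split.
- rewrite size_map; apply: leq_trans (card_small_l1 B d).
  by rewrite size_filter cardE; exact: count_size.
- by move=> x /mapP[z]; rewrite mem_filter => /andP[h _] ->.
move=> u u1.
pose i a := Num.truncn (N * `|u a 0|).
have iP a : (i a)%:R <= N * `|u a 0| < (i a).+1%:R.
  by apply: truncn_itv; rewrite mulr_ge0 // ltW.
have sumi : (\sum_a i a <= 4 * d)%N.
  rewrite -(ler_nat R) natr_sum natrM.
  apply: (@le_trans _ _ (\sum_(a < d) (2 + 2 * d%:R * (u a 0 * u a 0)))).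
    apply: ler_sum => a _; have /andP[h _] := iP a; apply: (le_trans h).
    (* 4 sqrt d |u a| <= 2 + 2 d |u a|^2 *)
    have := sqr_ge0 (Num.sqrt d%:R * `|u a 0| - 1).
    rewrite sqrrB exprMn sqr_sqrtr ?ler0n // real_normK ?num_real // /N expr1n.
    rewrite !expr2; lra.
  rewrite big_split /= sumr_const card_ord -mulr_sumr -/(dotp u u) -mulr_natr.
  by have := ler_wpM2l (ltW dR) u1; lra.
have iB a : (i a < B)%N.
  rewrite ltnS; apply: leq_trans sumi.
  by rewrite (bigD1 a) //= leq_addr.
pose z : Z := [ffun a => (u a 0 < 0, Ordinal (iB a))].
have vecE a : vec z a 0 = (-1) ^+ (u a 0 < 0)%R * ((i a)%:R / N).
  by rewrite mxE ffunE /= mulrA.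
have uE a : u a 0 = (-1) ^+ (u a 0 < 0)%R * `|u a 0|.
  by rewrite -numEsign.
have sgn2 a : ((-1) ^+ (u a 0 < 0)%R * (-1) ^+ (u a 0 < 0)%R : R) = 1.
  by rewrite -expr2 sqrr_sign.
have le_i a : (i a)%:R / N <= `|u a 0|.
  by have /andP[h _] := iP a; rewrite ler_pdivrMr // mulrC.
have ge_i a : `|u a 0| - (i a)%:R / N <= N^-1.
  have /andP[_ h] := iP a; rewrite -(ler_pM2l N0) mulrBr mulfV ?gt_eqF //.
  by rewrite mulrCA mulfV ?gt_eqF // mulr1 lerBlDr nat1r (ltW h).
exists (vec z).
  apply/mapP; exists z => //; rewrite mem_filter mem_enum inE; apply/andP; split.
    apply: le_trans u1; apply: ler_sum => a _.
    rewrite vecE mulrACA sgn2 mul1r -[u a 0 * u a 0]ger0_norm -?expr2 ?sqr_ge0 //.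
    rewrite expr2 [u a 0 ^+ 2]expr2 normrM.
    by apply: ler_pM => //; rewrite divr_ge0 ?ler0n // ltW.
  by apply: leq_trans sumi; rewrite leq_eqVlt; apply/orP; left; apply/eqP;
     apply: eq_bigr => a _; rewrite ffunE.
have -> : 16^-1 = \sum_(a < d) (N^-1 * N^-1).
  rewrite sumr_const card_ord -invfM -expr2 N2 -mulr_natr.
  by field; rewrite gt_eqF.
have rE a : (u - vec z) a 0 = (-1) ^+ (u a 0 < 0)%R * (`|u a 0| - (i a)%:R / N).
  by rewrite mxE [(- vec z) a 0]mxE vecE mulrBr -uE.
apply: ler_sum => a _; rewrite rE mulrACA sgn2 mul1r.
by apply: ler_pM; rewrite ?subr_ge0 ?ge_i ?le_i.
Qed.

Lemma enorm_le_net (R : realType) d (s : seq 'cV[R]_d) (V : 'cV[R]_d) (t : R) :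
  (forall u, dotp u u <= 1 -> exists2 x, x \in s & dotp (u - x) (u - x) <= 16^-1) ->
  (forall x, x \in s -> dotp x V <= t) -> enorm V <= 4 / 3 * t.
Proof.
move=> net ht.
have [V0|V0] := eqVneq (enorm V) 0.
  have [|x xs _] := net 0; first by rewrite dotp0l ler01.
  have := ht x xs; move/eqP: (V0); rewrite enorm_eq0 => /eqP ->.
  by rewrite dotpC dotp0l enorm0; lra.
have Vp : 0 < enorm V by rewrite lt_def V0 enorm_ge0.
pose u := (enorm V)^-1 *: V.
have uu : dotp u u = 1 by rewrite /u !dotpE -sqr_enorm; field.
have uV : dotp u V = enorm V by rewrite /u !dotpE -sqr_enorm; field.
have [|x xs hx] := net u; first by rewrite uu.
have := ht x xs; have := cauchy_schwarz (u - x) V; rewrite ler_norml => /andP[_].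
rewrite dotpDl dotpNl uV.
have : enorm (u - x) <= 4^-1.
  rewrite -ler_sqr ?nnegrE ?enorm_ge0 // sqr_enorm; apply: le_trans hx _.
  by rewrite exprVn -natrX.
move=> h; have := ler_wpM2r (ltW Vp) h; lra.
Qed.

(** Passing from a point of the ball to the net costs [2 q / 4 + q / 16] of the
    supremum [q] of the form over the ball, hence [q <= b + 9 q / 16]. *)
Lemma quadratic_form_le_net (R : realType) d (s : seq 'cV[R]_d) (Z : 'M[R]_d) (b : R) :
  (forall x, x \in s -> dotp x x <= 1) ->
  (forall u, dotp u u <= 1 -> exists2 x, x \in s & dotp (u - x) (u - x) <= 16^-1) ->
  Z^T = Z ->
  (forall x, x \in s -> `|dotp x (Z *m x)| <= b) ->
  forall x, `|dotp x (Z *m x)| <= 16 / 7 * b * dotp x x.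
Proof.
move=> ball net symZ hb.
pose Q := [set `|dotp u (Z *m u)| | u in [set u : 'cV[R]_d | dotp u u <= 1]].
have [K K0 hK] := bilin_bound Z.
have ubQ : has_ubound Q.
  exists K => _ [u /= u1 <-]; apply: le_trans (hK u u) _.
  by rewrite -expr2 sqr_enorm ler_piMr.
pose q := sup Q.
have hq x : `|dotp x (Z *m x)| <= q * dotp x x.
  have [->|x0] := eqVneq x 0; first by rewrite !dotp0l normr0 mulr0.
  have ex : enorm x != 0 by rewrite enorm_eq0.
  have -> : dotp x (Z *m x) =
      dotp ((enorm x)^-1 *: x) (Z *m ((enorm x)^-1 *: x)) * dotp x x.
    by rewrite -scalemxAr !dotpE -sqr_enorm; field.
  rewrite normrM (ger0_norm (dotp_ge0 x)) ler_wpM2r ?dotp_ge0 //.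
  apply: ub_le_sup => //; exists ((enorm x)^-1 *: x) => //=.
  by rewrite !dotpE -sqr_enorm le_eqVlt; apply/orP; left; apply/eqP; field.
have q0 : 0 <= q.
  apply: ub_le_sup => //; exists 0; rewrite /= dotp0l ?normr0 ?ler01 //.
have qle : q <= b + 9 / 16 * q.
  apply: ge_sup; first by exists 0; exists 0; rewrite /= dotp0l ?normr0 ?ler01.
  move=> _ [u /= u1 <-]; have [x xs hx] := net u u1.
  have [r -> {}hx] : exists2 r, u = x + r & dotp r r <= 16^-1.
    by exists (u - x) => //; rewrite addrC subrK.
  have sE : dotp r (Z *m x) = dotp x (Z *m r) by rewrite dotp_mulmx symZ dotpC.
  rewrite mulmxDr !dotpE sE.
  have h1 : `|dotp x (Z *m r)| <= q * 4^-1.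
    apply: (le_trans (polarization symZ hq _ _)); rewrite ler_wpM2l //.
    rewrite -[leRHS]mul1r; apply: ler_pM; rewrite ?enorm_ge0 //.
      by rewrite -(expr_le1 (n:=2)) ?enorm_ge0 // sqr_enorm ball.
    rewrite -ler_sqr ?nnegrE ?enorm_ge0 // sqr_enorm; apply: le_trans hx _.
    by rewrite exprVn -natrX.
  have h2 : `|dotp r (Z *m r)| <= q * 16^-1.
    by apply: (le_trans (hq r)); rewrite ler_wpM2l.
  have h3 := hb x xs.
  move: h1 h2 h3; rewrite !ler_norml.
  by move=> /andP[? ?] /andP[? ?] /andP[? ?]; apply/andP; split; lra.
move=> x; apply: le_trans (hq x) _; rewrite ler_wpM2r ?dotp_ge0 //; lra.
Qed.

(** * Independence *)

(** Both sides are finite measures in [A]; they agree on a pi-system, hence on the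
    sigma-algebra that it generates. *)
Lemma indep_pi_system_half (R : realType) disp (T : measurableType disp)
    (P : probability T R) (G : set (set T)) (B : set T) :
  G `<=` measurable -> setI_closed G -> G setT -> measurable B ->
  (forall A, G A -> P (A `&` B) = (P A * P B)%E) ->
  forall A, <<s G >> A -> P (A `&` B) = (P A * P B)%E.
Proof.
move=> Gm GI GT mB hG A sA.
have PB : P B \is a fin_num by exact: fin_num_measure.
pose r : {nonneg R} := NngNum (fine_ge0 (measure_ge0 P B)).
have rE : (r%:num)%:E = P B by rewrite /= fineK.
have cover : \bigcup_(k : nat) (fun=> [set: T]) k = setT.
  by apply/seteqP; split=> // w _; exists 0%N.
have := @g_sigma_algebra_measure_unique _ R T G Gm (fun=> setT) (fun=> GT)
  cover [the {measure set T -> \bar R} of mrestr P mB]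
  [the {measure set T -> \bar R} of mscale r P] GI _ _ A sA => uniq.
have m1E C : mrestr P mB C = P (C `&` B) by [].
have m2E C : mscale r P C = (P C * P B)%E by rewrite muleC -rE.
rewrite -m1E -m2E; apply: uniq => // [C GC|_].
  by rewrite [LHS]m1E [RHS]m2E hG.
by rewrite [X in (X < _)%E]m1E setTI; apply: le_lt_trans (probability_le1 P mB) (ltry _).
Qed.

Lemma indep_pi_system (R : realType) disp (T : measurableType disp)
    (P : probability T R) (G H : set (set T)) :
  G `<=` measurable -> setI_closed G -> G setT ->
  H `<=` measurable -> setI_closed H -> H setT ->
  (forall A B, G A -> H B -> P (A `&` B) = (P A * P B)%E) ->
  forall A B, <<s G >> A -> <<s H >> B -> P (A `&` B) = (P A * P B)%E.
Proof.
move=> Gm GI GT Hm HI HT hGH A B sA sB.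
have mB : measurable B.
  by move: sB; apply: smallest_sub => //; exact: sigma_algebra_measurable.
have mA : measurable A.
  by move: sA; apply: smallest_sub => //; exact: sigma_algebra_measurable.
apply: indep_pi_system_half sA => // C GC.
rewrite setIC muleC; apply: (indep_pi_system_half Hm HI HT _ _ sB); first exact: Gm.
by move=> D HD; rewrite setIC hGH // muleC.
Qed.

(** The events of the members of [F] indexed by [J]; they generate the
    sigma-algebra of the block [J]. *)
Definition joint_sets (T I : Type) (F : I -> set (set T)) (J : I -> bool) :
  set (set T) := [set A | exists2 i, J i & F i A].

(** The finite intersections of events, one for each index of a block, form a
    pi-system on which mutual independence gives the product formula directly. *)
Lemma indep_blocks (R : realType) disp (T : measurableType disp)
    (P : probability T R) (n : nat) (F : 'I_n -> set (set T)) (J1 J2 : pred 'I_n) :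
  (forall i, F i `<=` measurable) -> (forall i, setI_closed (F i)) ->
  (forall i, F i setT) -> mutually_independent P F ->
  (forall i, J1 i -> ~~ J2 i) ->
  forall A B, <<s joint_sets F J1 >> A -> <<s joint_sets F J2 >> B ->
  P (A `&` B) = (P A * P B)%E.
Proof.
move=> Fm FI FT indF J12 A B.
pose cyl (J : pred 'I_n) : set (set T) :=
  [set A | exists2 C : 'I_n -> set T, (forall i, J i -> F i (C i)) &
                                      A = \bigcap_(i in [set i | J i]) C i].
have subcyl J : <<s joint_sets F J >> `<=` <<s cyl J >>.
  apply: smallest_sub; first exact: smallest_sigma_algebra.
  move=> C [i Ji FC]; apply: sub_sigma_algebra; rewrite /cyl /=.
  exists (fun j => if j == i then C else setT).
    by move=> j _; case: eqP => [->|].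
  apply/seteqP; split=> [w Cw j _ /=|w /(_ i Ji) /=]; first by case: eqP.
  by rewrite eqxx.
have cylm J : cyl J `<=` measurable.
  move=> _ [C FC ->]; apply: fin_bigcap_measurable => // i Ji.
  by apply: (Fm i); exact: FC.
have cylI J : setI_closed (cyl J).
  move=> _ _ [C FC ->] [D FD ->]; exists (fun i => C i `&` D i).
    by move=> i Ji; apply: FI; [exact: FC|exact: FD].
  by rewrite bigcapI.
have cylT J : cyl J setT.
  exists (fun=> setT); first by move=> i _; exact: FT.
  by rewrite bigcapT.
move=> /subcyl sA /subcyl sB.
apply: (@indep_pi_system _ _ _ P (cyl J1) (cyl J2)) => //.
move=> _ _ [C FC ->] [D FD ->].
pose K1 : {set 'I_n} := finset J1; pose K2 : {set 'I_n} := finset J2.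
have setE (J : pred 'I_n) : [set i | J i] = [set` (finset J : {set 'I_n})].
  by apply/seteqP; split=> i /=; rewrite inE.
have e1 : P (\bigcap_(i in [set i | J1 i]) C i) = (\prod_(i in K1) P (C i))%E.
  by rewrite setE; apply: indF => i; rewrite inE; exact: FC.
have e2 : P (\bigcap_(i in [set i | J2 i]) D i) = (\prod_(i in K2) P (D i))%E.
  by rewrite setE; apply: indF => i; rewrite inE; exact: FD.
pose E i := if J1 i then C i else D i.
have -> : \bigcap_(i in [set i | J1 i]) C i `&` \bigcap_(i in [set i | J2 i]) D i
    = \bigcap_(i in [set` (K1 :|: K2)%SET]) E i.
  apply/seteqP; split=> [w [hC hD] i /=|w h].
    rewrite !inE /E; case: ifPn => [Ji _|_ /= Ji]; [exact: hC|exact: hD].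
  split=> i /= Ji.
    by have := h i; rewrite /= !inE Ji /E Ji; apply.
  have := h i; rewrite /= !inE Ji orbT /E; case: ifPn => [Ji1|_]; last exact.
  by have := J12 i Ji1; rewrite Ji.
rewrite indF; last first.
  move=> i; rewrite !inE /E; case: ifPn => [Ji _|_ /= Ji]; [exact: FC|exact: FD].
rewrite (eq_bigl (mem [predU K1 & K2])); last by move=> i; rewrite !inE.
rewrite bigU /=; last first.
  rewrite disjoint_subset; apply/fintype.subsetP => i; rewrite !inE; exact: J12.
rewrite e1 e2; congr (_ * _)%E; apply: eq_bigr => i; rewrite inE /E.
  by move=> ->.
by case: ifPn => // /J12 /negPf ->.
Qed.

(** The law of the pair is the product of the laws, so the claim is Tonelli's
    theorem for [x * y]; positive parts make the integrand nonnegative on the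
    whole plane. *)
Lemma expectation_mul_indep (R : realType) disp (T : measurableType disp)
    (P : probability T R) (f g : T -> R) :
  measurable_fun setT f -> measurable_fun setT g ->
  (forall w, 0 <= f w) -> (forall w, 0 <= g w) ->
  (forall A B : set R, measurable A -> measurable B ->
     P (f @^-1` A `&` g @^-1` B) = (P (f @^-1` A) * P (g @^-1` B))%E) ->
  (\int[P]_w (f w * g w)%:E = \int[P]_w (f w)%:E * \int[P]_w (g w)%:E)%E.
Proof.
move=> mf mg f0 g0 ind.
have mX : measurable_fun setT (fun w => (f w, g w)) by exact: measurable_fun_pair.
pose X : {RV P >-> (R * R)%type} := mfun_Sub (mem_set mX).
pose F : {RV P >-> R} := mfun_Sub (mem_set mf).
pose G : {RV P >-> R} := mfun_Sub (mem_set mg).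
have prodE Z : measurable Z ->
    (distribution P F \x distribution P G)%E Z = distribution P X Z.
  apply: product_measure_unique => A B mA mB; exact: ind.
pose h (z : R * R) : \bar R := (Num.max z.1 0 * Num.max z.2 0)%:E.
have mmax : measurable_fun setT (fun x : R => Num.max x 0).
  by apply: measurable_maxr; [exact: measurable_id|exact: measurable_cst].
have mh : measurable_fun setT h.
  apply/measurable_EFinP; apply: measurable_funM.
    exact: (measurableT_comp mmax measurable_fst).
  exact: (measurableT_comp mmax measurable_snd).
have max0 (x : R) : 0 <= Num.max x 0 by rewrite le_max lexx orbT.
have h0 z : (0 <= h z)%E by rewrite lee_fin mulr_ge0.
transitivity (\int[P]_w h (X w))%E.
  by apply: eq_integral => w _; rewrite /h /= !max_l.
rewrite -(@ge0_integral_distribution _ _ _ _ _ P X h) //.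
rewrite -(eq_measure_integral _ (fun Z mZ _ => prodE Z mZ)).
rewrite fubini_tonelli1 //= /fubini_F.
have mEmax : measurable_fun setT (fun x : R => (Num.max x 0)%:E).
  exact/measurable_EFinP.
have marg (k : T -> R) (mk : measurable_fun setT k) : (forall w, 0 <= k w) ->
    (\int[distribution P (mfun_Sub (mem_set mk) : {RV P >-> R})]_y (Num.max y 0)%:E
      = \int[P]_w (k w)%:E)%E.
  move=> k0; rewrite ge0_integral_distribution //=.
  by apply: eq_integral => w _ /=; rewrite max_l.
under eq_integral => x _.
  rewrite /h /=; under eq_integral do rewrite EFinM.
  rewrite ge0_integralZl // ?lee_fin //; last by move=> y _; rewrite lee_fin.
  rewrite [X in (_ * X)%E](marg g mg g0).
  over.
rewrite ge0_integralZr //; last 2 first.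
- by move=> y _; rewrite lee_fin.
- by apply: integral_ge0 => w _; rewrite lee_fin.
by rewrite [X in (X * _)%E](marg f mf f0).
Qed.

Lemma measurable_fun_generated_mono (R : realType) (T : pointedType)
    (G H : set (set T)) (f : T -> R) : G `<=` <<s H >> ->
  measurable_fun (setT : set (g_sigma_algebraType G)) (f : g_sigma_algebraType G -> R) ->
  measurable_fun (setT : set (g_sigma_algebraType H)) (f : g_sigma_algebraType H -> R).
Proof.
move=> GH mf mT Y mY; have := mf measurableT Y mY; rewrite !setTI.
by apply: smallest_sub => //; exact: smallest_sigma_algebra.
Qed.

Lemma measurable_fun_generated (R : realType) disp (T : measurableType disp)
    (G : set (set T)) (f : T -> R) : G `<=` measurable ->
  measurable_fun (setT : set (g_sigma_algebraType G)) (f : g_sigma_algebraType G -> R) ->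
  measurable_fun setT f.
Proof.
move=> GH mf mT Y mY; have := mf measurableT Y mY; rewrite !setTI.
by apply: smallest_sub => //; exact: sigma_algebra_measurable.
Qed.

(** Measurability with respect to the sigma-algebra of the block [J], phrased on
    the type of points that carries this sigma-algebra. *)
Definition block_measurable (R : realType) (T : pointedType) (I : Type)
    (F : I -> set (set T)) (J : I -> bool) (f : T -> R) : Prop :=
  measurable_fun (setT : set (g_sigma_algebraType (joint_sets F J)))
    (f : g_sigma_algebraType (joint_sets F J) -> R).

(** By induction on the number of blocks: the product of the first functions is
    measurable for the union of their blocks, which is disjoint from the next. *)
Lemma expectation_prod_blocks (R : realType) disp (T : measurableType disp)
    (P : probability T R) (n : nat) (F : 'I_n -> set (set T))
    (J : nat -> pred 'I_n) (f : nat -> T -> R) (l : nat) :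
  (forall i, F i `<=` measurable) -> (forall i, setI_closed (F i)) ->
  (forall i, F i setT) -> mutually_independent P F ->
  (forall a b i, J a i -> J b i -> a = b) ->
  (forall a, block_measurable F (J a) (f a)) ->
  (forall a w, 0 <= f a w) ->
  (\int[P]_w (\prod_(a < l) f a w)%:E = \prod_(a < l) \int[P]_w (f a w)%:E)%E.
Proof.
move=> Fm FI FT indF disj mf f0.
have Jm (K : pred 'I_n) : joint_sets F K `<=` measurable.
  by move=> A [i _]; exact: Fm.
elim: l => [|l IH].
  under eq_integral do rewrite big_ord0.
  by rewrite big_ord0 integral_cst //= mul1e probability_setT.
under eq_integral do rewrite big_ord_recr /=.
rewrite big_ord_recr /= -IH.
pose K : pred 'I_n := fun i => [exists a : 'I_l, J a i].
have mprod : block_measurable F K (fun w => \prod_(a < l) f a w).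
  apply: measurable_prod => a _.
  apply: measurable_fun_generated_mono (mf a) => A [i Ji FA].
  apply: sub_sigma_algebra; exists i => //; apply/existsP; exists a; exact: Ji.
apply: expectation_mul_indep.
- exact: measurable_fun_generated (@Jm K) mprod.
- exact: measurable_fun_generated (@Jm (J l)) (mf l).
- by move=> w; exact: prodr_ge0.
- exact: f0.
move=> A B mA mB.
apply: (@indep_blocks _ _ _ P n F K (J l)) => //.
- move=> i /existsP[a Jai]; apply/negP => Jli.
  by have := disj _ _ _ Jai Jli; have := ltn_ord a; lia.
- by have := mprod measurableT A mA; rewrite setTI.
- by have := mf l measurableT B mB; rewrite setTI.
Qed.

(** * Squares of sub-Gaussian variables *)

(** From [e^y <= 1 + y e^y] the remainder is at most [y (e^y - 1)], and the same
    inequality, or [1 - e^y <= - y] for negative [y], bounds it by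
    [y^2 e^|y|]. *)
Lemma expR_le_second_order (R : realType) (y : R) :
  expR y <= 1 + y + y ^+ 2 * expR `|y|.
Proof.
have le_tangent : expR y <= 1 + y * expR y.
  have := ler_wpM2r (expR_ge0 y) (expR_ge1Dx (- y)).
  by rewrite -expRD addNr expR0; lra.
have below := expR_ge1Dx y.
have [y0|y0] := leP 0 y.
  by rewrite ger0_norm //; have := ler_wpM2l y0 le_tangent; rewrite expr2; lra.
rewrite ltr0_norm //.
have e1 : 1 <= expR (- y) by have := expR_ge1Dx (- y); lra.
have : y * expR y <= y + y ^+ 2.
  have h : 0 <= - y by lra.
  by have := ler_wpM2l h below; rewrite expr2; lra.
have := ler_wpM2l (sqr_ge0 y) e1; lra.
Qed.

Lemma expR_half_ge (R : realType) : 3 / 2 <= expR (2^-1 : R).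
Proof. by have := expR_ge1Dx (2^-1 : R); lra. Qed.

(** [x^2/4] is the supremum over real [m] of [m x - m^2]; an integer [m] within 1
    of the optimum loses at most 1. Exponential moments of [x^2] thus follow from
    those of [x]. *)
Lemma expR_sq_le_series (R : realType) (x : R) :
  ((expR (x ^+ 2 / 4))%:E <= (expR 1)%:E * \sum_(0 <= m <oo)
    (expR (m%:R * x - m%:R ^+ 2) + expR (- m%:R * x - m%:R ^+ 2))%:E)%E.
Proof.
pose m := Num.truncn (`|x| / 2).
have /andP[m1 m2] : m%:R <= `|x| / 2 < m.+1%:R.
  by apply: truncn_itv; rewrite divr_ge0.
pose f (m : nat) := (expR (m%:R * x - m%:R ^+ 2) + expR (- m%:R * x - m%:R ^+ 2))%:E : \bar R.
have f0 k : (0 <= f k)%E by rewrite lee_fin addr_ge0 // expR_ge0.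
apply: (@le_trans _ _ ((expR 1)%:E * f m)%E); last first.
  rewrite lee_pmul2l ?lte_fin ?expR_gt0 //.
  apply: le_trans (nneseries_lim_ge m.+1 _); last by move=> k _ _; exact: f0.
  by rewrite big_nat_recr //= leeDr // sume_ge0 // => k _; exact: f0.
rewrite -EFinM lee_fin.
apply: (@le_trans _ _ (expR 1 * expR (m%:R * `|x| - m%:R ^+ 2))).
  rewrite -expRD ler_expR -[x ^+ 2]real_normK ?num_real //.
  have h : 0 <= 1 - (`|x| / 2 - m%:R).
    by rewrite subr_ge0 lerBlDl natr1 ltW.
  have h' : 0 <= 1 + (`|x| / 2 - m%:R) by lra.
  by have := mulr_ge0 h h'; rewrite !expr2; lra.
rewrite ler_wpM2l ?expR_ge0 //.
have [x0|x0] := leP 0 x; first by rewrite ger0_norm // lerDl expR_ge0.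
by rewrite ltr0_norm // mulrN -mulNr lerDr expR_ge0.
Qed.

Lemma expectation_expR_sq (R : realType) disp (T : measurableType disp)
    (P : probability T R) (U : T -> R) :
  measurable_fun setT U ->
  (forall t, \int[P]_w (expR (t * U w))%:E <= (expR (t ^+ 2 / 2))%:E)%E ->
  (\int[P]_w (expR (U w ^+ 2 / 4))%:E <= (6 * expR 1)%:E)%E.
Proof.
move=> mU mgf.
pose f (m : nat) w := (expR (m%:R * U w - m%:R ^+ 2) + expR (- m%:R * U w - m%:R ^+ 2))%:E : \bar R.
have mexp (a b : R) : measurable_fun setT (fun w => expR (a * U w - b)).
  apply: measurableT_comp => //; apply: measurable_funB; last exact: measurable_cst.
  by apply: measurable_funM => //; exact: measurable_cst.
have mf m : measurable_fun setT (f m).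
  by apply/measurable_EFinP; apply: measurable_funD; exact: mexp.
have f0 m w : (0 <= f m w)%E by rewrite lee_fin addr_ge0 // expR_ge0.
have mS : measurable_fun setT (fun w => \sum_(0 <= m <oo) f m w)%E.
  exact: (@ge0_emeasurable_sum _ _ _ setT f xpredT).
have mL : measurable_fun setT (fun w => (expR (U w ^+ 2 / 4))%:E).
  apply/measurable_EFinP; apply: measurableT_comp => //.
  by apply: measurable_funM; [exact: measurable_funX|exact: measurable_cst].
apply: (@le_trans _ _ (\int[P]_w ((expR 1)%:E * \sum_(0 <= m <oo) f m w))%E).
  apply: ge0_le_integral => //.
  - exact: measurable_funeM.
  - by move=> w _; exact: expR_sq_le_series.
rewrite ge0_integralZl //; last first.
  by move=> w _; apply: nneseries_ge0.
rewrite integral_nneseries //.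
have half (m : nat) (e : R) : e ^+ 2 = 1 ->
    (\int[P]_w (expR (e * m%:R * U w - m%:R ^+ 2))%:E <= ((2 / 3) ^+ m)%:E)%E.
  move=> e2.
  under eq_integral do rewrite expRD mulrC EFinM.
  rewrite ge0_integralZl ?lee_fin ?expR_ge0 //; last first.
    by apply/measurable_EFinP; have := mexp (e * m%:R) 0; under eq_fun do rewrite subr0.
  apply: (le_trans (lee_wpmul2l _ (mgf _))); first by rewrite lee_fin expR_ge0.
  rewrite -EFinM -expRD exprMn e2 mul1r lee_fin.
  apply: (@le_trans _ _ (expR (- (m%:R * 2^-1)))).
    rewrite ler_expR; have : (m%:R : R) <= m%:R ^+ 2.
      by rewrite -natrX ler_nat; case: (m) => // k; rewrite -mulnn; lia.
    by lra.
  rewrite expRN expRM_natl -exprVn lerXn2r ?nnegrE ?invr_ge0 ?expR_ge0 //.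
  by rewrite -[2 / 3]invrK lef_pV2 ?posrE ?expR_gt0 // invf_div expR_half_ge.
rewrite [6 * _]mulrC EFinM.
rewrite lee_pmul2l; [|by []|by rewrite lte_fin expR_gt0].
apply: lime_le; first by apply: is_cvg_nneseries => k _ _; apply: integral_ge0.
apply: nearW => k.
apply: (@le_trans _ _ (\sum_(0 <= i < k) (2 * (2 / 3) ^+ i)%:E)%E).
  apply: lee_sum => i _; rewrite /f.
  under eq_integral do rewrite EFinD.
  rewrite ge0_integralD //; last 2 first.
  - by apply/measurable_EFinP; exact: mexp.
  - by apply/measurable_EFinP; exact: mexp.
  rewrite [in leRHS]mulr_natl mulr2n EFinD; apply: leeD.
    rewrite (eq_integral (fun w => (expR (1 * i%:R * U w - i%:R ^+ 2))%:E)).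
      by apply: half; rewrite expr1n.
    by move=> w _; rewrite mul1r.
  rewrite (eq_integral (fun w => (expR (-1 * i%:R * U w - i%:R ^+ 2))%:E)).
    by apply: half; rewrite sqrrN expr1n.
  by move=> w _; rewrite mulN1r.
rewrite sumEFin lee_fin.
suff -> : \sum_(0 <= i < k) (2 * (2 / 3) ^+ i) = 6 - 6 * (2 / 3) ^+ k :> R.
  by rewrite lerBlDr lerDl mulr_ge0 // exprn_ge0.
elim: k => [|k IH]; first by rewrite big_nil expr0 mulr1 subrr.
by rewrite big_nat_recr //= IH exprS; field.
Qed.

(** The constant [512 e] of the pointwise bound times the bound [6 e] on the
    exponential moment of [U^2 / 4]. *)
Definition bernstein_const (R : realType) : R := 3072 * expR 2.

Lemma bernstein_const_ge0 (R : realType) : 0 <= bernstein_const R.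
Proof. by rewrite /bernstein_const mulr_ge0 ?ler0n ?expR_ge0. Qed.

(** In the second-order bound for [y = lam (u^2 - s)] one has
    [|y| <= (u^2 + 1) / 16], and a further factor [e^((u^2+1)/16)] absorbs the
    polynomial [(u^2 + 1)^2]. *)
Lemma expR_centered_square_le (R : realType) (u s lam : R) :
  0 <= s <= 1 -> `|lam| <= 16^-1 ->
  expR (lam * (u ^+ 2 - s)) <=
    1 + lam * (u ^+ 2 - s) + 512 * expR 1 * lam ^+ 2 * expR (u ^+ 2 / 4).
Proof.
move=> /andP[s0 s1] hlam; set y := lam * _; set h := u ^+ 2 + 1.
have h0 : 0 <= h by rewrite addr_ge0 ?sqr_ge0.
have yh : `|y| <= `|lam| * h.
  rewrite normrM ler_wpM2l // ler_norml /h; have := sqr_ge0 u; lra.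
apply: (le_trans (expR_le_second_order y)); rewrite lerD2l.
have e1 : expR `|y| <= expR (h / 16).
  by rewrite ler_expR; apply: (le_trans yh); rewrite mulrC ler_wpM2l.
have y2 : y ^+ 2 <= lam ^+ 2 * h ^+ 2.
  rewrite -(real_normK (num_real y)) -(real_normK (num_real lam)) -exprMn.
  by rewrite ler_sqr ?nnegrE ?mulr_ge0.
have h2 : h ^+ 2 <= 512 * expR (h / 16).
  have := @expR_ge1Dxn R (h / 16) 1 (divr_ge0 h0 (ler0n _ _)).
  have -> : (1.+1)`! = 2%N by [].
  by rewrite !expr2; lra.
apply: (@le_trans _ _ (lam ^+ 2 * (512 * expR (h / 16)) * expR (h / 16))).
  apply: ler_pM; rewrite ?sqr_ge0 ?expR_ge0 //.
  by apply: (le_trans y2); rewrite ler_wpM2l ?sqr_ge0.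
have e2 : expR (h / 16) * expR (h / 16) <= expR 1 * expR (u ^+ 2 / 4).
  by rewrite -!expRD ler_expR /h; have := sqr_ge0 u; lra.
have l2 : 0 <= 512 * lam ^+ 2 by rewrite mulr_ge0 ?ler0n ?sqr_ge0.
by have := ler_wpM2l l2 e2; lra.
Qed.

(** Bernstein's condition for the square of a sub-Gaussian variable: after
    integration the linear term of the pointwise bound vanishes and
    [1 + x <= e^x] concludes. *)
Lemma mgf_centered_square (R : realType) disp (T : measurableType disp)
    (P : probability T R) (U : T -> R) (s lam : R) :
  measurable_fun setT U ->
  (forall t, \int[P]_w (expR (t * U w))%:E <= (expR (t ^+ 2 / 2))%:E)%E ->
  (\int[P]_w (U w ^+ 2)%:E = s%:E)%E -> 0 <= s <= 1 -> `|lam| <= 16^-1 ->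
  (\int[P]_w (expR (lam * (U w ^+ 2 - s)))%:E
     <= (expR (bernstein_const R * lam ^+ 2))%:E)%E.
Proof.
move=> mU mgf U2 s01 hlam; have /andP[s0 _] := s01.
pose p := Num.max lam 0; pose q := Num.max (- lam) 0.
have p0 : 0 <= p by rewrite le_max lexx orbT.
have q0 : 0 <= q by rewrite le_max lexx orbT.
have lamE : lam = p - q.
  by rewrite /p /q; case: (leP lam 0) => h; case: (leP (- lam) 0); lra.
pose c := 512 * expR 1 * lam ^+ 2.
have c0 : 0 <= c by rewrite /c mulr_ge0 ?sqr_ge0 ?mulr_ge0 ?ler0n ?expR_ge0.
have mU2 : measurable_fun setT (fun w => U w ^+ 2) by exact: measurable_funX.
have mL : measurable_fun setT (fun w => expR (lam * (U w ^+ 2 - s))).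
  apply: measurableT_comp => //; apply: measurable_funM; first exact: measurable_cst.
  by apply: measurable_funB => //; exact: measurable_cst.
have mE : measurable_fun setT (fun w => expR (U w ^+ 2 / 4)).
  apply: measurableT_comp => //.
  by apply: measurable_funM; [exact: measurable_funX|exact: measurable_cst].
have intZ (k : R) (f : T -> R) : 0 <= k -> measurable_fun setT f -> (forall w, 0 <= f w) ->
    (\int[P]_w (k * f w)%:E = k%:E * \int[P]_w (f w)%:E)%E.
  move=> k0 mf f0; under eq_integral do rewrite EFinM.
  by rewrite ge0_integralZl // => [|w _]; rewrite ?lee_fin //; exact/measurable_EFinP.
have intD (f g : T -> R) : measurable_fun setT f -> (forall w, 0 <= f w) ->
    measurable_fun setT g -> (forall w, 0 <= g w) ->
    (\int[P]_w (f w + g w)%:E = \int[P]_w (f w)%:E + \int[P]_w (g w)%:E)%E.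
  move=> mf f0 mg g0; under eq_integral do rewrite EFinD.
  by rewrite ge0_integralD // => [w _||w _|]; rewrite ?lee_fin //; exact/measurable_EFinP.
have int1 (k : R) : (\int[P]_w k%:E = k%:E)%E.
  by rewrite -[RHS]mule1 -(probability_setT P) -integral_cst.
have pU (k : R) w : 0 <= k -> 0 <= k * U w ^+ 2.
  by move=> k0; rewrite mulr_ge0 // sqr_ge0.
have ps (k : R) : 0 <= k -> 0 <= k * s by move=> k0; rewrite mulr_ge0.
have pos (k k' : R) w : 0 <= k -> 0 <= k' -> 0 <= k * U w ^+ 2 + k' * s.
  by move=> k0 k0'; rewrite addr_ge0 ?pU ?ps.
(* the parts with a negative sign go to the left: all integrands are nonnegative *)
have main : (\int[P]_w (expR (lam * (U w ^+ 2 - s)) + (q * U w ^+ 2 + p * s))%:E <=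
    \int[P]_w (1 + (p * U w ^+ 2 + q * s) + c * expR (U w ^+ 2 / 4))%:E)%E.
  apply: ge0_le_integral => //.
  - by move=> w _; rewrite lee_fin addr_ge0 ?expR_ge0 ?pos.
  - apply/measurable_EFinP; apply: measurable_funD => //; apply: measurable_funD => //.
    by apply: measurable_funM => //; exact: measurable_cst.
  - apply/measurable_EFinP; apply: measurable_funD.
      apply: measurable_funD => //; apply: measurable_funD => //.
      by apply: measurable_funM => //; exact: measurable_cst.
    by apply: measurable_funM => //; exact: measurable_cst.
  move=> w _; rewrite lee_fin.
  have := expR_centered_square_le (U w) s01 hlam; rewrite -/c [in X in _ <= X -> _]lamE.
  by lra.
have mM (k : R) (f : T -> R) : measurable_fun setT f -> measurable_fun setT (fun w => k * f w).
  by move=> mf; apply: measurable_funM => //; exact: measurable_cst.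
move: main.
rewrite (intD _ (fun w => q * U w ^+ 2 + p * s)); last 4 first.
- exact: mL.
- by move=> w; exact: expR_ge0.
- by apply: measurable_funD; [exact: mM|exact: measurable_cst].
- by move=> w; exact: pos.
rewrite (intD (fun w => q * U w ^+ 2) (fun=> p * s)); last 4 first.
- exact: mM.
- by move=> w; exact: pU.
- exact: measurable_cst.
- by move=> w; exact: ps.
rewrite (intD (fun w => 1 + (p * U w ^+ 2 + q * s))); last 4 first.
- apply: measurable_funD; first exact: measurable_cst.
  by apply: measurable_funD; [exact: mM|exact: measurable_cst].
- by move=> w; rewrite addr_ge0 ?pos.
- exact: mM.
- by move=> w; rewrite mulr_ge0 // expR_ge0.
rewrite (intD (fun=> 1)); last 4 first.
- exact: measurable_cst.
- by [].
- by apply: measurable_funD; [exact: mM|exact: measurable_cst].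
- by move=> w; exact: pos.
rewrite (intD (fun w => p * U w ^+ 2) (fun=> q * s)); last 4 first.
- exact: mM.
- by move=> w; exact: pU.
- exact: measurable_cst.
- by move=> w; exact: ps.
have U20 w : 0 <= U w ^+ 2 by exact: sqr_ge0.
have E0 w : 0 <= expR (U w ^+ 2 / 4) by exact: expR_ge0.
rewrite (intZ q (fun w => U w ^+ 2)) // (intZ p (fun w => U w ^+ 2)) // (intZ c) // !int1.
rewrite U2 => main.
have hE := expectation_expR_sq mU mgf.
have fin : (\int[P]_w (expR (U w ^+ 2 / 4))%:E)%E \is a fin_num.
  rewrite ge0_fin_numE; first exact: le_lt_trans hE (ltry _).
  by apply: integral_ge0 => w _; rewrite lee_fin expR_ge0.
move: main hE; rewrite -(fineK fin); set I4 := fine _.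
rewrite -!EFinM -!EFinD !lee_fin => main hE.
have finL : (\int[P]_w (expR (lam * (U w ^+ 2 - s)))%:E)%E \is a fin_num.
  rewrite ge0_fin_numE; last by apply: integral_ge0 => w _; rewrite lee_fin expR_ge0.
  apply: (le_lt_trans _ (ltry (1 + (p * s + q * s) + c * I4))).
  apply: (le_trans _ main); rewrite leeDl // lee_fin addr_ge0 // mulr_ge0 //.
move: main; rewrite -(fineK finL) -!EFinD !lee_fin => main.
apply: (le_trans _ (expR_ge1Dx _)).
move: main (ler_wpM2l c0 hE); rewrite /c /bernstein_const.
have -> : expR 2 = expR 1 * expR 1 :> R by rewrite -expRD.
by lra.
Qed.

(** * Flips of the sign chain *)

Lemma prob_bigsetU_le (R : realType) disp (T : measurableType disp)
    (P : probability T R) (I : Type) (r : seq I) (Q : pred I) (A : I -> set T) :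
  (forall i, measurable (A i)) ->
  (P (\big[setU/set0]_(i <- r | Q i) A i) <= \sum_(i <- r | Q i) P (A i))%E.
Proof.
move=> mA; elim: r => [|i r IH]; first by rewrite !big_nil measure0.
rewrite !big_cons; case: ifP => // _.
apply: le_trans (measureU2 _ _ _) _ => //.
  by apply: bigsetU_measurable => j _.
by rewrite leeD2l.
Qed.

(** Indexing by natural numbers makes predecessors and block boundaries
    independent of the bound [n]. *)
Definition extend0 (V : Type) (x0 : V) n (s : 'I_n -> V) (i : nat) : V :=
  if insub i is Some j then s j else x0.

Lemma extend0E (V : Type) (x0 : V) n (s : 'I_n -> V) (j : 'I_n) :
  extend0 x0 s j = s j.
Proof. by rewrite /extend0 valK. Qed.

Definition flips_upto (V : eqType) (x0 : V) n (s : 'I_n -> V) (i : nat) : nat :=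
  \sum_(1 <= j < i) (extend0 x0 s j != extend0 x0 s j.-1).

Definition signb (R : pzRingType) (b : bool) : R := if b then 1 else -1.

Definition sign_path (R : realType) (T : Type) (n : nat) (eta : 'I_n -> T -> R)
    (z : {ffun 'I_n -> bool}) (i : nat) : set T :=
  [set w | forall j : 'I_n, (j <= i)%N -> eta j w = signb R (z j)].

Lemma sign_pathE (R : realType) (T : Type) (n : nat) (eta : 'I_n -> T -> R)
    (z : {ffun 'I_n -> bool}) (i : nat) :
  sign_path eta z i = \big[setI/setT]_(a < n)
    (if (a <= i)%N then eta a @^-1` [set signb R (z a)] else setT).
Proof.
rewrite -bigcap_seq; apply/seteqP; split=> [w h a _ /=|w h a ai].
  by case: ifP => // ai; exact: h.
by have := h a; rewrite ai; apply; rewrite /= mem_index_enum.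
Qed.

Lemma measurable_sign_path (R : realType) disp (T : measurableType disp)
    (P : probability T R) (n : nat) (eta : 'I_n -> {RV P >-> R})
    (z : {ffun 'I_n -> bool}) (i : nat) :
  measurable (sign_path (fun i => eta i) z i).
Proof.
rewrite sign_pathE; apply: bigsetI_measurable => a _; case: ifP => // _.
Qed.

Lemma sign_path_generated (R : realType) disp (T : measurableType disp)
    (P : probability T R) (n : nat) (eta : 'I_n -> {RV P >-> R})
    (z : {ffun 'I_n -> bool}) (i : nat) :
  g_sigma_preimage eta (sign_path (fun i => eta i) z i).
Proof.
rewrite sign_pathE.
have : @measurable _ (g_sigma_algebraType (\big[setU/set0]_(i < n)
    preimage_set_system setT (eta i) measurable)) (\big[setI/setT]_(a < n)
    (if (a <= i)%N then eta a @^-1` [set signb R (z a)] else setT)); last by [].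
apply: bigsetI_measurable => a _; case: ifP => // _.
apply: sub_sigma_algebra; rewrite -bigcup_seq; exists a => /=.
  by rewrite mem_index_enum.
by exists [set signb R (z a)] => //; rewrite setTI.
Qed.

(** Let [psi i] sum over all sign patterns [z] the probability of following [z] up
    to time [i], weighted by [t] to the number of flips of [z] up to [i]. Negating
    the coordinate [i+1] of [z] is a bijection that exchanges a step without flip
    and a step with flip, so [2 psi (i+1) = (1 - delta + delta t) psi i]. For
    [t = 1] this gives total mass 1; for [t > 1] it is the moment generating
    function of the number of flips. *)
Lemma chain_generating_function (R : realType) disp (T : measurableType disp)
    (P : probability T R) (n : nat) (delta t : R) (eta : 'I_n -> {RV P >-> R}) :
  (0 < n)%N -> sign_chain delta eta ->
  \sum_z fine (P (sign_path (fun i => eta i) z n)) * t ^+ flips_upto false z n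
    = (1 - delta + delta * t) ^+ n.-1.
Proof.
case: n eta => // n eta _ [eta1 eta0 step].
pose p z i := fine (P (sign_path (fun i => eta i) z i)).
pose N (z : {ffun 'I_n.+1 -> bool}) i := flips_upto false z i.+1.
pose psi i := \sum_z p z i * t ^+ N z i.
have -> : \sum_z fine (P (sign_path (fun i => eta i) z n.+1)) *
    t ^+ flips_upto false z n.+1 = psi n.
  apply: eq_bigr => z _; congr (fine (P _) * _).
  apply/seteqP; split=> w h j hj; apply: h; have := ltn_ord j; lia.
have sb (b : bool) : signb R b = 1 \/ signb R b = -1 by case: b; [left|right].
have one_neq : (1 == -1 :> R) = false.
  by apply/negbTE; rewrite -subr_eq0 opprK paddr_eq0 ?ler01 // oner_eq0.
have signb_eq (b c : bool) : (signb R b == signb R c) = (b == c).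
  by case: b; case: c; rewrite /signb ?eqxx // eq_sym.
(* every pattern starts with probability 1/2 *)
have psi0 : psi 0%N = 2 ^+ n.
  rewrite /psi (eq_bigr (fun=> 2^-1)) => [|z _].
    rewrite sumr_const card_ffun card_bool card_ord -[LHS]mulr_natr natrX exprS.
    by field.
  rewrite /N /flips_upto big_geq // expr0 mulr1 /p.
  have [h1 h2] := eta0 ord0 erefl.
  have -> : sign_path (fun i => eta i) z 0 = [set w | eta ord0 w = signb R (z ord0)].
    apply/seteqP; split=> [w h|w h j]; first exact: h.
    by rewrite leqn0 => /eqP j0; have -> : j = ord0 by exact: val_inj.
  by case: (z ord0); rewrite /signb ?h1 ?h2.
have psiS i : (i < n)%N -> psi i.+1 = psi i * ((1 - delta + delta * t) / 2).
  move=> lt_in.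
  pose jS := Ordinal (lt_in : (i.+1 < n.+1)%N).
  pose j := Ordinal (ltnW lt_in : (i < n.+1)%N).
  pose g (b : bool) : R := if b then 1 - delta else delta * t.
  have psiE : psi i.+1 = \sum_z p z i * t ^+ N z i * g (z jS == z j).
    apply: eq_bigr => z _.
    have NS : N z i.+1 = (N z i + (z jS != z j))%N.
      rewrite /N /flips_upto big_nat_recr //=; congr (_ + _)%N.
      by rewrite -(extend0E false z jS) -(extend0E false z j).
    have := step (fun j => signb R (z j)) (fun j => sb (z j)) j jS erefl.
    rewrite -/(sign_path (fun i => eta i) z i) -/(sign_path (fun i => eta i) z i.+1).
    rewrite /p => ->; rewrite signb_eq NS exprD.
    have fin : P (sign_path (fun i => eta i) z i) \is a fin_num.
      by apply: fin_num_measure; exact: measurable_sign_path.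
    rewrite fineM // [fine (_ %:E)]/=.
    by case: eqP => _ /=; rewrite ?expr0 ?expr1; ring.
  pose flip (z : {ffun 'I_n.+1 -> bool}) : {ffun 'I_n.+1 -> bool} :=
    [ffun a => if a == jS then ~~ z a else z a].
  have flipK : involutive flip.
    by move=> z; apply/ffunP => a; rewrite !ffunE; case: eqP => // _; rewrite negbK.
  have flipE z (a : 'I_n.+1) : (a <= i)%N -> flip z a = z a.
    by move=> ai; rewrite ffunE; case: eqP => // aE; move: ai; rewrite aE /= ltnn.
  have pflip z : p (flip z) i = p z i.
    rewrite /p; congr (fine (P _)); apply/seteqP.
    by split=> w h a ai; [rewrite -flipE //|rewrite flipE //]; exact: h.
  have Nflip z : N (flip z) i = N z i.
    apply: eq_big_nat => a /andP[a1 ai].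
    have e b : (b <= i)%N -> extend0 false (flip z) b = extend0 false z b.
      move=> bi; have bn : (b < n.+1)%N by lia.
      by rewrite -[b]/(val (Ordinal bn)) !extend0E flipE.
    by rewrite !e //; lia.
  have psiE2 : psi i.+1 = \sum_z p z i * t ^+ N z i * g (z jS != z j).
    rewrite psiE (reindex_inj (inv_inj flipK)); apply: eq_bigr => z _.
    rewrite pflip Nflip [flip z j]flipE ?leqnn // ffunE eqxx.
    by case: (z jS); case: (z j).
  have : psi i.+1 + psi i.+1 = psi i * (1 - delta + delta * t).
    rewrite {1}psiE psiE2 -big_split /psi mulr_suml; apply: eq_bigr => z _ /=.
    by rewrite -mulrDr; congr (_ * _); case: eqP => _; rewrite /g //= addrC.
  by lra.
have psiE i : (i <= n)%N -> psi i = 2 ^+ n * ((1 - delta + delta * t) / 2) ^+ i.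
  elim: i => [|i IH] hi; first by rewrite psi0 expr0 mulr1.
  by rewrite psiS // IH 1?ltnW // exprSr mulrA.
by rewrite psiE // -exprMn mulrC divfK.
Qed.

Lemma sum_sign_path (R : realType) disp (T : measurableType disp)
    (P : probability T R) (n : nat) (delta : R) (eta : 'I_n -> {RV P >-> R}) :
  (0 < n)%N -> sign_chain delta eta ->
  (\sum_z P (sign_path (fun i => eta i) z n) = 1)%E.
Proof.
move=> n0 chain; have := chain_generating_function 1 n0 chain.
rewrite mulr1 subrK expr1n => <-; rewrite -sumEFin; apply: eq_bigr => z _.
by rewrite expr1n mulr1 fineK // fin_num_measure //; exact: measurable_sign_path.
Qed.

Definition pattern (R : realType) (T : Type) (n : nat) (eta : 'I_n -> T -> R)
  (w : T) : {ffun 'I_n -> bool} := [ffun j => eta j w == 1].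

Lemma patternE (R : realType) disp (T : measurableType disp)
    (P : probability T R) (n : nat) (delta : R) (eta : 'I_n -> {RV P >-> R}) w j :
  sign_chain delta eta -> eta j w = signb R (pattern (fun i => eta i) w j).
Proof.
move=> [eta1 _ _]; rewrite ffunE /signb.
by case: eqP => // h; case: (eta1 j w).
Qed.

(** Conditioning on the signs: the signs take finitely many values, and given
    their pattern [z] the event [A z] of the noise keeps its probability. *)
Lemma conditional_union_bound (R : realType) disp (T : measurableType disp)
    (P : probability T R) (n : nat) (delta eps : R) (eta : 'I_n -> {RV P >-> R})
    (H : set (set T)) (A : {ffun 'I_n -> bool} -> set T) :
  (0 < n)%N -> sign_chain delta eta -> independent2 P (g_sigma_preimage eta) H ->
  (forall z, measurable (A z)) -> (forall z, H (A z)) -> (forall z, P (A z) <= eps%:E)%E ->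
  exists B, [/\ measurable B, (P B <= eps%:E)%E &
    forall w, ~ B w -> ~ A (pattern (fun i => eta i) w) w].
Proof.
move=> n0 chain ind mA HA Pz.
have mS z : measurable (sign_path (fun i => eta i) z n) by exact: measurable_sign_path.
exists (\big[setU/set0]_z (sign_path (fun i => eta i) z n `&` A z)); split.
- by apply: bigsetU_measurable => z _; exact: measurableI.
- apply: le_trans (prob_bigsetU_le _ _ _ _) _; first by move=> z; exact: measurableI.
  apply: (@le_trans _ _ (\sum_z P (sign_path (fun i => eta i) z n) * eps%:E)%E).
    apply: lee_sum => z _; rewrite ind //; last exact: sign_path_generated.
    by rewrite lee_wpmul2l.
  rewrite -ge0_sume_distrl => [|z _]; last exact: measure_ge0.
  by rewrite (sum_sign_path n0 chain) mul1e.
move=> w nB Aw; apply: nB; rewrite -bigcup_seq.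
exists (pattern (fun i => eta i) w); first by rewrite /= mem_index_enum.
by split=> // j _; exact: (patternE _ _ chain).
Qed.

(** Markov's inequality for [e^(flips / 2)], whose expectation is at most
    [e^(delta n)] because [e^(1/2) <= 2]. *)
Lemma flips_tail (R : realType) disp (T : measurableType disp)
    (P : probability T R) (n : nat) (delta x : R) (eta : 'I_n -> {RV P >-> R}) :
  (0 < n)%N -> 0 < delta < 1 / 2 -> sign_chain delta eta ->
  exists B, [/\ measurable B, (P B <= (expR (- x))%:E)%E &
    forall w, ~ B w -> (flips_upto false (pattern (fun i => eta i) w) n)%:R
      <= 2 * (delta * n%:R) + 2 * x].
Proof.
move=> n0 /andP[d0 d1] chain.
set r := 2 * _ + _; pose t : R := expR (2^-1).
pose bad := [pred z : {ffun 'I_n -> bool} | r < (flips_upto false z n)%:R].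
exists (\big[setU/set0]_(z | bad z) sign_path (fun i => eta i) z n); split.
- by apply: bigsetU_measurable => z _; exact: measurable_sign_path.
- apply: le_trans (prob_bigsetU_le _ _ _ _) _.
    by move=> z; exact: measurable_sign_path.
  pose p z := fine (P (sign_path (fun i => eta i) z n)).
  have pE z : P (sign_path (fun i => eta i) z n) = (p z)%:E.
    by rewrite fineK // fin_num_measure //; exact: measurable_sign_path.
  have p0 z : 0 <= p z by apply: fine_ge0; exact: measure_ge0.
  under eq_bigr do rewrite pE.
  rewrite sumEFin lee_fin.
  apply: (@le_trans _ _ (\sum_(z | bad z) expR (- (r / 2)) * (p z * t ^+ flips_upto false z n))).
    apply: ler_sum => z /= hz; rewrite mulrCA -[leLHS]mulr1 ler_wpM2l //.
    by rewrite /t -expRM_natr -expRD -[leLHS]expR0 ler_expR; lra.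
  apply: (@le_trans _ _ (\sum_z expR (- (r / 2)) * (p z * t ^+ flips_upto false z n))).
    rewrite [leRHS](bigID bad) /= lerDl; apply: sumr_ge0 => z _.
    by rewrite !mulr_ge0 ?exprn_ge0 ?expR_ge0.
  rewrite -mulr_sumr (chain_generating_function t n0 chain).
  have t2 : t <= 2.
    have := expR_ge1Dx (- 2^-1 : R); rewrite expRN => h.
    have h2 : 2^-1 <= t^-1 by apply: le_trans h; lra.
    by move: h2; rewrite lef_pV2 ?posrE ?expR_gt0.
  have t1 : 1 <= t by have := expR_ge1Dx (2^-1 : R); rewrite -/t; lra.
  have rho1 : 1 <= 1 - delta + delta * t by have := ler_wpM2l (ltW d0) t1; lra.
  have rho : 1 - delta + delta * t <= expR delta.
    apply: le_trans (expR_ge1Dx delta); have := ler_wpM2l (ltW d0) t2; lra.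
  apply: (@le_trans _ _ (expR (- (r / 2)) * expR delta ^+ n)).
    rewrite ler_wpM2l ?expR_ge0 //.
    apply: (@le_trans _ _ ((1 - delta + delta * t) ^+ n)).
      by rewrite ler_weXn2l // leq_pred.
    by rewrite lerXn2r ?nnegrE ?expR_ge0 // (le_trans _ rho1).
  by rewrite -expRM_natr -expRD ler_expR /r; lra.
move=> w nB; rewrite leNgt; apply/negP => h; apply: nB; rewrite -bigcup_seq_cond.
exists (pattern (fun i => eta i) w); first by rewrite /= mem_index_enum.
by move=> j _; exact: (patternE _ _ chain).
Qed.

(** * Block averages *)

Definition in_block (k i j : nat) : bool := (i * k <= j < i.+1 * k)%N.

Definition block_avg (R : realType) (n d k : nat) (Y : 'I_n -> 'cV[R]_d) (i : nat) :
  'cV[R]_d := k%:R^-1 *: \sum_(j < n | in_block k i j) Y j.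

Definition block_mean (R : realType) (n k : nat) (f : 'I_n -> R) (i : nat) : R :=
  k%:R^-1 * \sum_(j < n | in_block k i j) f j.

Lemma in_blockE k i j : (0 < k)%N -> in_block k i j = (i == j %/ k)%N.
Proof.
by move=> k0; rewrite /in_block -leq_divRL // -ltn_divLR // ltnS -eqn_leq.
Qed.

Lemma card_block n k i : (i.+1 * k <= n)%N -> (\sum_(j < n | in_block k i j) 1 = k)%N.
Proof.
move=> h; rewrite -(big_mkord (in_block k i) (fun=> 1%N)).
rewrite (big_cat_nat (n := i.+1 * k)) //= [X in (_ + X)%N]big1_seq ?addn0; last first.
  by move=> j /andP[]; rewrite /in_block mem_index_iota; lia.
rewrite (big_cat_nat (n := i * k)) //=; last by rewrite leq_mul2r leqnSn orbT.
rewrite big1_seq ?add0n; last first.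
  by move=> j /andP[]; rewrite /in_block mem_index_iota; lia.
rewrite big_nat_cond (eq_bigl (fun j => (i * k <= j < i.+1 * k)%N && true)); last first.
  by move=> j; rewrite /in_block andbT andbb.
by rewrite -big_nat_cond sum_nat_const_nat muln1 mulSn addnK.
Qed.

Lemma sum_block_const (V : nmodType) n k i (v : V) : (i.+1 * k <= n)%N ->
  \sum_(j < n | in_block k i j) v = v *+ k.
Proof.
by move=> h; rewrite -[in RHS](card_block h) -sumrMnr; apply: eq_bigr => j _; rewrite mulr1n.
Qed.

Lemma tr_sigma_hat (R : realType) n d (Y : 'I_n -> 'cV[R]_d) l :
  (sigma_hat Y l)^T = sigma_hat Y l.
Proof. by rewrite /sigma_hat linearZ /= trmx_mul trmxK. Qed.

Lemma sigma_hat_form (R : realType) n d (Y : 'I_n -> 'cV[R]_d) l (x y : 'cV[R]_d) :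
  dotp x (sigma_hat Y l *m y) = l%:R^-1 * \sum_(i < l)
    dotp x (block_avg (n %/ l) Y i) * dotp y (block_avg (n %/ l) Y i).
Proof.
pose B := block_means Y l.
have BE (z : 'cV[R]_d) i : (B^T *m z) i 0 = dotp z (block_avg (n %/ l) Y i).
  rewrite mxE /dotp; apply: eq_bigr => a _; rewrite mulrC; congr (_ * _).
  rewrite !mxE summxE; congr (_ * _).
rewrite /sigma_hat -/B -scalemxAl dotpZr -mulmxA; congr (_ * _).
rewrite [LHS]/dotp; under eq_bigr => a _ do rewrite mxE mulr_sumr.
rewrite exchange_big /=; apply: eq_bigr => i _.
rewrite -!BE mulrC [(B^T *m x) i 0]mxE mulr_sumr; apply: eq_bigr => a _.
by rewrite [B^T i a]mxE; ring.
Qed.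

Lemma block_avg_signal (R : realType) n d k (f : 'I_n -> R) (theta : 'cV[R]_d)
    (xi : 'I_n -> 'cV[R]_d) i :
  block_avg k (fun j => f j *: theta + xi j) i
  = block_mean k f i *: theta + block_avg k xi i.
Proof.
by rewrite /block_avg /block_mean big_split scalerDr -scaler_suml scalerA.
Qed.

(** The average square of the block means of the signs: the factor by which block
    averaging attenuates the signal. *)
Definition purity (R : realType) n (f : 'I_n -> R) (l : nat) : R :=
  l%:R^-1 * \sum_(i < l) block_mean (n %/ l) f i ^+ 2.

(** The weight of observation [j] in the noise term of the block estimator; the
    sum over [i] has one term, or none for the observations left out by the
    blocks. *)
Definition block_coef (R : realType) n (f : 'I_n -> R) (l : nat) (j : 'I_n) : R :=
  (l * (n %/ l))%N%:R^-1 *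
    \sum_(i < l | in_block (n %/ l) i j) block_mean (n %/ l) f i.

Lemma sum_block_coef (R : realType) n d (f : 'I_n -> R) (xi : 'I_n -> 'cV[R]_d) l :
  l%:R^-1 *: \sum_(i < l) block_mean (n %/ l) f i *: block_avg (n %/ l) xi i
  = \sum_j block_coef f l j *: xi j.
Proof.
rewrite scaler_sumr; under [RHS]eq_bigr => j _.
  rewrite /block_coef mulr_sumr scaler_suml big_mkcond; over.
rewrite exchange_big /=; apply: eq_bigr => i _.
rewrite -big_mkcond /block_avg !scalerA scaler_sumr; apply: eq_bigr => j _.
by rewrite natrM invfM; congr (_ *: _); ring.
Qed.

Lemma mem_block_size n l i : (0 < l)%N -> (i < l)%N -> (i.+1 * (n %/ l) <= n)%N.
Proof.
move=> l0 il; apply: (@leq_trans (l * (n %/ l))); first by rewrite leq_mul2r il orbT.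
by rewrite mulnC leq_trunc_div.
Qed.

(** The block weights against the oracle weights [f j / n]. Expanding the square,
    the sum of squares is [a / (l k)], the cross term [a / n] and the oracle term
    [1 / n], where [a] is the purity. The result is small when the blocks are
    nearly pure and few observations are left out. *)
Lemma sum_sqr_block_coef (R : realType) n (f : 'I_n -> R) l :
  (0 < l <= n)%N -> (forall j, f j ^+ 2 = 1) ->
  \sum_j (block_coef f l j - n%:R^-1 * f j) ^+ 2
  = (1 - purity f l) / n%:R
    + purity f l * ((l * (n %/ l))%N%:R^-1 - n%:R^-1).
Proof.
move=> /andP[l0 ln] f1; set k := (n %/ l)%N.
have k0 : (0 < k)%N by rewrite divn_gt0.
have kR : k%:R != 0 :> R by rewrite pnatr_eq0 -lt0n.
have lR : l%:R != 0 :> R by rewrite pnatr_eq0 -lt0n.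
have nR : n%:R != 0 :> R by rewrite pnatr_eq0 -lt0n (leq_trans l0).
set a := purity f l.
have sum_am : \sum_(i < l) block_mean k f i ^+ 2 = l%:R * a by rewrite /a /purity mulVKf.
have coefE (i : 'I_l) (j : 'I_n) : in_block k i j ->
    block_coef f l j = (l * k)%N%:R^-1 * block_mean k f i.
  move=> hij; rewrite /block_coef -/k (bigD1 i) //= big1 ?addr0 // => i' /andP[h1 h2].
  move: hij h1 h2; rewrite !in_blockE // => /eqP ij /eqP ij'.
  by case/eqP; apply: val_inj; rewrite /= ij ij'.
have cross (g : 'I_n -> R) : \sum_j block_coef f l j * g j
    = (l * k)%N%:R^-1 * \sum_(i < l) block_mean k f i * \sum_(j < n | in_block k i j) g j.
  rewrite mulr_sumr; under eq_bigr => j _.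
    rewrite /block_coef -/k mulr_sumr mulr_suml big_mkcond; over.
  rewrite exchange_big /=; apply: eq_bigr => i _.
  by rewrite -big_mkcond [RHS]mulrA [RHS]mulr_sumr.
have meanE i : \sum_(j < n | in_block k i j) f j = k%:R * block_mean k f i.
  by rewrite /block_mean mulVKf.
have e1 : \sum_j block_coef f l j * f j = a.
  rewrite cross; under eq_bigr do rewrite meanE mulrCA -expr2.
  by rewrite -mulr_sumr sum_am natrM; field; rewrite lR kR.
have e2 : \sum_j block_coef f l j * block_coef f l j = (l * k)%N%:R^-1 * a.
  rewrite cross; congr (_ * _).
  transitivity (\sum_(i < l) ((l * k)%N%:R^-1 * k%:R) * block_mean k f i ^+ 2).
    apply: eq_bigr => i _.
    rewrite (eq_bigr (fun=> (l * k)%N%:R^-1 * block_mean k f i)) => [|j]; last exact: coefE.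
    by rewrite sum_block_const ?mem_block_size // -mulr_natr expr2; ring.
  by rewrite -mulr_sumr sum_am natrM; field; rewrite lR kR.
have e3 : \sum_(j < n) f j ^+ 2 = n%:R.
  by under eq_bigr do rewrite f1; rewrite sumr_const card_ord.
transitivity (\sum_j block_coef f l j * block_coef f l j
  - 2 * n%:R^-1 * (\sum_j block_coef f l j * f j) + n%:R^-2 * \sum_(j < n) f j ^+ 2).
  rewrite !mulr_sumr -sumrB -big_split; apply: eq_bigr => j _ /=.
  by field.
rewrite e1 e2 e3 natrM; field; by rewrite nR kR lR.
Qed.

Lemma flips_upto_blocks (V : eqType) (x0 : V) n (z : 'I_n -> V) k l : (0 < k)%N ->
  (\sum_(i < l) \sum_((i * k).+1 <= j < i.+1 * k)
      (extend0 x0 z j != extend0 x0 z j.-1) <= flips_upto x0 z (l * k))%N.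
Proof.
move=> k0; elim: l => [|l IH]; first by rewrite big_ord0.
rewrite big_ord_recr /= /flips_upto.
case: l IH => [|l] IH; first by rewrite big_ord0 add0n mul0n.
rewrite [leqRHS](@big_cat_nat _ _ _ (l.+1 * k)) /= ?muln_gt0 ?k0 ?leq_mul2r ?leqnSn ?orbT //.
apply: leq_add; first exact: IH.
rewrite [leqRHS]big_ltn ?leq_addl //.
by rewrite ltn_mul2r k0 ltnSn.
Qed.

Lemma flips_upto_mono (V : eqType) (x0 : V) n (z : 'I_n -> V) a b : (a <= b)%N ->
  (flips_upto x0 z a <= flips_upto x0 z b)%N.
Proof.
move=> ab; rewrite /flips_upto; have [a0|a0] := leqP 1 a; last first.
  by rewrite big_geq //; lia.
by rewrite [leqRHS](big_cat_nat (n := a)) //= leq_addr.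
Qed.

Lemma signb_sqr (R : realType) b : signb R b ^+ 2 = 1.
Proof. by case: b; rewrite /signb ?sqrrN expr1n. Qed.

Lemma block_mean_sqr_le1 (R : realType) n k (z : 'I_n -> bool) i :
  (0 < k)%N -> (i.+1 * k <= n)%N -> block_mean k (fun j => signb R (z j)) i ^+ 2 <= 1.
Proof.
move=> k0 h; have kR : 0 < k%:R :> R by rewrite ltr0n.
have : `|block_mean k (fun j => signb R (z j)) i| <= 1.
  rewrite /block_mean normrM ger0_norm ?invr_ge0 ?ler0n // mulrC ler_pdivrMr // mul1r.
  apply: (le_trans (ler_norm_sum _ _ _)).
  rewrite (eq_bigr (fun=> 1)) => [|j _]; first by rewrite sum_block_const.
  by case: (z j); rewrite /signb ?normrN normr1.
by move=> h1; rewrite -(real_normK (num_real _)) expr_le1.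
Qed.

(** A block without flip has constant sign, hence block mean 1 or -1. *)
Lemma block_impurity_le_flips (R : realType) n k (z : 'I_n -> bool) i :
  (0 < k)%N -> (i.+1 * k <= n)%N ->
  1 - block_mean k (fun j => signb R (z j)) i ^+ 2 <=
    (\sum_((i * k).+1 <= j < i.+1 * k) (extend0 false z j != extend0 false z j.-1))%N%:R.
Proof.
move=> k0 h; have kR : k%:R != 0 :> R by rewrite pnatr_eq0 -lt0n.
set fl := (\sum_(_ <= j < _) _)%N.
have [fl0|fl0] := posnP fl; last first.
  apply: (@le_trans _ _ 1); first by rewrite lerBlDr lerDl sqr_ge0.
  by rewrite -(ler_nat R) in fl0.
have noflip j : (i * k <= j < i.+1 * k)%N -> extend0 false z j = extend0 false z (i * k).
  move=> /andP[]; elim: j => [|j IH] hj1 hj2.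
    by congr extend0; move: hj1; rewrite leqn0 => /eqP.
  have [e|ne] := eqVneq (i * k)%N j.+1; first by rewrite e.
  have hj : (i * k <= j)%N by lia.
  rewrite -IH //; last by lia.
  move/eqP: fl0; rewrite sum_nat_seq_eq0 => /allP.
  move=> /(_ j.+1); rewrite mem_index_iota ltnS hj hj2 => /(_ isT) /=.
  by rewrite eqb0 negbK => /eqP.
suff -> : block_mean k (fun j => signb R (z j)) i = signb R (extend0 false z (i * k)).
  by rewrite signb_sqr subrr ler0n.
rewrite /block_mean (eq_bigr (fun=> signb R (extend0 false z (i * k)))) => [|j hj].
  by rewrite sum_block_const // -[X in _ * X = _]mulr_natl mulKf.
by rewrite -(noflip j hj) extend0E.
Qed.

Lemma purity_le1 (R : realType) n l (z : 'I_n -> bool) : (0 < l <= n)%N ->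
  purity (fun j => signb R (z j)) l <= 1.
Proof.
move=> /andP[l0 ln]; have k0 : (0 < n %/ l)%N by rewrite divn_gt0.
rewrite /purity mulrC ler_pdivrMr ?ltr0n // mul1r.
apply: (@le_trans _ _ (\sum_(i < l) 1)); last by rewrite sumr_const card_ord.
by apply: ler_sum => i _; apply: block_mean_sqr_le1; rewrite ?mem_block_size.
Qed.

Lemma purity_ge0 (R : realType) n l (f : 'I_n -> R) : 0 <= purity f l.
Proof. by rewrite mulr_ge0 ?invr_ge0 ?ler0n // sumr_ge0 // => i _; rewrite sqr_ge0. Qed.

Lemma impurity_le_block_flips (R : realType) n l (z : 'I_n -> bool) : (0 < l <= n)%N ->
  1 - purity (fun j => signb R (z j)) l <=
  l%:R^-1 * (\sum_(i < l) \sum_((i * (n %/ l)).+1 <= j < i.+1 * (n %/ l))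
      (extend0 false z j != extend0 false z j.-1))%N%:R.
Proof.
move=> /andP[l0 ln]; have k0 : (0 < n %/ l)%N by rewrite divn_gt0.
have lR : l%:R != 0 :> R by rewrite pnatr_eq0 -lt0n.
rewrite -{1}(mulVf lR) /purity -mulrBr ler_wpM2l ?invr_ge0 ?ler0n // natr_sum.
have -> : l%:R = \sum_(i < l) (1 : R) by rewrite sumr_const card_ord.
rewrite -sumrB; apply: ler_sum => i _.
by apply: block_impurity_le_flips; rewrite ?mem_block_size.
Qed.

Lemma impurity_le_flips (R : realType) n l (z : 'I_n -> bool) : (0 < l <= n)%N ->
  1 - purity (fun j => signb R (z j)) l <= (flips_upto false z n)%:R / l%:R.
Proof.
move=> hl; have /andP[l0 ln] := hl; have k0 : (0 < n %/ l)%N by rewrite divn_gt0.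
apply: le_trans (impurity_le_block_flips R z hl) _.
rewrite mulrC ler_wpM2r ?invr_ge0 ?ler0n // ler_nat.
apply: leq_trans (flips_upto_blocks _ _ _ k0) _.
by apply: flips_upto_mono; rewrite mulnC leq_trunc_div.
Qed.

(** For [n < 2 l] the blocks have one element. *)
Lemma impurity_singletons (R : realType) n l (z : 'I_n -> bool) : (0 < l <= n)%N ->
  (n < 2 * l)%N -> 1 - purity (fun j => signb R (z j)) l <= 0.
Proof.
move=> hl hn; have /andP[l0 ln] := hl.
have k1 : (n %/ l = 1)%N by apply/eqP; rewrite eqn_leq divn_gt0 // ln andbT -ltnS ltn_divLR.
apply: le_trans (impurity_le_block_flips R z hl) _.
by rewrite k1 big1 ?mulr0 // => i _; rewrite !muln1 big_geq.
Qed.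

(** * Linear combinations of the noise vectors *)

Lemma integrable_le_finite (R : realType) disp (T : measurableType disp)
    (P : probability T R) (f g : T -> R) (c : R) :
  measurable_fun setT f -> measurable_fun setT g -> (forall w, `|f w| <= g w) ->
  (\int[P]_w (g w)%:E <= c%:E)%E -> P.-integrable setT (EFin \o f).
Proof.
move=> mf mg fg gc; apply/integrableP; split; first exact/measurable_EFinP.
apply: (le_lt_trans _ (ltry c)); apply: le_trans gc.
apply: ge0_le_integral => //.
- by apply/measurable_EFinP; exact: measurableT_comp.
- exact/measurable_EFinP.
- by move=> w _; rewrite /= lee_fin.
Qed.

(** Bounding the exponential below by its tangent at [t m], where [m] is the mean,
    gives [t m <= t^2 v / 2] for all [t], which forces [m = 0]. *)
Lemma mean_zero_of_mgf (R : realType) disp (T : measurableType disp)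
    (P : probability T R) (f : T -> R) (v : R) :
  measurable_fun setT f -> 0 <= v ->
  (forall t, \int[P]_w (expR (t * f w))%:E <= (expR (t ^+ 2 * v / 2))%:E)%E ->
  P.-integrable setT (EFin \o f) /\ (\int[P]_w (f w)%:E = 0)%E.
Proof.
move=> mf v0 mgf.
have mexp t : measurable_fun setT (fun w => expR (t * f w)).
  apply: measurableT_comp => //; apply: measurable_funM => //; exact: measurable_cst.
have intexp t : P.-integrable setT (EFin \o (fun w => expR (t * f w))).
  by apply: (integrable_le_finite (mexp t) (mexp t) _ (mgf t)) => w; rewrite ger0_norm ?expR_ge0.
have intf : P.-integrable setT (EFin \o f).
  apply: (le_integrable _ _ _ (integrableD measurableT (intexp 1) (intexp (-1)))) => //.
    exact/measurable_EFinP.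
  move=> w _ /=; rewrite lee_fin [leRHS]ger0_norm ?addr_ge0 ?expR_ge0 // mul1r mulN1r.
  have := expR_ge1Dx (f w); have := expR_ge1Dx (- f w).
  have := expR_ge0 (f w); have := expR_ge0 (- f w).
  by move=> *; rewrite ler_norml; apply/andP; split; lra.
split=> //.
have fin := integrable_fin_num measurableT intf.
move: (fineK fin); set m := fine _ => mE; rewrite -[LHS]mE.
have tm t : t * m <= t ^+ 2 * v / 2.
  rewrite -ler_expR -lee_fin; apply: le_trans (mgf t).
  have int1 : P.-integrable setT (EFin \o (fun w => expR (t * m) * (1 - t * m))).
    exact: finite_measure_integrable_cst.
  have int2 : P.-integrable setT (EFin \o (fun w => expR (t * m) * t * f w)).
    have := integrableZl measurableT (expR (t * m) * t) intf.
    by congr (P.-integrable setT _); apply/funext => w /=; rewrite EFinM.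
  (* tangent line of the exponential at t * m *)
  apply: (@le_trans _ _ (\int[P]_w ((expR (t * m) * (1 - t * m))%:E
      + (expR (t * m) * t * f w)%:E))%E).
    rewrite integralD_EFin // integral_cst //= probability_setT mule1.
    under [X in (_ <= _ + X)%E]eq_integral do rewrite EFinM.
    rewrite integralZl // [X in (_ <= _ + _ * X)%E](_ : _ = m%:E) //.
    by rewrite -EFinM -EFinD lee_fin; lra.
  apply: le_integral => //; [exact: integrableD|exact: (intexp t)|].
  move=> w _; rewrite /= -EFinD lee_fin.
  have := ler_wpM2l (expR_ge0 (t * m)) (expR_ge1Dx (t * f w - t * m)).
  have eE : t * m + (t * f w - t * m) = t * f w by ring.
  by rewrite -expRD eE; lra.
have v1 : 0 < v + 1 by rewrite ltr_wpDl.
have h := tm (m / (v + 1)).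
have this : m ^+ 2 <= 0.
  have e1 : (m / (v + 1)) ^+ 2 * v / 2 = m ^+ 2 * v / 2 / (v + 1) ^+ 2 by field; lra.
  have e2 : m / (v + 1) * m = m ^+ 2 * (v + 1) / (v + 1) ^+ 2 by field; lra.
  move: h; rewrite e1 e2 ler_pM2r ?invr_gt0 ?exprn_gt0 //.
  by have := mulr_ge0 (sqr_ge0 m) v0; lra.
have h2 : m ^+ 2 = 0 by apply/eqP; rewrite eq_le this sqr_ge0.
by move/eqP: h2; rewrite sqrf_eq0 => /eqP ->.
Qed.

(** The positive and negative parts of a centred variable have equal means, so the
    four products of parts have the same mean and cancel in pairs. *)
Lemma integral_mul_indep_mean_zero (R : realType) disp (T : measurableType disp)
    (P : probability T R) (f g : T -> R) :
  measurable_fun setT f -> measurable_fun setT g ->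
  P.-integrable setT (EFin \o f) -> (\int[P]_w (f w)%:E = 0)%E ->
  P.-integrable setT (EFin \o g) -> (\int[P]_w (g w)%:E = 0)%E ->
  (forall A B : set R, measurable A -> measurable B ->
     P (f @^-1` A `&` g @^-1` B) = (P (f @^-1` A) * P (g @^-1` B))%E) ->
  (\int[P]_w (f w * g w)%:E = 0)%E.
Proof.
move=> mf mg intf f0 intg g0 ind.
pose pos (h : T -> R) w := Num.max (h w) 0.
have pos_ge0 h w : 0 <= pos h w by rewrite le_max lexx orbT.
have mmax : measurable_fun setT (fun x : R => Num.max x 0).
  by apply: measurable_maxr; [exact: measurable_id|exact: measurable_cst].
have mpos h : measurable_fun setT h -> measurable_fun setT (pos h).
  by move=> mh; exact: (measurableT_comp mmax mh).
have mopp (h : T -> R) : measurable_fun setT h -> measurable_fun setT (fun w => - h w).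
  by move=> mh; exact: measurable_funN.
have ipos h : measurable_fun setT h -> P.-integrable setT (EFin \o h) ->
    P.-integrable setT (EFin \o pos h).
  move=> mh; apply: le_integrable => //; first by apply/measurable_EFinP; exact: mpos.
  move=> w _; rewrite /= lee_fin /pos; case: (leP (h w) 0) => hw.
    by rewrite normr0.
  by [].
have part h : measurable_fun setT h -> P.-integrable setT (EFin \o h) ->
    (\int[P]_w (h w)%:E = 0)%E -> exists2 c : R,
    (\int[P]_w (pos h w)%:E = c%:E)%E & (\int[P]_w (pos (fun w => - h w) w)%:E = c%:E)%E.
  move=> mh ih h0.
  have ip := ipos _ mh ih.
  have iN : P.-integrable setT (EFin \o (fun w => - h w)).
    have := integrableN ih; by congr (P.-integrable setT _); apply/funext => w /=.
  have in_ := ipos _ (mopp _ mh) iN.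
  have fp := integrable_fin_num measurableT ip.
  have fn := integrable_fin_num measurableT in_.
  exists (fine (\int[P]_w (pos h w)%:E)); first by rewrite fineK.
  have : (\int[P]_w ((pos h w)%:E - (pos (fun w => - h w) w)%:E) = 0)%E.
    rewrite -h0; apply: eq_integral => w _; rewrite -EFinB /pos; congr (_%:E).
    by case: (leP (h w) 0) => a; case: (leP (- h w) 0) => b; lra.
  rewrite integralB_EFin // -(fineK fp) -(fineK fn) -EFinB => -[] /eqP.
  by rewrite subr_eq0 => /eqP ->; rewrite fineK.
have [a fa fa'] := part f mf intf f0; have [b gb gb'] := part g mg intg g0.
have indp (s t : R -> R) : measurable_fun setT s -> measurable_fun setT t ->
    (forall x, 0 <= s x) -> (forall x, 0 <= t x) ->
    (\int[P]_w (s (f w) * t (g w))%:E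
      = \int[P]_w (s (f w))%:E * \int[P]_w (t (g w))%:E)%E.
  move=> ms mt s0 t0; apply: expectation_mul_indep.
  - exact: measurableT_comp.
  - exact: measurableT_comp.
  - by move=> w; exact: s0.
  - by move=> w; exact: t0.
  move=> A B mA mB.
  have := ind (s @^-1` A) (t @^-1` B); apply.
    by rewrite -[X in measurable X]setTI; exact: ms.
  by rewrite -[X in measurable X]setTI; exact: mt.
pose mx (x : R) := Num.max x 0; pose mn (x : R) := Num.max (- x) 0.
have mmx : measurable_fun setT mx by [].
have mmn : measurable_fun setT mn.
  by apply: (measurableT_comp mmax); exact: measurable_funN.
have mx0 x : 0 <= mx x by rewrite le_max lexx orbT.
have mn0 x : 0 <= mn x by rewrite le_max lexx orbT.
have e1 := indp mx mx mmx mmx mx0 mx0; have e2 := indp mn mn mmn mmn mn0 mn0.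
have e3 := indp mx mn mmx mmn mx0 mn0; have e4 := indp mn mx mmn mmx mn0 mx0.
move: e1 e2 e3 e4; rewrite fa fa' gb gb' -!EFinM => e1 e2 e3 e4.
have mM (s t : R -> R) : measurable_fun setT s -> measurable_fun setT t ->
    measurable_fun setT (fun w => s (f w) * t (g w)).
  by move=> ms mt; apply: measurable_funM; exact: measurableT_comp.
have iM (s t : R -> R) : measurable_fun setT s -> measurable_fun setT t ->
    (forall x, 0 <= s x) -> (forall x, 0 <= t x) ->
    (\int[P]_w (s (f w) * t (g w))%:E = (a * b)%:E)%E ->
    P.-integrable setT (EFin \o (fun w => s (f w) * t (g w))).
  move=> ms mt s0 t0 e; apply: (@integrable_le_finite _ _ _ P _ (fun w => s (f w) * t (g w)) (a * b));
    last by rewrite e.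
  - exact: mM.
  - exact: mM.
  - by move=> w; rewrite ger0_norm // mulr_ge0.
have i1 := iM _ _ mmx mmx mx0 mx0 e1; have i2 := iM _ _ mmn mmn mn0 mn0 e2.
have i3 := iM _ _ mmx mmn mx0 mn0 e3; have i4 := iM _ _ mmn mmx mn0 mx0 e4.
transitivity (\int[P]_w ((mx (f w) * mx (g w) + mn (f w) * mn (g w))%:E
   - (mx (f w) * mn (g w) + mn (f w) * mx (g w))%:E))%E.
  apply: eq_integral => w _; rewrite -EFinB; congr (_%:E).
  have dec (x : R) : x = mx x - mn x.
    by rewrite /mx /mn; case: (leP x 0) => h; case: (leP (- x) 0) => h'; lra.
  by rewrite {1}(dec (f w)) {1}(dec (g w)); ring.
have iD (f1 f2 : T -> R) : P.-integrable setT (EFin \o f1) -> P.-integrable setT (EFin \o f2) ->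
    P.-integrable setT (EFin \o (fun w => f1 w + f2 w)).
  by move=> h1 h2; have := integrableD measurableT h1 h2.
rewrite integralB_EFin //; [|exact: iD|exact: iD].
under eq_integral do rewrite EFinD.
under [X in (_ - X)%E]eq_integral do rewrite EFinD.
rewrite (integralD_EFin _ i1 i2) // (integralD_EFin _ i3 i4) //.
rewrite [X in (X + _ - _)%E]e1 [X in (_ + X - _)%E]e2 [X in (_ - (X + _))%E]e3.
rewrite [X in (_ - (_ + X))%E]e4 -!EFinD.
by rewrite subrr.
Qed.

Lemma prode_le (R : realType) (I : Type) (r : seq I) (f g : I -> \bar R) :
  (forall i, 0 <= f i <= g i)%E -> (0 <= \prod_(i <- r) f i <= \prod_(i <- r) g i)%E.
Proof.
move=> fg; elim: r => [|i r /andP[h0 h1]]; first by rewrite !big_nil lee01 lexx.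
by rewrite !big_cons; have /andP[a0 a1] := fg i; rewrite mule_ge0 //= lee_pmul.
Qed.

Definition noise_comb (R : realType) disp (T : measurableType disp)
    (P : probability T R) (n d : nat) (xi : 'I_n -> {RV P >-> d.-tuple R})
    (c : 'I_n -> R) (w : T) : 'cV[R]_d := \sum_j c j *: col_of_tuple (xi j w).

Lemma dotp_noise_comb (R : realType) disp (T : measurableType disp)
    (P : probability T R) (n d : nat) (xi : 'I_n -> {RV P >-> d.-tuple R})
    (c : 'I_n -> R) (x : 'cV[R]_d) (w : T) :
  dotp x (noise_comb xi c w) = \sum_j c j * dotp x (col_of_tuple (xi j w)).
Proof. by rewrite dotp_sumr; apply: eq_bigr => j _; rewrite dotpZr. Qed.

Section noise.
Context (R : realType) disp (T : measurableType disp) (P : probability T R).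
Context (n d : nat) (xi : 'I_n -> {RV P >-> d.-tuple R}).
Let F i := g_sigma_algebra_preimage (xi i).
Let X x i w := dotp x (col_of_tuple (xi i w)).

Lemma noise_sets_measurable i : F i `<=` measurable.
Proof.
by move=> _ [B mB <-]; rewrite setTI -[X in measurable X]setTI; exact: measurable_funP.
Qed.

Lemma noise_setsI i : setI_closed (F i).
Proof.
move=> _ _ [A mA <-] [B mB <-]; exists (A `&` B); first exact: measurableI.
by rewrite !setTI preimage_setI.
Qed.

Lemma noise_setsT i : F i setT.
Proof. by exists setT => //; rewrite setTI preimage_setT. Qed.

Lemma block_measurable_noise (J : pred 'I_n) i x : J i -> block_measurable F J (X x i).
Proof.
move=> Ji.
have -> : X x i = fun w => \sum_a x a 0 * tnth (xi i w) a.
  by apply/funext => w; apply: eq_bigr => a _; rewrite mxE.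
apply: measurable_sum => a; apply: measurable_funM; first exact: measurable_cst.
move=> _ Y mY; rewrite setTI; apply: sub_sigma_algebra; exists i => //.
exists ((fun t : d.-tuple R => tnth t a) @^-1` Y) => //.
  by rewrite -[X in measurable X]setTI; exact: measurable_tnth.
by rewrite setTI.
Qed.

Lemma block_measurable_noise_comb (J : pred 'I_n) (c : 'I_n -> R) x :
  (forall i, ~~ J i -> c i = 0) ->
  block_measurable F J (fun w => dotp x (noise_comb xi c w)).
Proof.
move=> c0.
have -> : (fun w => dotp x (noise_comb xi c w)) = fun w => \sum_j c j * X x j w.
  by apply/funext => w; exact: dotp_noise_comb.
apply: measurable_sum => j; have [Jj|/c0 ->] := boolP (J j).
  by apply: measurable_funM; [exact: measurable_cst|exact: block_measurable_noise].
by under eq_fun do rewrite mul0r; exact: measurable_cst.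
Qed.

Lemma measurable_noise_comb (c : 'I_n -> R) x :
  measurable_fun setT (fun w => dotp x (noise_comb xi c w)).
Proof.
apply: (@measurable_fun_generated _ _ _ (joint_sets F predT)).
  by move=> A [i _]; exact: noise_sets_measurable.
exact: (block_measurable_noise_comb (J := predT)).
Qed.

Lemma noise_sets_generated : <<s joint_sets F predT >> `<=` g_sigma_preimage xi.
Proof.
apply: smallest_sub; first exact: smallest_sigma_algebra.
move=> A [i _ FA]; apply: sub_sigma_algebra; rewrite -bigcup_seq; exists i => //.
by rewrite /= mem_index_enum.
Qed.

Lemma generated_noise_comb_gt (c : 'I_n -> R) x (r : R) :
  g_sigma_preimage xi [set w | r < dotp x (noise_comb xi c w)].
Proof.
apply: noise_sets_generated.
have c0 i : ~~ predT i -> c i = 0 by [].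
have := @block_measurable_noise_comb predT c x c0.
have mr : measurable `]r, +oo[%classic by exact: measurable_itv.
move=> /(_ measurableT _ mr); rewrite setTI; congr (<<s _ >> _).
by apply/seteqP; split=> w /=; rewrite in_itv /= andbT.
Qed.

Context (noise : noise_model xi).

Lemma noise_mgf x i t :
  (\int[P]_w (expR (t * X x i w))%:E <= (expR (t ^+ 2 * dotp x x / 2))%:E)%E.
Proof.
have [_ _ _ /(_ i)/(_ (t *: x))] := noise.
rewrite unlock sqr_enorm !dotpE mulrA -expr2 => h; apply: le_trans h.
by rewrite le_eqVlt; apply/orP; left; apply/eqP; apply: eq_integral => w _; rewrite dotpZl.
Qed.

Lemma noise_comb_mgf (c : 'I_n -> R) x t :
  (\int[P]_w (expR (t * dotp x (noise_comb xi c w)))%:E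
     <= (expR (t ^+ 2 * ((\sum_j c j ^+ 2) * dotp x x) / 2))%:E)%E.
Proof.
pose J (a : nat) : pred 'I_n := fun i => val i == a.
pose f (a : nat) (w : T) : R :=
  if insub a is Some j then expR (t * c j * X x j w) else 1.
have fE (j : 'I_n) w : f j w = expR (t * c j * X x j w) by rewrite /f valK.
have -> : (\int[P]_w (expR (t * dotp x (noise_comb xi c w)))%:E
    = \int[P]_w (\prod_(a < n) f a w)%:E)%E.
  apply: eq_integral => w _; congr (_%:E).
  rewrite dotp_noise_comb mulr_sumr expR_sum; apply: eq_bigr => j _.
  by rewrite fE mulrA.
have [ind _ _ _] := noise.
rewrite (@expectation_prod_blocks _ _ _ P n F J f).
- apply: (@le_trans _ _ (\prod_(j < n) (expR ((t * c j) ^+ 2 * dotp x x / 2))%:E)%E).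
    suff /andP[_] : (0 <= \prod_(j < n) \int[P]_w (f j w)%:E
        <= \prod_(j < n) (expR ((t * c j) ^+ 2 * dotp x x / 2))%:E)%E by [].
    apply: prode_le => j; rewrite integral_ge0 => [|w _].
      by under eq_integral do rewrite fE; exact: noise_mgf.
    by rewrite lee_fin fE expR_ge0.
  rewrite prodEFin lee_fin -expR_sum ler_expR -!mulr_suml.
  rewrite le_eqVlt; apply/orP; left; apply/eqP; under eq_bigr do rewrite exprMn.
  by rewrite -mulr_sumr mulrA.
- exact: noise_sets_measurable.
- exact: noise_setsI.
- exact: noise_setsT.
- exact: ind.
- by move=> a b i /eqP <- /eqP.
- move=> a; rewrite /block_measurable /f; case: insubP => [j _ ja|_]; last exact: measurable_cst.
  apply: measurableT_comp => //; apply: measurable_funM; first exact: measurable_cst.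
  by apply: block_measurable_noise; rewrite /J ja.
- by move=> a w; rewrite /f; case: insub => // j; exact: expR_ge0.
Qed.

Lemma measurable_noise x i : measurable_fun setT (X x i).
Proof.
apply: (@measurable_fun_generated _ _ _ (joint_sets F predT)).
  by move=> A [j _]; exact: noise_sets_measurable.
exact: (block_measurable_noise (J := predT)).
Qed.

Lemma noise_mean x i :
  P.-integrable setT (EFin \o X x i) /\ (\int[P]_w (X x i w)%:E = 0)%E.
Proof.
apply: (mean_zero_of_mgf (measurable_noise x i) (dotp_ge0 x)) => t; exact: noise_mgf.
Qed.

Lemma noise_second_moment x i : (\int[P]_w (X x i w ^+ 2)%:E = (dotp x x)%:E)%E.
Proof.
have [_ _ /(_ i) iso _] := noise.
pose xc a w := col_of_tuple (xi i w) a 0.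
have isoE a b : (\int[P]_w (xc a w * xc b w)%:E = (a == b)%:R%:E)%E.
  by have := iso a b; rewrite unlock mxE.
have mxc a : measurable_fun setT (xc a).
  have := measurable_noise (delta_mx a 0) i; congr measurable_fun.
  apply/funext => w; rewrite /X /dotp (bigD1 a) //= mxE !eqxx mul1r big1 ?addr0 // => b ba.
  by rewrite mxE (negPf ba) mul0r.
have sqint a : P.-integrable setT (EFin \o (fun w => xc a w * xc a w)).
  apply: (@integrable_le_finite _ _ _ P _ (fun w => xc a w * xc a w) 1).
  - exact: measurable_funM.
  - exact: measurable_funM.
  - by move=> w; rewrite ger0_norm // -expr2 sqr_ge0.
  - by rewrite isoE eqxx.
have prodint a b : P.-integrable setT (EFin \o (fun w => xc a w * xc b w)).
  apply: (le_integrable measurableT _ _ (integrableD measurableT (sqint a) (sqint b))).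
    by apply/measurable_EFinP; exact: measurable_funM.
  move=> w _ /=; rewrite lee_fin [leRHS]ger0_norm; last by rewrite addr_ge0 // -expr2 sqr_ge0.
  rewrite ler_norml; have := sqr_ge0 (xc a w - xc b w); have := sqr_ge0 (xc a w + xc b w).
  have := sqr_ge0 (xc a w); have := sqr_ge0 (xc b w).
  by rewrite !expr2 => *; apply/andP; split; lra.
transitivity (\int[P]_w (\sum_a \sum_b (x a 0 * x b 0)%:E * (xc a w * xc b w)%:E))%E.
  apply: eq_integral => w _.
  under eq_bigr do under eq_bigr do rewrite -EFinM.
  under eq_bigr do rewrite sumEFin.
  rewrite sumEFin; congr (_%:E).
  rewrite expr2 {1}/X /dotp mulr_suml; apply: eq_bigr => a _.
  by rewrite /X /dotp mulr_sumr; apply: eq_bigr => b _; rewrite /xc; ring.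
rewrite integral_sum //; last first.
  by move=> a; apply: integrable_sum => // b _; exact: (integrableZl measurableT _ (prodint a b)).
under eq_bigr => a _.
  rewrite integral_sum //; last by move=> b; exact: (integrableZl measurableT _ (prodint _ b)).
  under eq_bigr => b _ do rewrite (integralZl measurableT (prodint a b)) isoE -EFinM.
  rewrite sumEFin (bigD1 a) //= eqxx mulr1 big1 ?addr0 => [|b ba]; last first.
    by rewrite eq_sym (negPf ba) mulr0.
  over.
by rewrite sumEFin.
Qed.

Lemma noise_cross x i j : i != j -> (\int[P]_w (X x i w * X x j w)%:E = 0)%E.
Proof.
move=> ij; have [ind _ _ _] := noise.
have [ii i0] := noise_mean x i; have [ij' j0] := noise_mean x j.
apply: integral_mul_indep_mean_zero => //; try exact: measurable_noise.
move=> A B mA mB.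
apply: (@indep_blocks _ _ _ P n F (pred1 i) (pred1 j)).
- exact: noise_sets_measurable.
- exact: noise_setsI.
- exact: noise_setsT.
- exact: ind.
- by move=> a /eqP ->.
- by have := @block_measurable_noise (pred1 i) i x (eqxx i) measurableT A mA; rewrite setTI.
- by have := @block_measurable_noise (pred1 j) j x (eqxx j) measurableT B mB; rewrite setTI.
Qed.

Lemma noise_comb_second_moment (c : 'I_n -> R) x :
  (\int[P]_w (dotp x (noise_comb xi c w) ^+ 2)%:E
     = ((\sum_j c j ^+ 2) * dotp x x)%:E)%E.
Proof.
have sqint i : P.-integrable setT (EFin \o (fun w => X x i w * X x i w)).
  apply: (@integrable_le_finite _ _ _ P _ (fun w => X x i w ^+ 2) (dotp x x)).
  - by apply: measurable_funM; exact: measurable_noise.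
  - by apply: measurable_funX; exact: measurable_noise.
  - by move=> w; rewrite -expr2 ger0_norm // sqr_ge0.
  - by rewrite noise_second_moment.
have prodint i j : P.-integrable setT (EFin \o (fun w => X x i w * X x j w)).
  apply: (le_integrable measurableT _ _ (integrableD measurableT (sqint i) (sqint j))).
    by apply/measurable_EFinP; apply: measurable_funM; exact: measurable_noise.
  move=> w _ /=; rewrite lee_fin [leRHS]ger0_norm; last by rewrite addr_ge0 // -expr2 sqr_ge0.
  rewrite ler_norml.
  have := sqr_ge0 (X x i w - X x j w); have := sqr_ge0 (X x i w + X x j w).
  have := sqr_ge0 (X x i w); have := sqr_ge0 (X x j w).
  by rewrite !expr2 => *; apply/andP; split; lra.
transitivity (\int[P]_w (\sum_i \sum_j (c i * c j)%:E * (X x i w * X x j w)%:E))%E.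
  apply: eq_integral => w _.
  under eq_bigr do under eq_bigr do rewrite -EFinM.
  under eq_bigr do rewrite sumEFin.
  rewrite sumEFin; congr (_%:E).
  rewrite expr2 dotp_noise_comb mulr_suml; apply: eq_bigr => a _.
  by rewrite mulr_sumr; apply: eq_bigr => b _; rewrite /X; ring.
rewrite integral_sum //; last first.
  by move=> a; apply: integrable_sum => // b _; exact: (integrableZl measurableT _ (prodint a b)).
rewrite mulr_suml -sumEFin; apply: eq_bigr => i _.
rewrite integral_sum //; last by move=> b; exact: (integrableZl measurableT _ (prodint _ b)).
rewrite (bigD1 i) //= (integralZl measurableT (prodint i i)) big1 ?adde0 => [|j ji].
  rewrite (eq_integral (fun w => (X x i w ^+ 2)%:E)); last first.
    by move=> w _; rewrite /= expr2.
  by rewrite noise_second_moment -EFinM -expr2.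
by rewrite (integralZl measurableT (prodint i j)) noise_cross ?mule0 // eq_sym.
Qed.

End noise.

(** * Deviation bounds *)

Lemma chernoff_gt (R : realType) disp (T : measurableType disp)
    (P : probability T R) (f : T -> R) (t a b : R) :
  measurable_fun setT f -> 0 < t ->
  (\int[P]_w (expR (t * f w))%:E <= (expR b)%:E)%E ->
  (P [set w | (a < f w)%R] <= (expR (b - t * a))%:E)%E.
Proof.
move=> mf t0 mgf; pose X : {RV P >-> R} := mfun_Sub (mem_set mf).
have := @chernoff _ _ _ P X t a t0; rewrite /mmt_gen_fun unlock.
have -> : (\int[P]_w ((expR \o t \o* X) w)%:E = \int[P]_w (expR (t * f w))%:E)%E.
  by apply: eq_integral => w _; rewrite /= mulrC.
move=> h; apply: le_trans (le_trans h _); last first.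
  by rewrite expRD EFinM lee_wpmul2r // lee_fin expR_ge0.
apply: le_measure.
- rewrite inE; have -> : [set w | a < f w] = f @^-1` `]a, +oo[%classic.
    by apply/seteqP; split=> w /=; rewrite in_itv /= andbT.
  by rewrite -[X in measurable X]setTI; apply: (mf measurableT); exact: measurable_itv.
- rewrite inE; have -> : [set w | a <= X w] = f @^-1` `[a, +oo[%classic.
    by apply/seteqP; split=> w /=; rewrite in_itv /= andbT.
  by rewrite -[X in measurable X]setTI; apply: (mf measurableT); exact: measurable_itv.
- by move=> w /=; exact: ltW.
Qed.

(** The factor [64 ^ d] is the size of the net, and 2 leaves room for two-sided
    events. *)
Lemma net_size_bound (R : realType) d : (0 < d)%N ->
  (2 * 64 ^ d)%N%:R * expR (- (8 * d%:R)) <= expR (- d%:R) :> R.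
Proof.
move=> d0.
have e7 : 128 <= expR 7 :> R.
  have -> : expR 7 = expR 1 ^+ 7 :> R by rewrite -expRM_natl mulr1.
  have -> : 128 = 2 ^+ 7 :> R by rewrite -natrX.
  by rewrite lerXn2r ?nnegrE ?expR_ge0 //; have := expR_ge1Dx (1 : R); lra.
have -> : - (8 * d%:R) = - d%:R - d%:R * 7 :> R by ring.
rewrite expRB mulrCA ler_piMr ?expR_ge0 // ler_pdivrMr ?expR_gt0 // mul1r.
rewrite expRM_natl; apply: (@le_trans _ _ (128 ^+ d)).
  rewrite -natrX ler_nat; apply: (@leq_trans (2 ^ d * 64 ^ d)).
    by apply: leq_mul => //; rewrite (@leq_exp2l 2 1).
  by rewrite -expnMn.
by rewrite lerXn2r ?nnegrE ?expR_ge0.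
Qed.

Section tails.
Context (R : realType) disp (T : measurableType disp) (P : probability T R).
Context (n d : nat) (xi : 'I_n -> {RV P >-> d.-tuple R}) (noise : noise_model xi).

Lemma noise_comb_gt_tail (c : 'I_n -> R) (x : 'cV[R]_d) :
  (0 < d)%N -> dotp x x <= 1 ->
  (P [set w | (4 * Num.sqrt (d%:R * \sum_j c j ^+ 2) < dotp x (noise_comb xi c w))%R]
    <= (expR (- (8 * d%:R)))%:E)%E.
Proof.
move=> d0 x1; set v := \sum_j c j ^+ 2; set r := 4 * _.
have v0 : 0 <= v by apply: sumr_ge0 => j _; exact: sqr_ge0.
have r0 : 0 <= r by rewrite mulr_ge0 // sqrtr_ge0.
have r2 : r ^+ 2 = 16 * (d%:R * v) by rewrite exprMn sqr_sqrtr ?mulr_ge0 ?ler0n //; ring.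
have dR : 0 < d%:R :> R by rewrite ltr0n.
have [v_eq0|v_neq0] := eqVneq v 0.
  have c0 j : c j = 0.
    have /(psumr_eq0P) := v_eq0 => /(_ _ j isT) h; apply/eqP.
    by rewrite -sqrf_eq0; apply/eqP; apply: h => i _; exact: sqr_ge0.
  rewrite (_ : mkset _ = set0) ?measure0 ?lee_fin ?expR_ge0 //.
  apply/seteqP; split=> w //=.
  rewrite dotp_noise_comb big1 => [|j _]; last by rewrite c0 mul0r.
  by rewrite ltNge r0.
have vp : 0 < v by rewrite lt_def v_neq0.
have rp : 0 < r by rewrite mulr_gt0 // sqrtr_gt0 mulr_gt0.
have t0 : 0 < r / v by rewrite divr_gt0.
have := chernoff_gt r (measurable_noise_comb xi c x) t0 (noise_comb_mgf noise c x _).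
move/le_trans; apply; rewrite lee_fin ler_expR -/v.
have -> : r / v * r = 16 * d%:R by rewrite mulrAC -expr2 r2; field.
have -> : (r / v) ^+ 2 * (v * dotp x x) / 2 = 8 * d%:R * dotp x x.
  by rewrite exprMn r2; field.
by have := ler_wpM2l (ltW dR) x1; lra.
Qed.

(** A union bound over the net of the Chernoff bounds in its directions. The bad
    event belongs to the sigma-algebra of the noise, so that the weights may later
    be functions of the signs. *)
Lemma linear_tail (c : 'I_n -> R) : (0 < d)%N ->
  exists B, [/\ measurable B, g_sigma_preimage xi B, (P B <= (expR (- d%:R))%:E)%E &
    forall w, ~ B w ->
      enorm (noise_comb xi c w) ^+ 2 <= 29 * (d%:R * \sum_j c j ^+ 2)].
Proof.
move=> d0; have [s [size_s ball net]] := @ball_net R d d0.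
set r := 4 * Num.sqrt (d%:R * \sum_j c j ^+ 2).
pose A x := [set w | r < dotp x (noise_comb xi c w)].
have mA x : measurable (A x).
  have -> : A x = (fun w => dotp x (noise_comb xi c w)) @^-1` `]r, +oo[%classic.
    by apply/seteqP; split=> w /=; rewrite in_itv /= andbT.
  rewrite -[X in measurable X]setTI; apply: (measurable_noise_comb xi c x measurableT).
  exact: measurable_itv.
exists (\big[setU/set0]_(x <- s) A x); split.
- by apply: bigsetU_measurable => x _.
- have : @measurable _ (g_sigma_algebraType (\big[setU/set0]_(i < n)
    preimage_set_system setT (xi i) measurable)) (\big[setU/set0]_(x <- s) A x); last by [].
  by apply: bigsetU_measurable => x _; exact: generated_noise_comb_gt.
- apply: le_trans (prob_bigsetU_le _ _ _ mA) _.
  apply: (@le_trans _ _ (\sum_(x <- s) (expR (- (8 * d%:R)))%:E)%E).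
    rewrite big_seq [leRHS]big_seq; apply: lee_sum => x xs.
    exact: noise_comb_gt_tail d0 (ball x xs).
  rewrite sumEFin lee_fin big_const_seq count_predT iter_addr_0 -[leLHS]mulr_natl.
  apply: le_trans (net_size_bound R d0); rewrite ler_wpM2r ?expR_ge0 // ler_nat.
  by apply: leq_trans size_s _; rewrite leq_pmull.
move=> w nB.
have le_r x : x \in s -> dotp x (noise_comb xi c w) <= r.
  move=> xs; rewrite leNgt; apply/negP => h; apply: nB; rewrite -bigcup_seq.
  by exists x.
have := enorm_le_net net le_r => h.
have : enorm (noise_comb xi c w) ^+ 2 <= (4 / 3 * r) ^+ 2.
  by rewrite ler_sqr ?nnegrE ?enorm_ge0 // mulr_ge0 // mulr_ge0 // sqrtr_ge0.
have v0 : 0 <= d%:R * \sum_j c j ^+ 2.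
  by rewrite mulr_ge0 ?ler0n // sumr_ge0 // => j _; exact: sqr_ge0.
(* (4 / 3 * 4)^2 <= 29 *)
have r2 : r ^+ 2 = 16 * (d%:R * \sum_j c j ^+ 2) by rewrite exprMn sqr_sqrtr //; ring.
by rewrite exprMn r2 => h2; apply: le_trans h2 _; lra.
Qed.

(** Weights of the block average, scaled so that their squares sum to 1. *)
Definition block_weight (k i : nat) (j : 'I_n) : R :=
  if in_block k i j then (Num.sqrt k%:R)^-1 else 0.

Lemma block_weight_comb k i w : (0 < k)%N ->
  noise_comb xi (block_weight k i) w
    = Num.sqrt k%:R *: block_avg k (fun j => col_of_tuple (xi j w)) i.
Proof.
move=> k0; have kR : 0 < k%:R :> R by rewrite ltr0n.
rewrite /block_avg scalerA scaler_sumr [RHS]big_mkcond; apply: eq_bigr => j _.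
rewrite /block_weight; case: ifP => _; last by rewrite scale0r.
congr (_ *: _); rewrite -{3}(sqr_sqrtr (ltW kR)).
by field; rewrite sqrtr_eq0 -ltNge.
Qed.

Lemma sum_sqr_block_weight k i : (0 < k)%N -> (i.+1 * k <= n)%N ->
  \sum_j block_weight k i j ^+ 2 = 1.
Proof.
move=> k0 h; have kR : 0 < k%:R :> R by rewrite ltr0n.
transitivity (\sum_(j < n | in_block k i j) (k%:R^-1 : R)).
  rewrite [RHS]big_mkcond; apply: eq_bigr => j _; rewrite /block_weight.
  by case: ifP => _; rewrite ?expr0n // exprVn sqr_sqrtr // ltW.
by rewrite sum_block_const // -[LHS]mulr_natr mulVf ?gt_eqF.
Qed.

Lemma quadratic_mgf l (x : 'cV[R]_d) lam :
  (0 < l <= n)%N -> dotp x x <= 1 -> `|lam| <= 16^-1 ->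
  (\int[P]_w (expR (lam * \sum_(i < l)
      (dotp x (noise_comb xi (block_weight (n %/ l) i) w) ^+ 2 - dotp x x)))%:E
    <= (expR (l%:R * (bernstein_const R * lam ^+ 2)))%:E)%E.
Proof.
move=> /andP[l0 ln] x1 hlam; set k := (n %/ l)%N.
have k0 : (0 < k)%N by rewrite divn_gt0.
pose F i := g_sigma_algebra_preimage (xi i).
pose J (a : nat) : pred 'I_n := fun j => in_block k a j.
pose f (a : nat) w :=
  expR (lam * (dotp x (noise_comb xi (block_weight k a) w) ^+ 2 - dotp x x)).
under eq_integral do rewrite mulr_sumr expR_sum.
have [ind _ _ _] := noise.
rewrite (@expectation_prod_blocks _ _ _ P n F J f).
- suff /andP[_] : (0 <= \prod_(a < l) \int[P]_w (f a w)%:E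
      <= \prod_(a < l) (expR (bernstein_const R * lam ^+ 2))%:E)%E.
    move=> h; apply: (le_trans h).
    by rewrite prodEFin lee_fin -expR_sum sumr_const card_ord mulr_natl.
  apply: prode_le => a; rewrite integral_ge0 => [|w _]; last first.
    by rewrite lee_fin expR_ge0.
  apply: mgf_centered_square => //.
  + exact: measurable_noise_comb.
  + move=> t; apply: le_trans (noise_comb_mgf noise _ x t) _.
    rewrite sum_sqr_block_weight ?mem_block_size // mul1r lee_fin ler_expR.
    by have := ler_wpM2l (sqr_ge0 t) x1; lra.
  + by rewrite (noise_comb_second_moment noise) sum_sqr_block_weight ?mem_block_size // mul1r.
  + by rewrite dotp_ge0.
- exact: noise_sets_measurable.
- exact: noise_setsI.
- exact: noise_setsT.
- exact: ind.
- by move=> a b i; rewrite /J !in_blockE // => /eqP -> /eqP ->.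
- move=> a; apply: measurableT_comp => //; apply: measurable_funM; first exact: measurable_cst.
  apply: measurable_funB; last exact: measurable_cst.
  apply: measurable_funX; apply: block_measurable_noise_comb => i.
  by rewrite /J /block_weight => /negPf ->.
- by move=> a w; exact: expR_ge0.
Qed.

(** With [lam = sqrt (d / l) / 16] the Chernoff exponent is
    [(bernstein_const / 256 - quadratic_const / 16) d = - 8 d]. *)
Definition quadratic_const : R := 128 + bernstein_const R / 16.

Lemma quadratic_const_ge0 : 0 <= quadratic_const.
Proof. by rewrite /quadratic_const; have := bernstein_const_ge0 R; lra. Qed.

(** Bernstein's inequality for the sum over blocks of centred squares, in the
    directions of the net. The condition [d <= l] keeps the optimal parameter
    within the range where the centred squares have a sub-Gaussian moment
    generating function. *)
Lemma quadratic_tail l : (0 < d <= l)%N -> (l <= n)%N ->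
  exists B, [/\ measurable B, (P B <= (expR (- d%:R))%:E)%E &
    forall w, ~ B w -> forall x,
      `|dotp x (sigma_hat (fun j => col_of_tuple (xi j w)) l *m x)
        - (n %/ l)%N%:R^-1 * dotp x x|
      <= 5 * quadratic_const * (Num.sqrt (d * l)%N%:R / n%:R) * dotp x x].
Proof.
move=> /andP[d0 dl] ln; have l0 : (0 < l)%N by exact: leq_trans dl.
set k := (n %/ l)%N; have k0 : (0 < k)%N by rewrite divn_gt0.
have kR : 0 < k%:R :> R by rewrite ltr0n.
have lR : 0 < l%:R :> R by rewrite ltr0n.
have dR : 0 < d%:R :> R by rewrite ltr0n.
have nR : 0 < n%:R :> R by rewrite ltr0n (leq_trans l0).
have [s [size_s ball net]] := @ball_net R d d0.
have tau0 := quadratic_const_ge0.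
pose S x w := \sum_(i < l) (dotp x (noise_comb xi (block_weight k i) w) ^+ 2 - dotp x x).
have mS x : measurable_fun setT (S x).
  apply: measurable_sum => i; apply: measurable_funB; last exact: measurable_cst.
  by apply: measurable_funX; exact: measurable_noise_comb.
pose r := quadratic_const * Num.sqrt (d * l)%N%:R.
pose lam : R := 16^-1 * Num.sqrt (d%:R / l%:R).
have lam0 : 0 < lam by rewrite mulr_gt0 // sqrtr_gt0 divr_gt0.
have lam1 : lam <= 16^-1.
  by rewrite ler_piMr // -[leRHS]sqrtr1 ler_wsqrtr // ler_pdivrMr // mul1r ler_nat.
have lam2 : lam ^+ 2 = 256^-1 * (d%:R / l%:R).
  by rewrite exprMn sqr_sqrtr ?divr_ge0 ?ler0n // exprVn -natrX.
have lamr : lam * r = quadratic_const / 16 * d%:R.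
  have sqrt_dl : Num.sqrt (d * l)%N%:R = Num.sqrt (d%:R / l%:R) * l%:R :> R.
    rewrite natrM (_ : d%:R * l%:R = d%:R / l%:R * l%:R ^+ 2); last first.
      by field; rewrite gt_eqF.
    by rewrite sqrtrM ?divr_ge0 ?ler0n // sqrtr_sqr ger0_norm ?ler0n.
  rewrite /lam /r sqrt_dl; set sg := Num.sqrt _.
  have -> : 16^-1 * sg * (quadratic_const * (sg * l%:R))
      = quadratic_const / 16 * l%:R * sg ^+ 2 by ring.
  rewrite sqr_sqrtr ?divr_ge0 ?ler0n //.
  by field; rewrite gt_eqF.
pose A (e : R) x := [set w | r < e * S x w].
have mA e x : measurable (A e x).
  have -> : A e x = (fun w => e * S x w) @^-1` `]r, +oo[%classic.
    by apply/seteqP; split=> w /=; rewrite in_itv /= andbT.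
  rewrite -[X in measurable X]setTI.
  have me : measurable_fun setT (fun w => e * S x w).
    by apply: measurable_funM => //; exact: measurable_cst.
  by apply: (me measurableT); exact: measurable_itv.
have PA e x : `|e| = 1 -> x \in s -> (P (A e x) <= (expR (- (8 * d%:R)))%:E)%E.
  move=> e1 xs.
  have me : measurable_fun setT (fun w => e * S x w).
    by apply: measurable_funM => //; exact: measurable_cst.
  have e2 : e ^+ 2 = 1 by rewrite -(real_normK (num_real e)) e1 expr1n.
  have := @chernoff_gt _ _ _ P (fun w => e * S x w) lam r
    (l%:R * (bernstein_const R * lam ^+ 2)) me lam0.
  have -> : (\int[P]_w (expR (lam * (e * S x w)))%:E
      = \int[P]_w (expR (lam * e * S x w))%:E)%E.
    by apply: eq_integral => w _; rewrite mulrA.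
  have hle : `|lam * e| <= 16^-1 by rewrite normrM e1 mulr1 ger0_norm // ltW.
  have := @quadratic_mgf l x (lam * e) (introT andP (conj l0 ln)) (ball x xs) hle.
  rewrite exprMn e2 mulr1 => hq /(_ hq) /le_trans; apply.
  rewrite lee_fin ler_expR lamr lam2 /quadratic_const.
  have -> : l%:R * (bernstein_const R * (256^-1 * (d%:R / l%:R)))
      = bernstein_const R / 256 * d%:R by field; rewrite gt_eqF.
  lra.
exists (\big[setU/set0]_(x <- s) (A 1 x `|` A (-1) x)); split.
- by apply: bigsetU_measurable => x _; exact: measurableU.
- apply: le_trans (prob_bigsetU_le _ _ _ _) _; first by move=> x; exact: measurableU.
  apply: (@le_trans _ _ (\sum_(x <- s) (2 * expR (- (8 * d%:R)))%:E)%E).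
    rewrite big_seq [leRHS]big_seq; apply: lee_sum => x xs.
    apply: le_trans (measureU2 _ _ _) _ => //.
    by rewrite mulr_natl mulr2n EFinD leeD // PA ?normrN ?normr1.
  rewrite sumEFin lee_fin big_const_seq count_predT iter_addr_0 -[leLHS]mulr_natl.
  apply: le_trans (net_size_bound R d0); rewrite mulrA ler_wpM2r ?expR_ge0 //.
  by rewrite -natrM ler_nat mulnC leq_mul2l size_s orbT.
move=> w nB.
pose Y j := col_of_tuple (xi j w).
pose Z : 'M[R]_d := sigma_hat Y l - k%:R^-1%:M.
have ZE (x y : 'cV[R]_d) : dotp x (Z *m y) = dotp x (sigma_hat Y l *m y) - k%:R^-1 * dotp x y.
  by rewrite mulmxBl mul_scalar_mx !dotpE.
have symZ : Z^T = Z by rewrite linearB /= tr_sigma_hat tr_scalar_mx.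
have ZS x : dotp x (Z *m x) = (l * k)%N%:R^-1 * S x w.
  rewrite ZE sigma_hat_form -/k /S sumrB sumr_const card_ord -mulr_natl natrM.
  set q := \sum_(i < l) _ * _.
  have -> : \sum_(i < l) dotp x (noise_comb xi (block_weight k i) w) ^+ 2 = k%:R * q.
    rewrite mulr_sumr; apply: eq_bigr => i _.
    by rewrite block_weight_comb // dotpZr exprMn sqr_sqrtr ?ler0n // expr2.
  by field; rewrite !gt_eqF.
have nlk : (l * k)%N%:R^-1 <= 2 / n%:R :> R.
  rewrite ler_pdivlMr // mulrC ler_pdivrMr ?ltr0n ?muln_gt0 ?l0 // -natrM ler_nat.
  have := divn_eq n l; have := ltn_pmod n l0; rewrite -/k.
  have : (l <= l * k)%N by rewrite leq_pmulr.
  by rewrite [(k * l)%N]mulnC; lia.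
have Sr x : x \in s -> `|S x w| <= r.
  move=> xs; rewrite leNgt; apply/negP => h; apply: nB; rewrite -bigcup_seq.
  exists x => //=; move: h; rewrite /A /= mul1r mulN1r.
  by case: (leP 0 (S x w)) => hs; [rewrite ger0_norm //; left|rewrite ltr0_norm //; right].
have le_net x : x \in s -> `|dotp x (Z *m x)| <= 2 / n%:R * r.
  move=> xs; rewrite ZS normrM ger0_norm ?invr_ge0 ?ler0n //.
  by apply: ler_pM; rewrite ?invr_ge0 ?ler0n ?Sr.
move=> x; rewrite -ZE; apply: le_trans (quadratic_form_le_net ball net symZ le_net x) _.
rewrite ler_wpM2r ?dotp_ge0 // /r.
have h : 0 <= quadratic_const * Num.sqrt (d * l)%N%:R / n%:R.
  by rewrite divr_ge0 ?ler0n // mulr_ge0 // sqrtr_ge0.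
lra.
Qed.

End tails.

(** * Selection of the number of buckets *)

Lemma descent_le (R : realDomainType) (e phi : nat -> R) (a b : nat) :
  (a <= b)%N ->
  (forall m, (a <= m < b)%N -> e m + phi m <= e m.+1 + phi m.+1) ->
  forall m, (a <= m <= b)%N -> e m + phi m <= e b + phi b.
Proof.
move=> ab step m /andP[am mb].
have : (m + (b - m) <= b)%N by rewrite subnKC.
rewrite -[in X in _ -> _ <= X](subnKC mb).
elim: (b - m)%N => [|k IH] hk; first by rewrite addn0.
apply: (le_trans (IH _)); first by lia.
by rewrite addnS step //; lia.
Qed.

(** The oracle index [ms] is the least one from which on the bias is dominated by
    the noise. Above [ms] two consecutive estimators are close to [u], so all these
    comparisons succeed and the selected index [mt] is at most [ms]. From [ms] down
    to [mt] consecutive estimators differ by at most the accepted thresholds, which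
    decrease geometrically. With the threshold [s] alone this keeps the selected
    estimator within a multiple of [sqrt (s ms)] of [u], which suffices unless [u] is much larger
    than that. In the latter case it shows that all estimators on the way have norm
    at least [|u| / 2], and then the second threshold gives the faster rate
    [s ms / |u|]. The noise level is kept as [s^2 / (s + |u|^2)], which is within a
    factor 2 of the minimum of [s] and [s^2 / |u|^2]. *)
Lemma lepski_oracle (R : realType) d (C1 : R) (M : nat) (s b : nat -> R)
    (x : nat -> 'cV[R]_d) (u : 'cV[R]_d) (mt : nat) :
  1 <= C1 ->
  (forall j, 0 < s j) ->
  (forall j, 49 / 36 * s j <= s j.+1 <= 3 / 2 * s j) ->
  b M = 0 ->
  (forall j, (j <= M)%N -> loss (x j) u ^+ 2 * (s j + enorm u ^+ 2)
     <= C1 * (b j * (s j + enorm u ^+ 2) + s j ^+ 2)) ->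
  let adm m := forall j, (m < j <= M)%N ->
     loss (x j) (x j.-1) ^+ 2 <= 4 * (4 * C1) ^+ 2 * s j /\
     loss (x j) (x j.-1) ^+ 2 * enorm (x j) ^+ 2 <= 4 * (4 * C1) ^+ 2 * s j ^+ 2 in
  (mt <= M)%N -> adm mt -> (forall m, (m <= M)%N -> adm m -> (mt <= m)%N) ->
  let A := 8 * C1 in
  exists ms, [/\ (ms <= M)%N,
    loss (x mt) u ^+ 2 * (s ms + enorm u ^+ 2)
      <= 64 * A ^+ 2 * (3 + 256 * A ^+ 2) * s ms ^+ 2 &
    (0 < ms)%N -> s ms.-1 ^+ 2 < b ms.-1 * (s ms.-1 + enorm u ^+ 2)].
Proof.
move=> C11 s0 sS bM oracle adm mtM admmt mtmin A.
set X := enorm u ^+ 2 in oracle *; have X0 : 0 <= X by exact: sqr_ge0.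
have sX j : 0 < s j + X by rewrite ltr_wpDr.
pose good (j : nat) := b j * (s j + X) <= s j ^+ 2.
pose tail (m : nat) := [forall j : 'I_M.+1, (m <= j)%N ==> good j].
have tailP m : reflect (forall j, (m <= j <= M)%N -> good j) (tail m).
  apply: (iffP forallP) => [h j /andP[mj jM]|h j].
    by have /implyP/(_ mj) := h (Ordinal (jM : (j < M.+1)%N)).
  by apply/implyP => mj; apply: h; rewrite mj -ltnS ltn_ord.
have exm : exists m, tail m.
  exists M; apply/tailP => j; rewrite -eqn_leq => /eqP <-.
  by rewrite /good bM mul0r sqr_ge0.
have [ms /tailP goodms minms] := ex_minnP exm.
have msM : (ms <= M)%N.
  by apply: minms; apply/tailP => j; rewrite -eqn_leq => /eqP <-; rewrite /good bM mul0r sqr_ge0.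
exists ms; split=> //; last first.
  move=> ms0; rewrite ltNge; apply/negP => h.
  suff /minms : tail ms.-1 by lia.
  apply/tailP => j hj; have [/eqP <-//|hne] := boolP (ms.-1 == j).
  by apply: goodms; move: hj hne; lia.
pose e m := loss (x m) u; have e0 m : 0 <= e m by exact: loss_ge0.
have eg j : (ms <= j <= M)%N -> e j ^+ 2 * (s j + X) <= 2 * C1 * s j ^+ 2.
  move=> hj; have := goodms j hj; rewrite /good => hg.
  have /andP[_ jM] := hj; apply: le_trans (oracle j jM) _.
  by rewrite [2 * C1]mulrC -mulrA ler_wpM2l ?(le_trans ler01) //; lra.
have C10 : 0 < C1 by lra.
have C10' : 0 <= C1 by lra.
have admms : adm ms.
  move=> [|j] // hj; have /= /andP[sl su] := sS j.
  have h1 := eg j.+1; have h2 := eg j; rewrite -/(e j) in h2.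
  have /andP[hj1 hj2] := hj.
  have {}h1 := h1 (introT andP (conj (ltnW hj1) hj2)).
  have {}h2 := h2 (introT andP (conj hj1 (ltnW hj2))).
  set L := loss _ _; have L0 : 0 <= L by exact: loss_ge0.
  have tri : L <= e j.+1 + e j by rewrite /e (loss_sym (x j)); exact: loss_triangle.
  have L2 : L ^+ 2 <= 2 * e j.+1 ^+ 2 + 2 * e j ^+ 2.
    have : L ^+ 2 <= (e j.+1 + e j) ^+ 2 by rewrite ler_sqr ?nnegrE ?addr_ge0.
    have := sqr_ge0 (e j.+1 - e j); rewrite !expr2; lra.
  have sj := s0 j; have sj1 := s0 j.+1.
  have h3 : e j ^+ 2 * (s j.+1 + X) <= 3 * C1 * s j.+1 ^+ 2.
    have a1 : s j.+1 + X <= 3 / 2 * (s j + X) by lra.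
    have a2 := ler_wpM2l (sqr_ge0 (e j)) a1.
    have a3 : s j ^+ 2 <= s j.+1 ^+ 2 by rewrite ler_sqr ?nnegrE; lra.
    have := ler_wpM2l (ltW C10) a3; lra.
  have h4 : L ^+ 2 * (s j.+1 + X) <= 10 * C1 * s j.+1 ^+ 2.
    by have := ler_wpM2r (ltW (sX j.+1)) L2; lra.
  have C2 : C1 <= C1 ^+ 2 by rewrite expr2 ler_peMl // ltW.
  split.
    rewrite -(ler_pM2r sj1); apply: (@le_trans _ _ (10 * C1 * s j.+1 ^+ 2)).
      by apply: le_trans h4; rewrite ler_wpM2l ?sqr_ge0 // lerDl.
    by have := mulr_ge0 (ltW C10) (sqr_ge0 (s j.+1)); have := ler_wpM2r (sqr_ge0 (s j.+1)) C2; rewrite !expr2; lra.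
  have xn : enorm (x j.+1) ^+ 2 <= 4 * C1 * (s j.+1 + X).
    have a1 := loss_enorm (x j.+1) u.
    have a2 : enorm (x j.+1) ^+ 2 <= 2 * X + 2 * e j.+1 ^+ 2.
      have : enorm (x j.+1) ^+ 2 <= (enorm u + e j.+1) ^+ 2.
        by rewrite ler_sqr ?nnegrE ?addr_ge0 ?enorm_ge0.
      have := sqr_ge0 (enorm u - e j.+1); rewrite /X !expr2; lra.
    have a3 : e j.+1 ^+ 2 <= 2 * C1 * s j.+1.
      rewrite -(ler_pM2r sj1) -[leRHS]mulrA -expr2; apply: le_trans h1.
      by rewrite ler_wpM2l ?sqr_ge0 // lerDl.
    by have := ler_wpM2r X0 C11; lra.
  have := ler_wpM2l (sqr_ge0 L) xn.
  have := ler_wpM2l (ltW C10) h4.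
  have := mulr_ge0 (sqr_ge0 C1) (sqr_ge0 (s j.+1)); rewrite !expr2; lra.
have mtms := mtmin ms msM admms.
have A8 : 8 <= A by rewrite /A; lra.
have A0 : 0 < A by lra.
have A0' : 0 <= A by lra.
have sqrA : 4 * (4 * C1) ^+ 2 = A ^+ 2 by rewrite /A; ring.
have CA : 2 * C1 <= A ^+ 2 by rewrite /A expr2; have := mulr_ge0 (ltW C10) (ltW C10); have := ler_wpM2l (ltW C10) C11; lra.
clearbody A.
pose L m := loss (x m.+1) (x m).
have L0 m : 0 <= L m by exact: loss_ge0.
have eL m : e m <= e m.+1 + L m.
  by rewrite addrC /L loss_sym; exact: loss_triangle.
pose Q m := Num.sqrt (s m).
have Q0 m : 0 < Q m by rewrite sqrtr_gt0.
have Q0' m : 0 <= Q m by exact: sqrtr_ge0.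
have s0' m : 0 <= s m by exact: ltW.
have Q2 m : Q m ^+ 2 = s m by rewrite sqr_sqrtr // ltW.
(* the scales grow at least by 49/36 = (7/6)^2, so that Q m.+1 <= 7 (Q m.+1 - Q m) *)
have QS m : 7 * Q m <= 6 * Q m.+1.
  rewrite -ler_sqr ?nnegrE ?mulr_ge0 // !exprMn !Q2.
  by have /andP[h _] := sS m; lra.
have LQ m : (mt <= m < ms)%N -> L m <= A * Q m.+1.
  move=> hm; rewrite -ler_sqr ?nnegrE ?mulr_ge0 // exprMn Q2 -sqrA.
  have /andP[h1 h2] := hm; have [|h _] := admmt m.+1; last by [].
  by rewrite ltnS h1 (leq_trans h2).
have LN m : (mt <= m < ms)%N -> L m * enorm (x m.+1) <= A * s m.+1.
  move=> hm; rewrite -ler_sqr ?nnegrE ?mulr_ge0 ?enorm_ge0 // !exprMn -sqrA.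
  have /andP[h1 h2] := hm; have [|_ h] := admmt m.+1; last by [].
  by rewrite ltnS h1 (leq_trans h2).
have ems2 : e ms ^+ 2 * (s ms + X) <= 2 * C1 * s ms ^+ 2.
  by apply: eg; rewrite leqnn.
have emsQ : e ms <= A * Q ms.
  rewrite -ler_sqr ?nnegrE ?mulr_ge0 // exprMn Q2 -(ler_pM2r (s0 ms)).
  apply: (@le_trans _ _ (2 * C1 * s ms ^+ 2)).
    by apply: le_trans ems2; rewrite ler_wpM2l ?sqr_ge0 // lerDl.
  by rewrite -[leRHS]mulrA -expr2 ler_wpM2r ?sqr_ge0.
have emQ m : (mt <= m <= ms)%N -> e m <= 8 * A * Q ms.
  move=> hm.
  suff : e m + 7 * A * Q m <= e ms + 7 * A * Q ms.
    by have := mulr_ge0 A0' (Q0' m); lra.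
  apply: (descent_le (e := e) (phi := fun m => 7 * A * Q m) mtms _ hm) => k hk.
  have := eL k; have := LQ k hk; have := ler_wpM2l A0' (QS k); lra.
have smsX := sX ms; have sms := s0 ms.
have mtmt : (mt <= mt <= ms)%N by rewrite leqnn.
have emt := emQ mt mtmt.
have emt2 : e mt ^+ 2 <= 64 * A ^+ 2 * s ms.
  have : e mt ^+ 2 <= (8 * A * Q ms) ^+ 2.
    by rewrite ler_sqr ?nnegrE // !mulr_ge0.
  by rewrite !exprMn Q2; lra.
have A2 : 0 <= A ^+ 2 by exact: sqr_ge0.
have [Xs|Xl] := leP X (256 * A ^+ 2 * s ms).
  apply: (@le_trans _ _ (64 * A ^+ 2 * s ms * (s ms + 256 * A ^+ 2 * s ms))).
    by apply: ler_pM; rewrite ?sqr_ge0 ?(ltW smsX) // lerD2l.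
  have := mulr_ge0 A2 (sqr_ge0 (s ms)); rewrite !expr2; lra.
pose nu := enorm u.
have nu0' : 0 <= nu by exact: enorm_ge0.
have nuQ : 16 * A * Q ms <= nu.
  rewrite -ler_sqr ?nnegrE ?enorm_ge0 ?mulr_ge0 // !exprMn Q2 -/X; lra.
have nu0 : 0 < nu by apply: lt_le_trans nuQ; rewrite !mulr_gt0.
have half m : (mt <= m <= ms)%N -> nu / 2 <= enorm (x m).
  by move=> hm; have := emQ m hm; have := loss_enorm u (x m); rewrite loss_sym -/nu -/(e m); lra.
have Lnu m : (mt <= m < ms)%N -> L m * nu <= 2 * A * s m.+1.
  move=> hm; have /andP[h1 h2] := hm.
  have := half m.+1; rewrite h2 (leq_trans h1) // => /(_ isT); have := LN m hm.
  by move=> a1 a2; have := ler_wpM2l (L0 m) a2; lra.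
(* since 4/3 <= 49/36, each step 2 A s / nu is at most the decrease of 8 A s / nu *)
have emtnu : e mt * nu + 8 * A * s mt <= e ms * nu + 8 * A * s ms.
  apply: (descent_le (e := fun m => e m * nu) (phi := fun m => 8 * A * s m) mtms _ mtmt).
  move=> m hm; have := ler_wpM2r (ltW nu0) (eL m); have := Lnu m hm.
  by have /andP[h _] := sS m; have := ler_wpM2l (ltW A0) h; have := mulr_gt0 A0 (s0 m.+1); lra.
have emsnu : e ms * nu <= A * s ms.
  rewrite -ler_sqr ?nnegrE ?mulr_ge0 // !exprMn -/X.
  apply: (@le_trans _ _ (2 * C1 * s ms ^+ 2)); last by rewrite ler_wpM2r ?sqr_ge0.
  by apply: le_trans ems2; rewrite ler_wpM2l ?sqr_ge0 // lerDr ltW.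
have fin : e mt * nu <= 9 * A * s ms by have := mulr_gt0 A0 (s0 mt); lra.
have fin2 : e mt ^+ 2 * X <= 81 * A ^+ 2 * s ms ^+ 2.
  have : (e mt * nu) ^+ 2 <= (9 * A * s ms) ^+ 2.
    by rewrite ler_sqr ?nnegrE ?mulr_ge0 // ltW.
  by rewrite !exprMn -/X; lra.
have sleX : s ms <= X.
  apply: ltW; apply: le_lt_trans Xl; rewrite ler_peMl //.
  by have := ler_wpM2l (ltW A0) A8; rewrite expr2; lra.
have := ler_wpM2l (sqr_ge0 (e mt)) sleX; rewrite -/(e mt).
have := mulr_ge0 A2 (sqr_ge0 (s ms)); have := mulr_ge0 (mulr_ge0 A2 A2) (sqr_ge0 (s ms)).
by rewrite !expr2; lra.
Qed.

(** * Error of the spectral estimator for a fixed number of buckets *)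

Lemma enorm_sqr_triangle (R : realType) d (u v w : 'cV[R]_d) :
  u = v + w -> enorm u ^+ 2 <= 2 * enorm v ^+ 2 + 2 * enorm w ^+ 2.
Proof. by move=> ->; exact: sqr_enormD_le. Qed.

(** The sample covariance minus [I/k] is compared with the rank one matrix of
    [theta + Ws], the estimator that knows the signs, rather than with that of
    [theta]. The error [Ws] of this oracle is common to all numbers of buckets and
    may exceed the selection thresholds, whereas only the difference [D] of the
    noise weights depends on the buckets. *)
Lemma theta_tilde_error (R : realType) n d l (vmax : 'M[R]_d -> 'cV[R]_d)
    (f : 'I_n -> R) (theta : 'cV[R]_d) (xi : 'I_n -> 'cV[R]_d) (zeta : R) :
  top_eigenvector vmax -> 0 <= 1 - purity f l ->
  (forall x, `|dotp x (sigma_hat xi l *m x) - (n %/ l)%N%:R^-1 * dotp x x|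
     <= zeta * dotp x x) ->
  let Y j := f j *: theta + xi j in
  let Ws := \sum_j (n%:R^-1 * f j) *: xi j in
  let D := \sum_j (block_coef f l j - n%:R^-1 * f j) *: xi j in
  let Delta := (1 - purity f l) * enorm theta ^+ 2 + 2 * (enorm theta * enorm D)
               + zeta + enorm Ws ^+ 2 in
  loss (theta_tilde vmax Y l) (theta + Ws) ^+ 2 <= 3 * Delta /\
  loss (theta_tilde vmax Y l) (theta + Ws) ^+ 2 * enorm (theta + Ws) ^+ 2 <= 6 * Delta ^+ 2.
Proof.
move=> top a1 hz Y Ws D Delta; rewrite [enorm (_ + _) ^+ 2]sqr_enorm.
set k := (n %/ l)%N in hz *; set a := purity f l in a1 *.
have [eigv nv] := top _ (tr_sigma_hat Y l).
apply: (spectral_perturbation (tr_sigma_hat Y l) eigv nv) => x y; rewrite -/k.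
pose Z : 'M[R]_d := sigma_hat xi l - k%:R^-1%:M.
have ZE (u v : 'cV[R]_d) : dotp u (Z *m v) = dotp u (sigma_hat xi l *m v) - k%:R^-1 * dotp u v.
  by rewrite mulmxBl mul_scalar_mx !dotpE.
have symZ : Z^T = Z by rewrite linearB /= tr_sigma_hat tr_scalar_mx.
have hZ : `|dotp x (Z *m y)| <= zeta * (enorm x * enorm y).
  by apply: polarization => // u; rewrite ZE.
pose W := l%:R^-1 *: \sum_(i < l) block_mean k f i *: block_avg k xi i.
have DE : W = Ws + D.
  rewrite /W sum_block_coef -big_split; apply: eq_bigr => j _ /=.
  by rewrite -scalerDl addrC subrK.
have WE (u : 'cV[R]_d) : l%:R^-1 * (\sum_(i < l) block_mean k f i * dotp u (block_avg k xi i))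
    = dotp u Ws + dotp u D.
  rewrite -dotpDr -DE dotpZr dotp_sumr; congr (_ * _).
  by apply: eq_bigr => i _; rewrite dotpZr.
have SE : dotp x (sigma_hat Y l *m y) = a * (dotp x theta * dotp y theta)
    + dotp x theta * (dotp y Ws + dotp y D) + (dotp x Ws + dotp x D) * dotp y theta
    + dotp x (sigma_hat xi l *m y).
  rewrite !sigma_hat_form -/k -!WE /a /purity -/k.
  set q1 := \sum_(i < l) _ ^+ 2; set q2 := \sum_(i < l) block_mean k f i * dotp y _.
  set q3 := \sum_(i < l) block_mean k f i * dotp x _.
  set q4 := \sum_(i < l) dotp x (block_avg k xi i) * dotp y (block_avg k xi i).
  transitivity (l%:R^-1 * (q1 * (dotp x theta * dotp y theta) + dotp x theta * q2
      + q3 * dotp y theta + q4)); last by ring.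
  congr (_ * _); rewrite [q1 * _]mulr_suml [_ * q2]mulr_sumr [q3 * _]mulr_suml -!big_split /=.
  by apply: eq_bigr => i _; rewrite block_avg_signal !dotpE; ring.
have errE : dotp x (sigma_hat Y l *m y) - k%:R^-1 * dotp x y
      - dotp x (theta + Ws) * dotp (theta + Ws) y
    = - ((1 - a) * (dotp x theta * dotp y theta)) + dotp x theta * dotp y D
      + dotp x D * dotp y theta + dotp x (Z *m y) - dotp x Ws * dotp y Ws.
  by rewrite SE ZE [dotp (theta + Ws) y]dotpC !dotpE; ring.
rewrite errE /Delta -/a.
have cs (u v : 'cV[R]_d) : `|dotp x u * dotp y v| <= (enorm u * enorm v) * (enorm x * enorm y).
  rewrite normrM; apply: (@le_trans _ _ ((enorm x * enorm u) * (enorm y * enorm v))).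
    by apply: ler_pM => //; exact: cauchy_schwarz.
  by rewrite le_eqVlt; apply/orP; left; apply/eqP; ring.
have c1 := cs theta theta; have c2 := cs theta D; have c3 := cs D theta; have c4 := cs Ws Ws.
have c1' : `|(1 - a) * (dotp x theta * dotp y theta)|
    <= (1 - a) * (enorm theta * enorm theta * (enorm x * enorm y)).
  by rewrite normrM (ger0_norm a1) ler_wpM2l.
clear - c1' c2 c3 c4 hZ.
move: c1' c2 c3 c4 hZ; rewrite !ler_norml => /andP[? ?] /andP[? ?] /andP[? ?] /andP[? ?] /andP[? ?].
by rewrite !expr2; apply/andP; split; lra.
Qed.

(** The threshold is infinite in its second part when the estimator vanishes, where
    the second condition is trivial as well. *)
Lemma le_threshold (R : realType) n d (vmax : 'M[R]_d -> 'cV[R]_d)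
    (Y : 'I_n -> 'cV[R]_d) (l : nat) (c v : R) :
  (0 < n)%N -> (0 < d * l)%N -> 0 < c ->
  let s := Num.sqrt (d * l)%N%:R / n%:R in
  (v%:E <= c%:E * threshold vmax Y l)%E =
    (v <= c * s) && (v * enorm (theta_tilde vmax Y l) ^+ 2 <= c * s ^+ 2).
Proof.
move=> n0 dl0 c0 s; have nR : 0 < n%:R :> R by rewrite ltr0n.
have dlR : 0 < (d * l)%N%:R :> R by rewrite ltr0n.
have s2 : s ^+ 2 = (d * l)%N%:R / n%:R ^+ 2 by rewrite exprMn sqr_sqrtr ?ltW // exprVn.
rewrite -lee_pdivrMl // -EFinM le_min lee_fin mulrC ler_pdivrMr // (mulrC s).
congr andb; set e := enorm _.
have [e0|e0] := eqVneq e 0.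
  rewrite e0 expr0n mulr0 inve0 gt0_muley ?lte_fin // leey.
  by rewrite mulr0 mulr_ge0 ?sqr_ge0 ?ltW.
have ep : 0 < e by rewrite lt_def e0 enorm_ge0.
have e2 : 0 < e ^+ 2 by rewrite exprn_gt0.
have ne : 0 < n%:R ^+ 2 * e ^+ 2 by rewrite mulr_gt0 // exprn_gt0.
rewrite inver gt_eqF // -EFinM lee_fin s2 -(ler_pM2l (mulr_gt0 c0 e2)).
congr (_ <= _); last by field; rewrite !gt_eqF.
by field; rewrite gt_eqF.
Qed.

(** * Balancing bias and noise *)

(** Multiplying the squared error by [s] uses its bound by [Delta], and by [X] its
    bound by [Delta^2 / X]. Every mixed term is absorbed by completing squares,
    because [rho^4 <= rho^2 (2 X + 58 s)] turns a squared bias into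
    [B^2 rho^2 (s + X)] and [dn <= s]. *)
Lemma oracle_error_algebra (R : realType) (rho D X s dn w2 a1 B K3 Delta L : R) :
  0 <= rho <= 1 -> 0 <= D -> 0 < s <= 1 -> 0 <= dn <= s -> 0 <= a1 <= B -> 0 <= X ->
  0 <= K3 -> 0 <= w2 <= 29 * dn -> D ^+ 2 <= 29 * (a1 * dn + 2 * s ^+ 2) ->
  rho ^+ 2 <= 2 * X + 2 * w2 ->
  Delta = a1 * rho ^+ 2 + 2 * (rho * D) + K3 * s + w2 ->
  0 <= L -> L <= 3 * Delta -> L * X <= 6 * Delta ^+ 2 ->
  L * (s + X) <= 100 * (K3 + 29) ^+ 2 * (B ^+ 2 * rho ^+ 2 * (s + X) + s ^+ 2).
Proof.
move=> /andP[rho0 rho1] D0 /andP[s0 s1] /andP[dn0 dns] /andP[a0 aB] X0 K0 /andP[w0 w1].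
move=> hD hrho DE L0 L3 L6.
set r := rho ^+ 2 in hrho DE *; have r0 : 0 <= r by exact: sqr_ge0.
have r1 : r <= 1 by rewrite /r expr_le1.
set c := K3 + 29; have c29 : 29 <= c by rewrite /c; lra.
set b := B ^+ 2 * r; have b0 : 0 <= b by rewrite mulr_ge0 ?sqr_ge0.
have B0 : 0 <= B by lra.
set G := b * (s + X).
have s2 : 0 <= s ^+ 2 by exact: sqr_ge0.
have h1 : r <= 2 * X + 58 * s by lra.
have h2 : (B * r) ^+ 2 <= 58 * G.
  have := ler_wpM2l b0 h1; have := mulr_ge0 b0 X0.
  by rewrite /G /b !expr2; clear; lra.
have dn2 : dn ^+ 2 <= s ^+ 2 by rewrite ler_sqr ?nnegrE; lra.
have h3 : B * r * dn <= 29 * G + s ^+ 2 / 2.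
  have := sqr_ge0 (B * r - dn); rewrite sqrrB mulr2n.
  by move: h2 dn2; clear; lra.
have h4 : r * D ^+ 2 <= 29 * (B * r * dn + 2 * s ^+ 2).
  have e1 := ler_wpM2l r0 hD; have e2 := ler_wpM2r (mulr_ge0 r0 dn0) aB.
  have e3 := ler_wpM2r s2 r1.
  by move: e1 e2 e3; clear; lra.
have h5 : r * D ^+ 2 <= 841 * G + 73 * s ^+ 2 by move: h3 h4 s2; clear; lra.
have rD : (rho * D) ^+ 2 = r * D ^+ 2 by rewrite exprMn.
have Dl0 : 0 <= Delta.
  by rewrite DE !addr_ge0 ?mulr_ge0 // ltW.
have h6 : Delta <= B * r + 2 * (rho * D) + c * s.
  have := ler_wpM2r r0 aB; rewrite DE /c; move: w1 dns; clear; lra.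
have h7 : Delta ^+ 2 <= 3 * ((B * r) ^+ 2 + 4 * (rho * D) ^+ 2 + c ^+ 2 * s ^+ 2).
  apply: (@le_trans _ _ ((B * r + 2 * (rho * D) + c * s) ^+ 2)).
    by rewrite ler_sqr ?nnegrE // (le_trans Dl0).
  have := sqr_ge0 (B * r - 2 * (rho * D)); have := sqr_ge0 (B * r - c * s).
  have := sqr_ge0 (2 * (rho * D) - c * s).
  by rewrite !expr2; clear; lra.
have h8 : L * X <= 18 * (3422 * G + 292 * s ^+ 2 + c ^+ 2 * s ^+ 2).
  by move: L6 h7 h5 h2; rewrite rD; clear; lra.
have h9 : L * s <= 3 * (870 * G + 75 * s ^+ 2 + c * s ^+ 2).
  have e1 := ler_wpM2r (ltW s0) (le_trans L3 (ler_wpM2l (ler0n R 3) h6)).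
  have e2 := sqr_ge0 (B * r - s); have e3 := sqr_ge0 (rho * D - s).
  have e4 : (rho * D) ^+ 2 <= 841 * G + 73 * s ^+ 2 by rewrite rD.
  move: e1 e2 e3 e4 h2 s2; rewrite !expr2.
  by clear; lra.
have G0 : 0 <= G by rewrite mulr_ge0 // addr_ge0 // ltW.
have c0 : 0 <= c by rewrite (le_trans _ c29) // ler0n.
have c2 : 29 * c <= c ^+ 2 by rewrite expr2 ler_wpM2r.
have c3 : 841 <= c ^+ 2 by move: c2 c29; clear; lra.
have e1 := ler_wpM2r G0 c3; have e2 := ler_wpM2r s2 c3; have e3 := ler_wpM2r s2 c2.
move: h8 h9 e1 e2 e3 G0 s2; clear; lra.
Qed.

(** Let [N] be the left-hand side, so that [N <= s] and [N X <= s^2]. If [g <= q],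
    then [N^2 <= s^2 <= d q / n^2]. Otherwise the bias condition [N < (q/g)^2 rho2]
    gives [N^2 <= (q/g)^2 rho2 N <= 60 (q/g)^2 s^2 <= 60 q d / n^2]. In both cases
    [N^2] is of order [q d / n^2], the square of the rate. *)
Lemma oracle_rate_algebra (R : realType) (n d g q delta s X rho2 : R) :
  0 < n -> 0 < d -> 0 < g -> 0 <= delta -> 0 <= X -> 0 < s ->
  s ^+ 2 = d * g / n ^+ 2 -> d / n <= s ->
  q = 2 * (delta * n) + 2 * d -> rho2 <= 2 * X + 58 * (d / n) ->
  s ^+ 2 < (q / g) ^+ 2 * rho2 * (s + X) ->
  s ^+ 2 / (s + X) <= 11 * (Num.sqrt (delta * d / n) + d / n).
Proof.
move=> n0 d0 g0 de0 X0 s0 s2 dns qE hrho hbias.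
have sX : 0 < s + X by rewrite ltr_wpDr.
set tau := _ + d / n; set N := s ^+ 2 / (s + X).
have dn0 : 0 < d / n by rewrite divr_gt0.
have sq0 : 0 <= delta * d / n by rewrite divr_ge0 ?mulr_ge0 // ltW.
have tau0 : 0 <= tau by rewrite addr_ge0 ?sqrtr_ge0 // ltW.
have q0 : 0 < q by rewrite qE ltr_wpDl ?mulr_ge0 ?mulr_gt0 // ltW.
have N0 : 0 <= N by rewrite divr_ge0 ?sqr_ge0 // ltW.
have NsX : N * (s + X) = s ^+ 2 by rewrite divfK // gt_eqF.
have NX0 : 0 <= N * X by rewrite mulr_ge0.
have Ns0 : 0 <= N * s by rewrite mulr_ge0 // ltW.
have Nles : N <= s.
  by rewrite -(ler_pM2r s0) -expr2 -NsX mulrDr lerDl.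
have qtau : q * d / n ^+ 2 <= 2 * tau ^+ 2.
  have -> : q * d / n ^+ 2 = 2 * (delta * d / n) + 2 * (d / n) ^+ 2.
    by rewrite qE; field; rewrite gt_eqF.
  rewrite -[X in 2 * X + _](sqr_sqrtr sq0) /tau.
  have := mulr_ge0 (sqrtr_ge0 (delta * d / n)) (ltW dn0); rewrite !expr2; clear; lra.
have main : N ^+ 2 <= 60 * (q * d / n ^+ 2).
  have qd0 : 0 <= q * d / n ^+ 2 by rewrite divr_ge0 ?sqr_ge0 // mulr_ge0 // ltW.
  have [gq|qg] := leP g q.
    apply: (@le_trans _ _ (s ^+ 2)); first by rewrite ler_sqr ?nnegrE // ltW.
    apply: (@le_trans _ _ (q * d / n ^+ 2)); last by move: qd0; clear; lra.
    by rewrite s2 ler_wpM2r ?invr_ge0 ?sqr_ge0 // mulrC ler_wpM2r // ltW.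
  have N1 : N <= (q / g) ^+ 2 * rho2.
    by rewrite /N ler_pdivrMr // ltW.
  have e1 : N ^+ 2 <= (q / g) ^+ 2 * rho2 * N by rewrite expr2 ler_wpM2r.
  have e2 : rho2 * N <= 60 * s ^+ 2.
    have := ler_wpM2r N0 hrho; have := ler_wpM2r N0 dns; rewrite -NsX.
    by move: NX0 Ns0; clear; lra.
  apply: (le_trans e1); rewrite -mulrA.
  apply: (le_trans (ler_wpM2l (sqr_ge0 (q / g)) e2)).
  rewrite s2.
  have -> : (q / g) ^+ 2 * (60 * (d * g / n ^+ 2)) = 60 * (q * d / n ^+ 2) * (q / g).
    by field; rewrite !gt_eqF.
  apply: ler_piMr; first by rewrite mulr_ge0.
  by rewrite ler_pdivrMr // mul1r ltW.
have tau11 : 0 <= 11 * tau by rewrite mulr_ge0.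
rewrite -ler_sqr ?nnegrE // [(11 * tau) ^+ 2]exprMn; apply: (le_trans main).
by move: qtau (sqr_ge0 tau); clear; rewrite !expr2; lra.
Qed.

(** * The favourable event *)

Definition signs (R : realType) (T : Type) n (eta : 'I_n -> T -> R) (w : T) (j : 'I_n) : R :=
  signb R (pattern eta w j).

(** For each of the [M+1] numbers of buckets there are two deviation events for the
    noise; two more concern the number of flips and the oracle estimator. Each
    fails with probability at most [e^-d]. *)
Lemma favourable_event (R : realType) disp (T : measurableType disp)
    (P : probability T R) (n d M : nat) (delta : R)
    (eta : 'I_n -> {RV P >-> R}) (xi : 'I_n -> {RV P >-> d.-tuple R}) :
  (0 < d)%N -> (2 ^ M * d <= n)%N -> 0 < delta < 1 / 2 ->
  sign_chain delta eta -> noise_model xi ->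
  independent2 P (g_sigma_preimage eta) (g_sigma_preimage xi) ->
  exists E, [/\ measurable E,
    ((1 - 4 * M.+1%:R * expR (- d%:R))%:E <= P E)%E &
    forall w, E w ->
      let f := signs (fun i => eta i) w in
      let X j := col_of_tuple (xi j w) in
      [/\ (flips_upto false (pattern (fun i => eta i) w) n)%:R
            <= 2 * (delta * n%:R) + 2 * d%:R,
          enorm (\sum_i (n%:R^-1 * f i) *: X i) ^+ 2
            <= 29 * (d%:R * \sum_i (n%:R^-1 * f i) ^+ 2),
          forall j, (j <= M)%N ->
            enorm (\sum_i (block_coef f (grid d j) i - n%:R^-1 * f i) *: X i) ^+ 2
              <= 29 * (d%:R * \sum_i (block_coef f (grid d j) i - n%:R^-1 * f i) ^+ 2)
        & forall j, (j <= M)%N -> forall x,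
            `|dotp x (sigma_hat X (grid d j) *m x)
               - (n %/ grid d j)%N%:R^-1 * dotp x x|
             <= 5 * quadratic_const R * (Num.sqrt (d * grid d j)%N%:R / n%:R) * dotp x x]].
Proof.
move=> d0 Mn hdelta chain noise ind.
have n0 : (0 < n)%N by apply: leq_trans Mn; rewrite muln_gt0 expn_gt0 d0.
pose eps : R := expR (- d%:R); have eps0 : 0 <= eps by exact: expR_ge0.
have linear (c : {ffun 'I_n -> bool} -> 'I_n -> R) : exists B,
    [/\ measurable B, (P B <= eps%:E)%E & forall w, ~ B w ->
      enorm (noise_comb xi (c (pattern (fun i => eta i) w)) w) ^+ 2
        <= 29 * (d%:R * \sum_i c (pattern (fun i => eta i) w) i ^+ 2)].
  have [A hA] := choice (fun z => linear_tail noise (c z) d0).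
  have mA z : measurable (A z) by have [] := hA z.
  have gA z : g_sigma_preimage xi (A z) by have [] := hA z.
  have PA z : (P (A z) <= eps%:E)%E by have [] := hA z.
  have [B [mB PB nB]] := conditional_union_bound n0 chain ind mA gA PA.
  exists B; split=> // w /nB nA.
  by have [_ _ _] := hA (pattern (fun i => eta i) w); exact.
pose c0 (z : {ffun 'I_n -> bool}) i : R := n%:R^-1 * signb R (z i).
pose cj j (z : {ffun 'I_n -> bool}) i : R :=
  block_coef (fun i => signb R (z i)) (grid d j) i - n%:R^-1 * signb R (z i).
have [B1 [mB1 PB1 hB1]] := flips_tail d%:R n0 hdelta chain.
have [B2 [mB2 PB2 hB2]] := linear c0.
have [B3 hB3] := choice (fun j : nat => linear (cj j)).
have gridP (j : 'I_M.+1) : (0 < d <= grid d j)%N && (grid d j <= n)%N.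
  rewrite d0 /grid leq_pmull ?expn_gt0 //=; apply: leq_trans Mn.
  by rewrite leq_mul2r leq_exp2l // -ltnS ltn_ord orbT.
have quad (j : 'I_M.+1) : exists B, [/\ measurable B, (P B <= eps%:E)%E &
    forall w, ~ B w -> forall x,
      `|dotp x (sigma_hat (fun j => col_of_tuple (xi j w)) (grid d j) *m x)
        - (n %/ grid d j)%N%:R^-1 * dotp x x|
      <= 5 * quadratic_const R * (Num.sqrt (d * grid d j)%N%:R / n%:R) * dotp x x].
  by have /andP[h1 h2] := gridP j; exact: quadratic_tail.
have [B4 hB4] := choice quad.
have mB3 j : measurable (B3 j) by have [] := hB3 j.
have mB4 j : measurable (B4 j) by have [] := hB4 j.
have PB3 j : (P (B3 j) <= eps%:E)%E by have [] := hB3 j.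
have PB4 j : (P (B4 j) <= eps%:E)%E by have [] := hB4 j.
pose B34 := \big[setU/set0]_(j : 'I_M.+1) (B3 j `|` B4 j).
have mB34 : measurable B34 by apply: bigsetU_measurable => j _; exact: measurableU.
have mB : measurable (B1 `|` B2 `|` B34) by apply: measurableU => //; exact: measurableU.
exists (~` (B1 `|` B2 `|` B34)); split.
- exact: measurableC.
- rewrite probability_setC // EFinB; apply: leeB => //.
  have e34 : (P B34 <= (M.+1%:R * (2 * eps))%:E)%E.
    apply: le_trans (prob_bigsetU_le _ _ _ _) _; first by move=> j; exact: measurableU.
    apply: (@le_trans _ _ (\sum_(j < M.+1) (2 * eps)%:E)%E).
      apply: lee_sum => j _; apply: le_trans (measureU2 _ _ _) _ => //.
      have -> : 2 * eps = eps + eps by ring.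
      by rewrite EFinD; apply: leeD; [exact: PB3|exact: PB4].
    by rewrite sumEFin sumr_const card_ord -[_ *+ M.+1]mulr_natl.
  apply: le_trans (measureU2 _ _ _) _ => //; first exact: measurableU.
  apply: (@le_trans _ _ ((eps + eps)%:E + (M.+1%:R * (2 * eps))%:E)%E).
    apply: leeD => //; apply: le_trans (measureU2 _ _ _) _ => //.
    by rewrite EFinD leeD.
  rewrite -EFinD lee_fin -/eps.
  have : 1 <= M.+1%:R :> R by rewrite ler1n.
  by move=> /(ler_wpM2r eps0); clear; lra.
move=> w nB; rewrite /= in nB.
have n1 : ~ B1 w by move=> h; apply: nB; left; left.
have n2 : ~ B2 w by move=> h; apply: nB; left; right.
have n34 (j : 'I_M.+1) : ~ B3 j w /\ ~ B4 j w.
  split=> h; apply: nB; right; rewrite /B34 -bigcup_seq; exists j;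
    rewrite /= ?mem_index_enum //; [left|right]; exact: h.
split.
- exact: hB1.
- exact: hB2.
- move=> j jM; have [h _] := n34 (Ordinal (jM : (j < M.+1)%N)).
  by have [_ _ /(_ w h)] := hB3 j.
- move=> j jM; have [_ h] := n34 (Ordinal (jM : (j < M.+1)%N)).
  by have [_ _ /(_ w h)] := hB4 (Ordinal (jM : (j < M.+1)%N)).
Qed.

Lemma grid_count_le (R : realType) (n d M : nat) : (0 < d)%N -> (2 ^ M * d <= n)%N ->
  M.+1%:R <= 2 * ln (expR 1 * n%:R / d%:R) :> R.
Proof.
move=> d0 Mn; have dR : 0 < d%:R :> R by rewrite ltr0n.
have e2 : expR (2^-1) <= 2 :> R.
  have := expR_ge1Dx (- 2^-1 : R); rewrite expRN => h.
  have h2 : 2^-1 <= (expR 2^-1)^-1 :> R by apply: le_trans h; lra.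
  by move: h2; rewrite lef_pV2 ?posrE ?expR_gt0.
have h : expR (1 + M%:R * 2^-1) <= expR 1 * n%:R / d%:R :> R.
  rewrite expRD expRM_natl -mulrA ler_wpM2l ?expR_ge0 // ler_pdivlMr //.
  apply: (@le_trans _ _ (2 ^+ M * d%:R)).
    by rewrite ler_wpM2r ?ler0n // lerXn2r ?nnegrE ?expR_ge0.
  by rewrite -natrX -natrM ler_nat.
have : 1 + M%:R * 2^-1 <= ln (expR 1 * n%:R / d%:R) :> R.
  by rewrite -[leLHS]expRK ler_ln ?posrE ?expR_gt0 // (lt_le_trans _ h) ?expR_gt0.
by rewrite -[M.+1%:R]natr1; lra.
Qed.

(** * Adaptive bound on the favourable event *)

(** The noise level of the sample covariance with [grid d j] buckets. *)
Definition scale (R : realType) (n d j : nat) : R :=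
  Num.sqrt (d * grid d j)%N%:R / n%:R.

Lemma grid_gt0 d j : (0 < d)%N -> (0 < grid d j)%N.
Proof. by move=> d0; rewrite muln_gt0 expn_gt0. Qed.

Lemma scale_gt0 (R : realType) n d j : (0 < n)%N -> (0 < d)%N -> 0 < scale R n d j.
Proof.
move=> n0 d0; rewrite divr_gt0 ?ltr0n // sqrtr_gt0 ltr0n muln_gt0 d0.
exact: grid_gt0.
Qed.

Lemma sqr_scale (R : realType) n d j :
  scale R n d j ^+ 2 = d%:R * (grid d j)%:R / n%:R ^+ 2.
Proof. by rewrite exprMn sqr_sqrtr ?ler0n // natrM exprVn. Qed.

Lemma scaleS (R : realType) n d j : (0 < n)%N -> (0 < d)%N ->
  49 / 36 * scale R n d j <= scale R n d j.+1 <= 3 / 2 * scale R n d j.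
Proof.
move=> n0 d0; have s0 := scale_gt0 R j n0 d0; have s1 := scale_gt0 R j.+1 n0 d0.
have sq : scale R n d j.+1 ^+ 2 = 2 * scale R n d j ^+ 2.
  by rewrite !sqr_scale /grid expnS -mulnA natrM; ring.
move: s0 s1 sq; move: (scale R n d j) (scale R n d j.+1) => a b a0 b0 sq.
have a2 := sqr_ge0 a.
have p1 : 0 <= 49 / 36 * a by rewrite mulr_ge0 // ltW.
have p2 : 0 <= 3 / 2 * a by rewrite mulr_ge0 // ltW.
have p3 := ltW b0.
by apply/andP; split; rewrite -ler_sqr ?nnegrE // sq exprMn; move: a2; clear;
  rewrite !expr2; lra.
Qed.

Lemma ratio_le_scale (R : realType) n d j : (0 < n)%N -> (0 < d)%N ->
  d%:R / n%:R <= scale R n d j.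
Proof.
move=> n0 d0; rewrite ler_wpM2r ?invr_ge0 ?ler0n //.
rewrite -[leLHS]ger0_norm ?ler0n // -sqrtr_sqr ler_wsqrtr // -natrX ler_nat.
by rewrite -mulnn leq_mul2l /grid leq_pmull ?expn_gt0 ?orbT.
Qed.

Lemma scale_le1 (R : realType) n d j : (0 < n)%N -> (d <= n)%N -> (grid d j <= n)%N ->
  scale R n d j <= 1.
Proof.
move=> n0 dn gn; rewrite ler_pdivrMr ?ltr0n // mul1r.
rewrite -[leRHS]ger0_norm ?ler0n // -sqrtr_sqr ler_wsqrtr // -natrX ler_nat -mulnn.
exact: leq_mul.
Qed.

Lemma truncation_loss (R : realType) n l : (0 < l <= n)%N ->
  (l * (n %/ l))%N%:R^-1 - n%:R^-1 <= 2 * (l%:R / n%:R ^+ 2) :> R.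
Proof.
move=> /andP[l0 ln]; set k := (n %/ l)%N.
have k0 : (0 < k)%N by rewrite divn_gt0.
have n0 : (0 < n)%N by exact: leq_trans ln.
have nR : 0 < n%:R :> R by rewrite ltr0n.
have lkR : 0 < (l * k)%N%:R :> R by rewrite ltr0n muln_gt0 l0.
have lR : 0 < l%:R :> R by rewrite ltr0n.
have kR : 0 < k%:R :> R by rewrite ltr0n.
have h1 : n%:R - (l * k)%N%:R <= l%:R :> R.
  rewrite lerBlDr -natrD ler_nat.
  by rewrite [X in (X <= _)%N](divn_eq n l) -/k mulnC addnC leq_add2r ltnW // ltn_pmod.
have h2 : n%:R <= 2 * (l * k)%N%:R :> R.
  have : l%:R <= (l * k)%N%:R :> R by rewrite ler_nat leq_pmulr.
  by move: h1; clear; lra.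
have -> : (l * k)%N%:R^-1 - n%:R^-1
    = (n%:R - (l * k)%N%:R) / ((l * k)%N%:R * n%:R) :> R by field; rewrite !gt_eqF.
rewrite ler_pdivrMr ?mulr_gt0 //; apply: (le_trans h1).
have -> : 2 * (l%:R / n%:R ^+ 2) * ((l * k)%N%:R * n%:R)
    = l%:R * (2 * (l * k)%N%:R / n%:R) :> R by field; rewrite gt_eqF.
by rewrite ler_peMr ?ler0n // ler_pdivlMr // mul1r.
Qed.

Definition oracle_const (R : realType) (K3 : R) : R := 100 * (K3 + 29) ^+ 2.
Definition selection_const (R : realType) (K3 : R) : R :=
  64 * (8 * oracle_const K3) ^+ 2 * (3 + 256 * (8 * oracle_const K3) ^+ 2).

(** By [theta_tilde_error] and [oracle_error_algebra] each estimator is within bias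
    plus noise of the oracle estimator [u]; the bias is at most [q / grid d j], where
    [q] bounds the number of flips, and vanishes for [j = M], where the blocks are
    singletons. Then [lepski_oracle] selects an index whose error is the noise level
    at [ms]. If [ms] is positive, the bias dominates the noise at its predecessor,
    and [oracle_rate_algebra] shows that this noise level is of the order of the
    rate. *)
Lemma adaptive_bound (R : realType) (n d M : nat) (delta K3 : R) (theta : 'cV[R]_d)
    (vmax : 'M[R]_d -> 'cV[R]_d) (z : 'I_n -> bool) (X : 'I_n -> 'cV[R]_d) :
  (1 <= d <= n)%N -> 0 <= delta -> enorm theta ^+ 2 <= 1 -> top_eigenvector vmax ->
  (2 ^ M * d <= n)%N -> (forall m, (2 ^ m * d <= n)%N -> (m <= M)%N) -> 0 <= K3 ->
  let f i := signb R (z i) in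
  (flips_upto false z n)%:R <= 2 * (delta * n%:R) + 2 * d%:R ->
  enorm (\sum_i (n%:R^-1 * f i) *: X i) ^+ 2
    <= 29 * (d%:R * \sum_i (n%:R^-1 * f i) ^+ 2) ->
  (forall j, (j <= M)%N ->
    enorm (\sum_i (block_coef f (grid d j) i - n%:R^-1 * f i) *: X i) ^+ 2
      <= 29 * (d%:R * \sum_i (block_coef f (grid d j) i - n%:R^-1 * f i) ^+ 2)) ->
  (forall j, (j <= M)%N -> forall x,
    `|dotp x (sigma_hat X (grid d j) *m x) - (n %/ grid d j)%N%:R^-1 * dotp x x|
      <= K3 * scale R n d j * dotp x x) ->
  forall Y, (Y = fun i => f i *: theta + X i) ->
  loss (theta_tilde vmax Y (l_tilde (4 * oracle_const K3) vmax Y M)) theta ^+ 2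
    <= (50 * selection_const K3 + 58)
       * (Num.sqrt (delta * d%:R / n%:R) + d%:R / n%:R).
Proof.
move=> /andP[d0 dn] de0 theta1 top Mn Mmax K30 f hflips hWs hD hZ Y YE.
have n0 : (0 < n)%N by exact: leq_trans dn.
have nR : 0 < n%:R :> R by rewrite ltr0n.
have dR : 0 < d%:R :> R by rewrite ltr0n.
have gridn j : (j <= M)%N -> (0 < grid d j <= n)%N.
  move=> jM; rewrite grid_gt0 //=; apply: leq_trans Mn.
  by rewrite leq_mul2r leq_exp2l // jM orbT.
have f1 i : f i ^+ 2 = 1 by exact: signb_sqr.
set Ws := \sum_i _ in hWs.
pose u := theta + Ws; pose rho := enorm theta; pose X2 := enorm u ^+ 2.
have rho0 : 0 <= rho by exact: enorm_ge0.
have rho1 : rho <= 1 by rewrite -(expr_le1 (n:=2)).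
have X20 : 0 <= X2 by exact: sqr_ge0.
have w2 : enorm Ws ^+ 2 <= 29 * (d%:R / n%:R).
  apply: (le_trans hWs); rewrite ler_pM2l ?ltr0n // ler_pM2l //.
  under eq_bigr do rewrite exprMn f1 mulr1.
  rewrite sumr_const card_ord -[_ *+ n]mulr_natr le_eqVlt; apply/orP; left; apply/eqP.
  by field; rewrite gt_eqF.
have rhoX : rho ^+ 2 <= 2 * X2 + 2 * enorm Ws ^+ 2.
  rewrite -[enorm Ws]enormN; apply: enorm_sqr_triangle.
  by rewrite /u addrK.
pose q := 2 * (delta * n%:R) + 2 * d%:R.
pose B j : R := if (j < M)%N then q / (grid d j)%:R else 0.
pose b j := B j ^+ 2 * rho ^+ 2.
pose s j := scale R n d j.
pose x j := theta_tilde vmax Y (grid d j).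
have s0 j : 0 < s j by exact: scale_gt0.
have q0 : 0 <= q by rewrite addr_ge0 // mulr_ge0 ?ler0n // mulr_ge0 ?ler0n.
have oracle j : (j <= M)%N -> loss (x j) u ^+ 2 * (s j + X2)
    <= oracle_const K3 * (b j * (s j + X2) + s j ^+ 2).
  move=> jM; have gj := gridn j jM; have /andP[g0 gn] := gj.
  have gR : 0 < (grid d j)%:R :> R by rewrite ltr0n.
  have a1 : 0 <= 1 - purity f (grid d j) by rewrite subr_ge0 purity_le1.
  have aB : 1 - purity f (grid d j) <= B j.
    rewrite /B; case: ifPn => [_|].
      apply: le_trans (impurity_le_flips R z gj) _.
      by rewrite ler_wpM2r // invr_ge0 ler0n.
    rewrite -leqNgt => Mj; have jE : j = M by apply/eqP; rewrite eqn_leq jM.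
    apply: impurity_singletons gj _; rewrite jE /grid mulnA -expnS ltnNge.
    by apply/negP => /Mmax; rewrite ltnn.
  have [e1 e2] := theta_tilde_error theta top a1 (hZ j jM).
  rewrite -YE in e1 e2.
  apply: (oracle_error_algebra (dn := d%:R / n%:R) _ _ _ _ _ _ _ _ _ rhoX erefl _ e1 e2).
  - by rewrite rho0.
  - exact: enorm_ge0.
  - by rewrite s0 scale_le1.
  - by rewrite divr_ge0 ?ler0n // ratio_le_scale.
  - by rewrite a1.
  - exact: X20.
  - exact: K30.
  - by rewrite sqr_ge0.
  - apply: (le_trans (hD j jM)); rewrite ler_pM2l ?ltr0n // sum_sqr_block_coef //.
    rewrite sqr_scale.
    have p0 := purity_ge0 (grid d j) f; have t0 := truncation_loss R gj.
    have pt : purity f (grid d j) * ((grid d j * (n %/ grid d j))%N%:R^-1 - n%:R^-1)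
        <= 2 * ((grid d j)%:R / n%:R ^+ 2).
      apply: (le_trans (ler_wpM2l p0 t0)); apply: ler_piMl.
        by rewrite mulr_ge0 ?ler0n // divr_ge0 ?ler0n // sqr_ge0.
      by rewrite -subr_ge0.
    have := ler_wpM2l (ltW dR) pt; rewrite mulrDr.
    by move: nR; clear; lra.
  - exact: sqr_ge0.
pose C1 := oracle_const K3.
have C11 : 1 <= C1.
  rewrite /C1 /oracle_const.
  have h : 29 <= K3 + 29 by rewrite lerDr.
  have h2 : 1 <= (K3 + 29) ^+ 2.
    by rewrite expr_ge1 // (le_trans _ h) // ler1n.
  by move: h2; clear; lra.
have C10 : 0 < 4 * (4 * C1) ^+ 2.
  by rewrite mulr_gt0 ?ltr0n // exprn_gt0 // mulr_gt0 ?ltr0n // (lt_le_trans ltr01).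
have dlg j : (0 < d * grid d j)%N by rewrite muln_gt0 d0 grid_gt0.
have admE (m : 'I_M.+1) : admissible (4 * C1) vmax Y M m <->
    (forall j, (m < j <= M)%N ->
       loss (x j) (x j.-1) ^+ 2 <= 4 * (4 * C1) ^+ 2 * s j /\
       loss (x j) (x j.-1) ^+ 2 * enorm (x j) ^+ 2 <= 4 * (4 * C1) ^+ 2 * s j ^+ 2).
  split.
    move=> /forallP h j /andP[mj jM].
    have /implyP/(_ mj) := h (Ordinal (jM : (j < M.+1)%N)).
    rewrite /= (le_threshold _ _ _ n0 (dlg _) C10) => /andP[h1 h2].
    by split.
  move=> h; apply/forallP => j; apply/implyP => mj.
  have jM : (j <= M)%N by rewrite -ltnS ltn_ord.
  have [|h1 h2] := h j; first by rewrite mj.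
  by rewrite (le_threshold _ _ _ n0 (dlg _) C10); apply/andP.
rewrite /l_tilde /m_tilde -/C1; case: arg_minnP => [|mt mtadm mtmin].
  by apply/admE => j /= /andP[h1 h2]; move: h1; rewrite ltnNge h2.
rewrite -/(x mt); have mtM : (mt <= M)%N by rewrite -ltnS ltn_ord.
have mtmin' m : (m <= M)%N -> (forall j, (m < j <= M)%N ->
       loss (x j) (x j.-1) ^+ 2 <= 4 * (4 * C1) ^+ 2 * s j /\
       loss (x j) (x j.-1) ^+ 2 * enorm (x j) ^+ 2 <= 4 * (4 * C1) ^+ 2 * s j ^+ 2) ->
    (mt <= m)%N.
  move=> mM h; apply: (mtmin (Ordinal (mM : (m < M.+1)%N))).
  by apply/admE.
have bM : b M = 0 by rewrite /b /B ltnn expr0n mul0r.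
have sS j : 49 / 36 * s j <= s j.+1 <= 3 / 2 * s j by exact: scaleS.
have [ms [msM hms minms]] := lepski_oracle C11 s0 sS bM oracle mtM
  (proj1 (admE mt) mtadm) mtmin'.
rewrite -/X2 -/(selection_const K3) in hms minms.
set K1 := selection_const K3 in hms *.
have K10 : 0 <= K1.
  have h := sqr_ge0 (8 * C1).
  rewrite /K1 /selection_const -/C1; move: ((8 * C1) ^+ 2) h => y h.
  have h64 : 0 <= 64 * y by rewrite mulr_ge0 ?ler0n.
  have h256 : 0 <= 256 * y by rewrite mulr_ge0 ?ler0n.
  by rewrite mulr_ge0 // addr_ge0 ?ler0n.
set tau := _ + d%:R / n%:R.
have dn0 : 0 <= d%:R / n%:R :> R by rewrite divr_ge0 ?ler0n.
have tau_dn : d%:R / n%:R <= tau by rewrite /tau lerDr sqrtr_ge0.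
have tau0 : 0 <= tau by exact: le_trans tau_dn.
have sX j : 0 < s j + X2 by rewrite ltr_wpDr.
have e0 : 0 <= loss (x mt) u ^+ 2 by exact: sqr_ge0.
have main : loss (x mt) u ^+ 2 <= 25 * K1 * tau.
  have [ms0|ms0] := posnP ms.
    have sd : s 0%N = d%:R / n%:R.
      by rewrite /s /scale /grid expn0 mul1n natrM -expr2 sqrtr_sqr ger0_norm ?ler0n.
    move: hms; rewrite ms0 => h.
    have : loss (x mt) u ^+ 2 <= K1 * s 0%N.
      rewrite -(ler_pM2r (s0 0%N)) -[leRHS]mulrA -expr2; apply: le_trans h.
      by rewrite ler_wpM2l // lerDl.
    rewrite sd; have := ler_wpM2l K10 tau_dn; have := mulr_ge0 K10 tau0.
    by clear; lra.
  have := minms ms0; have := ms0; case: ms ms0 msM hms minms => // j _ jM hms _ _ /=.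
  rewrite /b /B jM => hb.
  have gj : (0 < grid d j)%N by exact: grid_gt0.
  have rate : s j ^+ 2 / (s j + X2) <= 11 * tau.
    apply: (oracle_rate_algebra (q := q) (g := (grid d j)%:R) (rho2 := rho ^+ 2)) => //.
    - by rewrite ltr0n.
    - exact: sqr_scale.
    - exact: ratio_le_scale.
    - by apply: (le_trans rhoX); move: w2; clear; lra.
  have /andP[sl su] := sS j.
  have e1 : loss (x mt) u ^+ 2 * (s j + X2) <= 9 / 4 * K1 * s j ^+ 2.
    apply: (@le_trans _ _ (loss (x mt) u ^+ 2 * (s j.+1 + X2))).
      by rewrite ler_wpM2l // lerD2r; move: sl (s0 j); clear; lra.
    apply: (le_trans hms).
    have : s j.+1 ^+ 2 <= (3 / 2 * s j) ^+ 2.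
      by rewrite ler_sqr ?nnegrE ?mulr_ge0 // ltW.
    move=> h; have := ler_wpM2l K10 h; move: (s j) (s j.+1) => p p'.
    by clear; lra.
  have e2 : loss (x mt) u ^+ 2 <= 9 / 4 * K1 * (s j ^+ 2 / (s j + X2)).
    by rewrite mulrA ler_pdivlMr.
  have := ler_wpM2l K10 rate; have := mulr_ge0 K10 tau0; move: e2; clear; lra.
have tri : loss (x mt) theta <= loss (x mt) u + enorm Ws.
  apply: (le_trans (loss_triangle _ u _)); rewrite lerD2l.
  have -> : Ws = u - 1 *: theta by rewrite scale1r /u addrC addKr.
  by apply: loss_le; left.
have l0 := loss_ge0 (x mt) theta.
have : loss (x mt) theta ^+ 2 <= (loss (x mt) u + enorm Ws) ^+ 2.
  by rewrite ler_sqr ?nnegrE // (le_trans l0).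
move=> h; apply: (le_trans h).
have := sqr_ge0 (loss (x mt) u - enorm Ws).
move: main w2 tau_dn; move: (loss _ _) (enorm Ws) (_ / _) => p p' p''.
by rewrite sqrrB sqrrD !mulr2n; clear; lra.
Qed.

Theorem theorem13 (R : realType) :
  exists C K c0 c1 : R,
    [/\ 0 < C, 0 < K, 0 < c0 & 0 < c1] /\
    forall (n d : nat) (delta : R) (theta : 'cV[R]_d)
      (disp : measure_display) (T : measurableType disp) (P : probability T R)
      (eta : 'I_n -> {RV P >-> R}) (xi : 'I_n -> {RV P >-> d.-tuple R})
      (vmax : 'M[R]_d -> 'cV[R]_d) (M : nat),
    (1 <= d <= n)%N ->
    0 < delta < 1 / 2 ->
    enorm theta ^+ 2 <= 1 ->
    sign_chain delta eta ->
    noise_model xi ->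
    independent2 P (g_sigma_preimage eta) (g_sigma_preimage xi) ->
    top_eigenvector vmax ->
    (2 ^ M * d <= n)%N -> (forall m : nat, (2 ^ m * d <= n)%N -> (m <= M)%N) ->
    exists E : set T,
      [/\ measurable E,
          ((1 - c1 * ln (expR 1 * n%:R / d%:R) * expR (- (c0 * d%:R)))%:E
             <= P E)%E
        & forall w, E w ->
            let Y := observation eta xi theta w in
            loss (theta_tilde vmax Y (l_tilde C vmax Y M)) theta ^+ 2
              <= K * (Num.sqrt (delta * d%:R / n%:R) + d%:R / n%:R)].

Proof.
pose K3 : R := 5 * quadratic_const R.
have K30 : 0 <= K3 by rewrite mulr_ge0 ?ler0n // quadratic_const_ge0.
have C0 : 0 < oracle_const K3.
  by rewrite /oracle_const mulr_gt0 ?ltr0n // exprn_gt0 // ltr_wpDl.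
have S0 : 0 < selection_const K3.
  rewrite /selection_const; set y := (8 * _) ^+ 2.
  have y0 : 0 < y by rewrite exprn_gt0 // mulr_gt0 ?ltr0n.
  have h64 : 0 < 64 * y by rewrite mulr_gt0 ?ltr0n.
  have h256 : 0 < 256 * y by rewrite mulr_gt0 ?ltr0n.
  by rewrite mulr_gt0 // addr_gt0 ?ltr0n.
exists (4 * oracle_const K3), (50 * selection_const K3 + 58), 1, 8; split.
  have K0 : 0 < 50 * selection_const K3 by rewrite mulr_gt0 ?ltr0n.
  split; [|by rewrite addr_gt0 ?ltr0n|exact: ltr01|by rewrite ltr0n].
  by rewrite mulr_gt0 ?ltr0n.
move=> n d delta theta disp T P eta xi vmax M dn hdelta theta1 chain noise ind top Mn Mmax.
have /andP[d0 _] := dn; have /andP[de0 _] := hdelta.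
have [E [mE PE hE]] := favourable_event d0 Mn hdelta chain noise ind.
exists E; split=> //.
  apply: le_trans PE; rewrite lee_fin mul1r lerB // ler_wpM2r ?expR_ge0 //.
  by have := grid_count_le R d0 Mn; lra.
move=> w Ew /=; have [h1 h2 h3 h4] := hE w Ew.
apply: (adaptive_bound dn (ltW de0) theta1 top Mn Mmax K30 h1 h2 h3 h4).
by apply/funext => i; rewrite /observation -(patternE _ _ chain).
Qed.
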